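(* Let $S \subset \mathbb{D}$ be a set without accumulation points in $\mathbb{D}$ that is not a zero set for the Dirichlet space $\mathcal{D}$. Then there exists a sequence $\{z_n\}$ of points of $S$ that converges to a point of $\mathbb{T}$ such that the set $\{z_n\}$ is not a zero set for $\mathcal{D}$.
   Context: $\mathbb{D}$ is the open unit disc in $\mathbb{C}$ and $\mathbb{T}$ is the unit circle. The Dirichlet space $\mathcal{D}$ is the space of analytic functions $f$ on $\mathbb{D}$ with $\int_{\mathbb{D}}|f'|^2\,dA<\infty$, where $A$ is normalized area measure on $\mathbb{D}$. A set $S\subset\mathbb{D}$ is a zero set for $\mathcal{D}$ if there is a function $f\in\mathcal{D}$ that vanishes exactly on $S$, i.e. $f$ has a zero of multiplicity one at each point of $S$ and $f(z)\neq 0$ for every $z\in\mathbb{D}\setminus S$. *)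

(* Defs.v *)
From HB Require Import structures.
From mathcomp Require Import all_boot all_order all_algebra.
From mathcomp Require Import all_classical all_reals all_analysis.
From mathcomp Require Import complex.

Set Implicit Arguments.
Unset Strict Implicit.
Unset Printing Implicit Defensive.

Import Order.TTheory GRing.Theory Num.Theory.
Import numFieldNormedType.Exports.

Local Open Scope classical_set_scope.
Local Open Scope ring_scope.
Local Open Scope complex_scope.

(* R[i] with the topology and normed-module structure of the numeric field
   it is, in the same way as the analysis library does for abstract ones. *)
HB.instance Definition _ (R : realType) := PseudoPointedMetric.copy R[i] R[i]^o.
HB.instance Definition _ (R : realType) := NormedModule.copy R[i] R[i]^o.

Section DirichletZeroSets.
Variable R : realType.
Implicit Types (f : R[i] -> R[i]) (S : set R[i]) (z a : R[i]).

Definition unit_disc : set R[i] := [set z | `|z| < 1].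

Definition unit_circle : set R[i] := [set z | `|z| = 1].

(* [derivable] and [derive1] are over the field R[i]: complex differentiability
   and the complex derivative.  Values of f off the disc are irrelevant. *)
Definition analytic_on_disc f :=
  forall z, unit_disc z -> derivable f z 1.

(* The plane is identified with R * R, and normalized area measure is
   1/pi times Lebesgue measure there; [Normc.normc] is the R-valued modulus. *)
Definition dirichlet_integral f : \bar R :=
  ((pi^-1 : R)%:E * \int[lebesgue_measure \x lebesgue_measure]_(p in
      [set p : R * R | unit_disc (p.1 +i* p.2)])
    (ComplexField.Normc.normc (derive1 f (p.1 +i* p.2)) ^+ 2)%:E)%E.

Definition dirichlet_space f :=
  analytic_on_disc f /\ (dirichlet_integral f < +oo)%E.

Definition zero_of_multiplicity (m : nat) f a :=
  (forall k, (k < m)%N -> derive1n k f a = 0) /\ derive1n m f a != 0.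

Definition dirichlet_zero_set S :=
  S `<=` unit_disc /\
  exists f, [/\ dirichlet_space f,
    forall a, S a -> zero_of_multiplicity 1 f a &
    forall z, (unit_disc `\` S) z -> f z != 0].

End DirichletZeroSets.

Arguments unit_disc {R}.
Arguments unit_circle {R}.

(* Main.v *)
(** With [E(f) = sum (n + 1) |a_n|^2], a set [Z] in the punctured disc is called
    admissible when some [f] with [E(f)] finite has [f(0) = 1] and vanishes on [Z].
    The minimizer [p] of [E] among such [f] has no zeros outside [Z] and only
    simple zeros on [Z], so [S \ {0}] admissible makes [S] a zero set.  By the
    complete Pick property of the Dirichlet space (Kaluza's lemma for its kernel)
    minimizers are bounded, and a product of two bounded functions of finite
    Dirichlet integral has finite Dirichlet integral; so admissible sets form an
    ideal.  If [S] is not a zero set, compactness gives a point [zeta] all of whose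
    neighbourhoods meet [S \ {0}] in a non-admissible set; [zeta] is on the circle.
    By weak compactness, the part of [S \ {0}] in the [k]-th neighbourhood has a
    finite subset [F_k] admitting no [f] with [E(f) <= k].  The union of the [F_k]
    is not admissible, and its points converge to [zeta].

    The identification of the Dirichlet space with the sequences of finite energy
    needs power series expansions of analytic functions (Goursat's lemma on the
    cones over circular arcs) and the orthogonality of monomials on discs. *)
Require Import Defs.
From HB Require Import structures.
From mathcomp Require Import all_boot all_order all_algebra.
From mathcomp Require Import all_classical all_reals all_analysis.
From mathcomp Require Import measurable_realfun complex.
From mathcomp Require Import ring lra zify.

Set Implicit Arguments.
Unset Strict Implicit.
Unset Printing Implicit Defensive.

Import Order.TTheory GRing.Theory Num.Theory.
Import numFieldNormedType.Exports.

Local Open Scope classical_set_scope.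
Local Open Scope ring_scope.
Local Open Scope complex_scope.

(** * Complex series and power series *)

Section ComplexModulus.
Variable R : realType.
Notation C := R[i].
Implicit Types z w : C.

(** The Dirichlet space is not an algebra, so the zeros of two functions cannot simply be combined
    by multiplying them; bounded minimizers are what makes a union of two admissible sets
    admissible. The weight n + 1, which adds the squared Hardy norm to the Dirichlet integral,
    serves two ends: multiplication by z does not decrease the energy, which controls the zeros of
    minimizers, and the coefficients 1 / (n + 1) of the reproducing kernel are log-convex, which
    gives the Pick property. The origin is removed because of the normalization f(0) = 1; a zero
    there is restored by a factor z. Finite pieces are taken because the neighbourhoods of zeta
    shrink: the union of their whole traces would be the trace of the first one. Finite pieces leave
    all but finitely many points in each neighbourhood, while the energies they force grow without
    bound. No inner product is constructed: orthogonality is expressed through the quadratic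
    behaviour of [energy] along real lines. *)

Definition modulus z : R := ComplexField.Normc.normc z.
Arguments modulus : simpl never.

Lemma modulus_ge0 z : 0 <= modulus z.
Proof. by case: z => a b; rewrite /modulus /= sqrtr_ge0. Qed.

Lemma sqr_modulus z : modulus z ^+ 2 = complex.Re z ^+ 2 + complex.Im z ^+ 2.
Proof. by case: z => a b; rewrite /modulus /= sqr_sqrtr ?addr_ge0 ?sqr_ge0. Qed.

Lemma normE z : `|z| = (modulus z)%:C.
Proof. by case: z. Qed.

Lemma modulusM z w : modulus (z * w) = modulus z * modulus w.
Proof. exact: ComplexField.Normc.normcM. Qed.

Lemma modulusD z w : modulus (z + w) <= modulus z + modulus w.
Proof. exact: le_normcD. Qed.

Lemma modulusN z : modulus (- z) = modulus z.
Proof. exact: normcN. Qed.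

Lemma modulus0 : modulus 0 = 0.
Proof. exact: ComplexField.Normc.normc0. Qed.

Lemma modulus1 : modulus 1 = 1.
Proof. exact: ComplexField.Normc.normc1. Qed.

Lemma modulus_eq0 z : (modulus z == 0) = (z == 0).
Proof.
apply/eqP/eqP => [|->]; last exact: modulus0.
exact: ComplexField.Normc.eq0_normc.
Qed.

Lemma modulus_gt0 z : (0 < modulus z) = (z != 0).
Proof. by rewrite lt_neqAle modulus_ge0 andbT eq_sym modulus_eq0. Qed.

Lemma modulusX z n : modulus (z ^+ n) = modulus z ^+ n.
Proof.
elim: n => [|n IH]; first by rewrite !expr0 modulus1.
by rewrite !exprS modulusM IH.
Qed.

Lemma modulusV z : modulus z^-1 = (modulus z)^-1.
Proof. exact: ComplexField.Normc.normcV. Qed.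

Lemma modulusB z w : modulus (z - w) = modulus (w - z).
Proof. by rewrite -modulusN opprB. Qed.

Lemma modulus_real (x : R) : modulus x%:C = `|x|.
Proof. by rewrite /modulus /= expr0n addr0 sqrtr_sqr. Qed.

Lemma modulus_nat n : modulus n%:R = n%:R.
Proof. by rewrite -(rmorph_nat (real_complex R)) modulus_real ger0_norm. Qed.

Lemma modulus_conj z : modulus (conjc z) = modulus z.
Proof. by case: z => a b; rewrite /modulus /= sqrrN. Qed.

Lemma modulus_ltE z (x : R) : (`|z| < x%:C) = (modulus z < x).
Proof. by rewrite normE ltcR. Qed.

Lemma modulus_sum (I : Type) (r : seq I) (P : pred I) (F : I -> C) :
  modulus (\sum_(i <- r | P i) F i) <= \sum_(i <- r | P i) modulus (F i).
Proof.
elim/big_rec2: _ => [|i x y _ IH]; first by rewrite modulus0.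
by rewrite (le_trans (modulusD _ _))// lerD2l.
Qed.

Lemma Re_le_modulus z : `|complex.Re z| <= modulus z.
Proof. by have := normc_ge_Re z; rewrite normE lecR. Qed.

Lemma Im_le_modulus z : `|complex.Im z| <= modulus z.
Proof.
rewrite -(@ler_pXn2r _ 2) ?nnegrE ?modulus_ge0 ?normr_ge0//.
by rewrite sqr_modulus -normrX ger0_norm ?sqr_ge0// lerDr sqr_ge0.
Qed.

Lemma modulus_le_ReIm z : modulus z <= `|complex.Re z| + `|complex.Im z|.
Proof.
case: z => a b.
have -> : a +i* b = a%:C + 'i * b%:C by simpc.
rewrite (le_trans (modulusD _ _))// modulusM !modulus_real.
by simpc; rewrite /modulus/= expr0n expr1n add0r sqrtr1 mul1r.
Qed.

Lemma mulcJ z : z * conjc z = (modulus z ^+ 2)%:C.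
Proof.
by rewrite sqr_modulus; case: z => a b; simpc; congr (_ +i* _); ring.
Qed.

Lemma unit_discE z : unit_disc z <-> modulus z < 1.
Proof. by rewrite /unit_disc /= -modulus_ltE. Qed.

End ComplexModulus.
Arguments modulus : simpl never.

(** * Convergent sequences and absolutely convergent series of complex numbers *)

Section ComplexSeries.
Variable R : realType.
Notation C := R[i].
Implicit Types (u v : nat -> C) (l z : C).

(** Convergence in [R[i]] reduced to a real limit, so that the limit theorems for real sequences
    apply; [tends_cvg] translates it back to the topology used in the theorem. *)
Definition tends u l := (fun n => modulus (u n - l)) @ \oo --> (0 : R).

Lemma tendsP u l : tends u l <->
  forall e : R, 0 < e -> exists N, forall n, (N <= n)%N -> modulus (u n - l) < e.
Proof.
split=> [/cvgr0Pnorm_lt h e /h [N _ hN]|h].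
  by exists N => n /hN /=; rewrite ger0_norm ?modulus_ge0.
apply/cvgr0Pnorm_lt => e /h [N hN]; exists N => // n /hN /=.
by rewrite ger0_norm ?modulus_ge0.
Qed.

Lemma tends_le u l (x : nat -> R) : x @ \oo --> (0 : R) ->
  (forall n, modulus (u n - l) <= x n) -> tends u l.
Proof.
move=> x0 ux; apply: (squeeze_cvgr _ _ x0); last exact: cvg_cst.
by near=> n; rewrite modulus_ge0 ux.
Unshelve. all: by end_near. Qed.

Lemma tends_cst l : tends (fun=> l) l.
Proof. by rewrite /tends subrr modulus0; exact: cvg_cst. Qed.

Lemma tendsD u v l m : tends u l -> tends v m -> tends (fun n => u n + v n) (l + m).
Proof.
move=> ul vm; apply: (@tends_le _ _ (fun n => modulus (u n - l) + modulus (v n - m))).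
  by rewrite -[X in _ --> X](addr0 (0 : R)); exact: cvgD.
by move=> n; rewrite opprD addrACA modulusD.
Qed.

Lemma tendsZ u l z : tends u l -> tends (fun n => z * u n) (z * l).
Proof.
move=> ul; apply: (@tends_le _ _ (fun n => modulus z * modulus (u n - l))).
  by rewrite -[X in _ --> X](mulr0 (modulus z)); apply: cvgM => //; exact: cvg_cst.
by move=> n; rewrite -mulrBr modulusM.
Qed.

Lemma tendsN u l : tends u l -> tends (fun n => - u n) (- l).
Proof.
by move=> h; rewrite -mulN1r; under [fun _ => _]eq_fun do rewrite -mulN1r; exact: tendsZ.
Qed.

Lemma tendsB u v l m : tends u l -> tends v m -> tends (fun n => u n - v n) (l - m).
Proof. by move=> ul /tendsN vm; exact: tendsD. Qed.

Lemma tendsS u l : tends u l -> tends (fun n => u n.+1) l.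
Proof. by rewrite /tends => h; rewrite -(cvg_shiftS (fun n => modulus (u n - l))) in h. Qed.

Lemma tends_modulus u l : tends u l -> (fun n => modulus (u n)) @ \oo --> modulus l.
Proof.
move=> /tendsP ul; apply/cvgrPdist_lt => e /ul [N hN]; exists N => // n /hN /= h.
apply: le_lt_trans h; rewrite ler_norml; apply/andP; split.
  by have := modulusD (u n - l) l; rewrite subrK; lra.
by have := modulusD (l - u n) (u n); rewrite subrK modulusB; lra.
Qed.

Lemma tends_unique u l m : tends u l -> tends u m -> l = m.
Proof.
move=> ul um; have := tends_modulus (tendsB ul um).
under [fun _ => _]eq_fun do rewrite subrr modulus0.
move=> h; have h0 : modulus (l - m) = 0.
  by apply: (cvg_unique (@Rhausdorff R) h); exact: cvg_cst.
by apply/eqP; rewrite -subr_eq0 -modulus_eq0 h0.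
Qed.

Lemma tends_ext u v l : (forall n, u n = v n) -> tends u l -> tends v l.
Proof. by move=> /funext ->. Qed.

Lemma tends_modulus_le u l (x : R) : tends u l -> (forall n, modulus (u n) <= x) ->
  modulus l <= x.
Proof.
move=> /tends_modulus h ux; apply: (cvgr_to_le h); near=> n; exact: ux.
Unshelve. all: by end_near. Qed.

Definition abs_summable u (S : R) := forall N, \sum_(i < N) modulus (u i) <= S.

(** Total by the default value of [limn]; it is the sum of the series as soon as [abs_summable]
    holds for some bound. *)
Definition csum u : C :=
  (limn (series (fun n => complex.Re (u n)))) +i* (limn (series (fun n => complex.Im (u n)))).

Lemma Re_sum (I : Type) (r : seq I) (F : I -> C) :
  complex.Re (\sum_(i <- r) F i) = \sum_(i <- r) complex.Re (F i).
Proof. by elim/big_rec2: _ => // i y1 y2 _ <-; case: (F i) y2 => ? ? []. Qed.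

Lemma Im_sum (I : Type) (r : seq I) (F : I -> C) :
  complex.Im (\sum_(i <- r) F i) = \sum_(i <- r) complex.Im (F i).
Proof. by elim/big_rec2: _ => // i y1 y2 _ <-; case: (F i) y2 => ? ? []. Qed.

Lemma bounded_real_series_cvg (x : nat -> R) (S : R) :
  (forall N, \sum_(i < N) `|x i| <= S) -> cvgn (series x).
Proof.
move=> h; apply: normed_cvg; apply: nondecreasing_is_cvgn.
  by apply: nondecreasing_series => n _ _; exact: normr_ge0.
by exists S => _ [n _ <-]; rewrite /= /series /= big_mkord; exact: h.
Qed.

Lemma csum_tends u S : abs_summable u S -> tends (fun N => \sum_(i < N) u i) (csum u).
Proof.
move=> us.
have cRe : cvgn (series (fun n => complex.Re (u n))).
  apply: (@bounded_real_series_cvg _ S) => N; apply: le_trans (us N).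
  by apply: ler_sum => i _; exact: Re_le_modulus.
have cIm : cvgn (series (fun n => complex.Im (u n))).
  apply: (@bounded_real_series_cvg _ S) => N; apply: le_trans (us N).
  by apply: ler_sum => i _; exact: Im_le_modulus.
have dist0 (x : nat -> R) : cvgn (series x) ->
    (fun n => `|series x n - limn (series x)|) @ \oo --> (0 : R).
  by move=> cx; apply/norm_cvg0P; rewrite -(subrr (limn (series x))); apply: cvgB => //; exact: cvg_cst.
apply: (@tends_le _ _ (fun n => `|series (fun n => complex.Re (u n)) n -
    limn (series (fun n => complex.Re (u n)))| +
    `|series (fun n => complex.Im (u n)) n - limn (series (fun n => complex.Im (u n)))|)).
  by rewrite -[X in _ --> X](addr0 (0 : R)); apply: cvgD; exact: dist0.
move=> N /=.
rewrite (le_trans (modulus_le_ReIm _))//=.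
rewrite /series/= !big_mkord -Re_sum -Im_sum /csum.
by case: (\sum_(i < N) u i).
Qed.
End ComplexSeries.

(** * Power series in the unit disc and their termwise differentiation *)

Section PowerSeries.
Variable R : realType.
Notation C := R[i].
Implicit Types (a b : nat -> C) (z w : C).

Lemma geometric_sum_le (q : R) N : 0 <= q -> q < 1 ->
  \sum_(i < N) q ^+ i <= (1 - q)^-1.
Proof.
move=> q0 q1; rewrite -[leRHS]mul1r ler_pdivlMr ?subr_gt0//.
have /(congr1 -%R) := subrX1 q N; rewrite -mulNr !opprB mulrC => <-.
by rewrite gerBl exprn_ge0.
Qed.

Lemma mul_natr_geometric_bound (q : R) n : 0 <= q -> q < 1 ->
  n%:R * q ^+ n <= (1 - q)^-1.
Proof.
move=> q0 q1; apply: le_trans (geometric_sum_le n q0 q1).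
rewrite mulr_natl -[X in _ *+ X]card_ord -sumr_const.
by apply: ler_sum => i _; rewrite ler_wiXn2l ?(ltW q1)// ltnW.
Qed.

(** Radius of convergence at least 1, in Abel's form: the terms are bounded at every r < 1, and
    comparison with a geometric series from a larger radius gives absolute convergence. *)
Definition radius1 a :=
  forall r : R, 0 <= r -> r < 1 -> exists M, forall n, modulus (a n) * r ^+ n <= M.

Definition ev a z := csum (fun n => a n * z ^+ n).

Lemma radius1_summable a (r : R) : radius1 a -> 0 <= r -> r < 1 ->
  exists2 S : R, 0 <= S & forall N, \sum_(i < N) modulus (a i) * r ^+ i <= S.
Proof.
move=> ra r0 r1; pose s := (1 + r) / 2.
have [s0 s1 rs] : [/\ 0 < s, s < 1 & r < s] by rewrite /s; split; lra.
have [M hM] := ra s (ltW s0) s1.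
have M0 : 0 <= M by apply: le_trans (hM 0%N); rewrite mulr_ge0 ?modulus_ge0// exprn_ge0// ltW.
have q0 : 0 <= r / s by rewrite divr_ge0// ltW.
have q1 : r / s < 1 by rewrite ltr_pdivrMr// mul1r.
exists (M * (1 - r / s)^-1).
  by rewrite mulr_ge0// invr_ge0 subr_ge0 ltW.
move=> N; apply: (@le_trans _ _ (\sum_(i < N) M * (r / s) ^+ i)); last first.
  by rewrite -mulr_sumr ler_wpM2l// geometric_sum_le.
apply: ler_sum => i _; rewrite expr_div_n mulrA ler_pdivlMr ?exprn_gt0//.
by rewrite -mulrA [_ ^+ _ * _ ^+ _]mulrC mulrA ler_wpM2r ?exprn_ge0// hM.
Qed.

Lemma radius1_abs_summable a z : radius1 a -> modulus z < 1 ->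
  exists2 S : R, 0 <= S & abs_summable (fun n => a n * z ^+ n) S.
Proof.
move=> ra z1; have [S S0 h] := radius1_summable ra (modulus_ge0 z) z1.
exists S => // N; apply: le_trans (h N).
by apply: ler_sum => i _; rewrite modulusM modulusX.
Qed.

Lemma ev_tends a z : radius1 a -> modulus z < 1 ->
  tends (fun N => \sum_(i < N) a i * z ^+ i) (ev a z).
Proof. by move=> ra z1; have [S _ /csum_tends] := radius1_abs_summable ra z1. Qed.

Lemma ev_le a z S : radius1 a -> modulus z < 1 ->
  (forall N, \sum_(i < N) modulus (a i) * modulus z ^+ i <= S) -> modulus (ev a z) <= S.
Proof.
move=> ra z1 h; apply: (tends_modulus_le (ev_tends ra z1)) => N.
apply: le_trans (h N); apply: le_trans (modulus_sum _ _ _) _.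
by apply: ler_sum => i _; rewrite modulusM modulusX.
Qed.

Lemma ev_at0 a : radius1 a -> ev a 0 = a 0%N.
Proof.
move=> ra; apply: (@tends_unique _ (fun N => \sum_(i < N.+1) a i * 0 ^+ i)).
  by apply: (tendsS (ev_tends ra _)); rewrite modulus0.
apply: tends_ext (tends_cst _) => n.
by rewrite big_ord_recl expr0 mulr1 big1 ?addr0// => i _; rewrite expr0n mulr0.
Qed.

Lemma radius1_bound a (M : R) : (forall n, modulus (a n) <= M) -> radius1 a.
Proof.
move=> h r r0 r1; exists M => n; apply: le_trans (h n).
by rewrite ler_piMr ?modulus_ge0// exprn_ile1// ltW.
Qed.

Lemma radius1D a b : radius1 a -> radius1 b -> radius1 (fun n => a n + b n).
Proof.
move=> ra rb r r0 r1; have [M hM] := ra r r0 r1; have [K hK] := rb r r0 r1.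
exists (M + K) => n; apply: le_trans (lerD (hM n) (hK n)).
by rewrite -mulrDl ler_wpM2r ?exprn_ge0// modulusD.
Qed.

Lemma radius1Z a (c : C) : radius1 a -> radius1 (fun n => c * a n).
Proof.
move=> ra r r0 r1; have [M hM] := ra r r0 r1.
by exists (modulus c * M) => n; rewrite modulusM -mulrA ler_wpM2l ?modulus_ge0.
Qed.

Lemma evD a b z : radius1 a -> radius1 b -> modulus z < 1 ->
  ev (fun n => a n + b n) z = ev a z + ev b z.
Proof.
move=> ra rb z1; apply: tends_unique (ev_tends (radius1D ra rb) z1) _.
apply: tends_ext (tendsD (ev_tends ra z1) (ev_tends rb z1)) => n.
by rewrite -big_split/=; apply: eq_bigr => i _; rewrite mulrDl.
Qed.

Lemma evZ a (c : C) z : radius1 a -> modulus z < 1 ->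
  ev (fun n => c * a n) z = c * ev a z.
Proof.
move=> ra z1; apply: tends_unique (ev_tends (radius1Z _ ra) z1) _.
apply: tends_ext (tendsZ c (ev_tends ra z1)) => n.
by rewrite mulr_sumr; apply: eq_bigr => i _; rewrite mulrA.
Qed.

Definition shift_seq a n := if n is m.+1 then a m else 0.

Lemma radius1_shift a : radius1 a -> radius1 (shift_seq a).
Proof.
move=> ra r r0 r1; have [M hM] := ra r r0 r1; exists M => -[|n] /=.
  rewrite modulus0 mul0r; apply: le_trans (hM 0%N).
  by rewrite mulr_ge0 ?modulus_ge0// exprn_ge0.
rewrite exprSr mulrA; apply: le_trans (hM n).
by rewrite ler_piMr ?mulr_ge0 ?modulus_ge0 ?exprn_ge0// ltW.
Qed.

Lemma ev_shift a z : radius1 a -> modulus z < 1 -> ev (shift_seq a) z = z * ev a z.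
Proof.
move=> ra z1; apply: tends_unique (tendsS (ev_tends (radius1_shift ra) z1)) _.
apply: tends_ext (tendsZ z (ev_tends ra z1)) => n.
rewrite big_ord_recl /= mul0r add0r mulr_sumr; apply: eq_bigr => i _.
by rewrite /bump add1n exprS mulrCA.
Qed.

Definition drop_seq k a n := a (k + n)%N.

Lemma radius1_drop k a : radius1 a -> radius1 (drop_seq k a).
Proof.
move=> ra r r0 r1; have [r00|rn0] := eqVneq r 0.
  exists (modulus (a k)) => -[|n]; first by rewrite /drop_seq addn0 mulr1.
  by rewrite r00 expr0n mulr0 modulus_ge0.
have rp : 0 < r by rewrite lt_neqAle eq_sym rn0.
have [M hM] := ra r r0 r1; exists (M / r ^+ k) => n.
by rewrite ler_pdivlMr ?exprn_gt0// -mulrA -exprD addnC hM.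
Qed.

Lemma ev_drop1 a z : radius1 a -> modulus z < 1 ->
  ev a z = a 0%N + z * ev (drop_seq 1 a) z.
Proof.
move=> ra z1; apply: tends_unique (tendsS (ev_tends ra z1)) _.
apply: tends_ext (tendsD (tends_cst (a 0%N)) (tendsZ z (ev_tends (radius1_drop 1 ra) z1))) => n.
rewrite big_ord_recl /= expr0 mulr1 mulr_sumr; congr (_ + _); apply: eq_bigr => i _.
by rewrite /bump /drop_seq exprS mulrCA.
Qed.

Lemma radius1_natmul a : radius1 a -> radius1 (fun n => n%:R * a n).
Proof.
move=> ra r r0 r1; pose s := (1 + r) / 2.
have [s0 s1 rs] : [/\ 0 < s, s < 1 & r < s] by rewrite /s; split; lra.
have [M hM] := ra s (ltW s0) s1.
have q0 : 0 <= r / s by rewrite divr_ge0// ltW.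
have q1 : r / s < 1 by rewrite ltr_pdivrMr// mul1r.
exists (M * (1 - r / s)^-1) => n.
have -> : modulus (n%:R * a n) * r ^+ n = modulus (a n) * s ^+ n * (n%:R * (r / s) ^+ n).
  have sn : s ^+ n != 0 by rewrite expf_neq0// gt_eqF.
  rewrite modulusM modulus_nat (expr_div_n r s); move: (s ^+ n) sn (r ^+ n) (modulus (a n)) n%:R => t t0 u v w.
  by field.
apply: ler_pM => //; last exact: mul_natr_geometric_bound.
  by rewrite mulr_ge0 ?modulus_ge0// exprn_ge0// ltW.
by rewrite mulr_ge0// exprn_ge0.
Qed.

Definition deriv_seq a n := n.+1%:R * a n.+1.

Lemma deriv_seqE a : deriv_seq a = drop_seq 1 (fun n => n%:R * a n).
Proof. by []. Qed.

Lemma radius1_deriv a : radius1 a -> radius1 (deriv_seq a).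
Proof. by move=> ra; rewrite deriv_seqE; apply/radius1_drop/radius1_natmul. Qed.

(** Differentiability as a first-order expansion, free of quotients and with h = 0 allowed; [cdiffP]
    identifies it with the limit of difference quotients. *)
Definition cdiff (f : C -> C) z (l : C) := forall e : R, 0 < e ->
  exists2 d : R, 0 < d & forall h : C, modulus h < d ->
    modulus (f (z + h) - f z - l * h) <= e * modulus h.

(** Induction on n: the remainder for n + 1 is (z + h) times that for n, plus n z^(n-1) h^2. The
    factor [r ^+ 2] on the left stands for an exponent n - 2 on the right, which would be truncated
    for n < 2. *)
Lemma binomial_remainder_le (r : R) (z h : C) n : 0 <= r ->
  modulus z <= r -> modulus (z + h) <= r ->
  r ^+ 2 * modulus ((z + h) ^+ n - z ^+ n - n%:R * z ^+ n.-1 * h)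
    <= n%:R ^+ 2 * modulus h ^+ 2 * r ^+ n.
Proof.
move=> r0 zr zhr; elim: n => [|n IH].
  by rewrite !expr0 subrr !mul0r subr0 modulus0 mulr0 !expr0n !mul0r.
have -> : (z + h) ^+ n.+1 - z ^+ n.+1 - n.+1%:R * z ^+ n.+1.-1 * h =
    (z + h) * ((z + h) ^+ n - z ^+ n - n%:R * z ^+ n.-1 * h) + n%:R * z ^+ n.-1 * h ^+ 2.
  case: n {IH} => [|n]; first by rewrite !expr0 !expr1; ring.
  by rewrite /= -!(natr1 n.+1) !exprS; ring.
apply: (@le_trans _ _ (r * (n%:R ^+ 2 * modulus h ^+ 2 * r ^+ n)
    + n%:R * modulus h ^+ 2 * r ^+ n.+1)).
  apply: le_trans (_ : _ <= r ^+ 2 * (modulus ((z + h) * ((z + h) ^+ n - z ^+ n - n%:R * z ^+ n.-1 * h)) + modulus (n%:R * z ^+ n.-1 * h ^+ 2))) _.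
    by rewrite ler_wpM2l ?exprn_ge0// modulusD.
  rewrite mulrDr lerD//.
    rewrite modulusM mulrCA; apply: ler_pM => //; first exact: modulus_ge0.
    by rewrite mulr_ge0 ?exprn_ge0 ?modulus_ge0.
  rewrite !modulusM modulus_nat !modulusX.
  case: n {IH} => [|n /=]; first by rewrite !mul0r mulr0.
  have -> : n.+1%:R * modulus h ^+ 2 * r ^+ n.+2 = r ^+ 2 * (n.+1%:R * r ^+ n * modulus h ^+ 2).
    by rewrite !exprS; ring.
  rewrite ler_wpM2l ?exprn_ge0// ler_wpM2r ?mulr_ge0 ?modulus_ge0//.
  by rewrite ler_wpM2l// lerXn2r ?nnegrE ?modulus_ge0.
have -> : r * (n%:R ^+ 2 * modulus h ^+ 2 * r ^+ n) + n%:R * modulus h ^+ 2 * r ^+ n.+1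
   = (n%:R ^+ 2 + n%:R) * (modulus h ^+ 2 * r ^+ n.+1) by rewrite [r ^+ n.+1]exprS; ring.
rewrite -mulrA ler_wpM2r ?mulr_ge0 ?exprn_ge0 ?modulus_ge0//.
rewrite -natr1; have : 0 <= n%:R :> R by []; nra.
Qed.

(** For r between |z| and 1, the binomial remainders add up to at most |h|^2 / r^2 times the
    convergent sum of n^2 |a_n| r^n. *)
Lemma ev_cdiff a z : radius1 a -> modulus z < 1 -> cdiff (ev a) z (ev (deriv_seq a) z).
Proof.
move=> ra z1 e e0.
pose r := (1 + modulus z) / 2.
have z0 := modulus_ge0 z.
have [r0 r1 zr] : [/\ 0 < r, r < 1 & modulus z < r] by rewrite /r; split; lra.
have [S S0 hS] := radius1_summable (radius1_natmul (radius1_natmul ra)) (ltW r0) r1.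
(* The first bound keeps z + h in the disc of radius r, the second makes S |h| at most e r^2; the 1
   added to S covers S = 0. *)
exists (Num.min (r - modulus z) (e * r ^+ 2 / (S + 1))).
  rewrite lt_min subr_gt0 zr/= divr_gt0 ?mulr_gt0 ?exprn_gt0//; lra.
move=> h; rewrite lt_min => /andP[hr hS1].
have zhr : modulus (z + h) <= r by rewrite (le_trans (modulusD _ _))//; lra.
have zh1 : modulus (z + h) < 1 by apply: le_lt_trans r1.
rewrite -(@ler_pM2l _ (r ^+ 2)) ?exprn_gt0//.
apply: (@le_trans _ _ (S * modulus h ^+ 2)); last first.
  have h0 := modulus_ge0 h; rewrite expr2 !mulrA ler_wpM2r//.
  move: hS1; rewrite ltr_pdivlMr; last by lra.
  by move=> h1; apply: ltW; rewrite mulrC; nra.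
pose T N := \sum_(i < N.+1) a i * (z + h) ^+ i - \sum_(i < N.+1) a i * z ^+ i
   - h * \sum_(i < N) deriv_seq a i * z ^+ i.
have T_lim : tends (fun N => (r ^+ 2)%:C * T N) ((r ^+ 2)%:C * (ev a (z + h) - ev a z - h * ev (deriv_seq a) z)).
  apply: tendsZ; apply: tendsB; first apply: tendsB.
  - exact: tendsS (ev_tends ra zh1).
  - exact: tendsS (ev_tends ra z1).
  - by apply: tendsZ; apply: ev_tends => //; exact: radius1_deriv.
have -> : r ^+ 2 * modulus (ev a (z + h) - ev a z - ev (deriv_seq a) z * h) =
    modulus ((r ^+ 2)%:C * (ev a (z + h) - ev a z - h * ev (deriv_seq a) z)).
  by rewrite modulusM modulus_real ger0_norm ?exprn_ge0 ?(ltW r0)// [h * _]mulrC.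
apply: (tends_modulus_le T_lim) => N.
have -> : T N = \sum_(i < N.+1) a i * ((z + h) ^+ i - z ^+ i - i%:R * z ^+ i.-1 * h).
  rewrite /T mulr_sumr.
  have -> : \sum_(i < N) h * (deriv_seq a i * z ^+ i) =
     \sum_(i < N.+1) a i * (i%:R * z ^+ i.-1 * h).
    rewrite big_ord_recl !mul0r mulr0 add0r; apply: eq_bigr => i _.
    by rewrite lift0 /deriv_seq /=; ring.
  by rewrite -!sumrB; apply: eq_bigr => i _; ring.
rewrite modulusM modulus_real ger0_norm ?exprn_ge0 ?(ltW r0)//.
apply: (@le_trans _ _ (r ^+ 2 * \sum_(i < N.+1) modulus (a i *
    ((z + h) ^+ i - z ^+ i - i%:R * z ^+ i.-1 * h)))).
  by rewrite ler_wpM2l ?modulus_sum// exprn_ge0// ltW.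
apply: (@le_trans _ _ ((\sum_(i < N.+1) modulus (i%:R * (i%:R * a i)) * r ^+ i) * modulus h ^+ 2)).
  rewrite mulr_sumr mulr_suml; apply: ler_sum => i _.
  rewrite modulusM mulrCA.
  apply: le_trans (ler_wpM2l (modulus_ge0 _) (binomial_remainder_le i (ltW r0) (ltW zr) zhr)) _.
  by rewrite !modulusM modulus_nat le_eqVlt; apply/orP; left; apply/eqP; ring.
by rewrite ler_wpM2r ?hS// exprn_ge0// modulus_ge0.
Qed.

Lemma cdiff_continuous f z l : cdiff f z l -> forall e : R, 0 < e ->
  exists2 d : R, 0 < d & forall h : C, modulus h < d -> modulus (f (z + h) - f z) < e.
Proof.
move=> fl e e0; have [d d0 hd] := fl 1 ltr01.
have l0 := modulus_ge0 l.
exists (Num.min d (e / (modulus l + 1))).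
  by rewrite lt_min d0 divr_gt0//; lra.
move=> h; rewrite lt_min => /andP[/hd h1]; rewrite ltr_pdivlMr; last by lra.
move=> h2; apply: le_lt_trans h2.
have := modulusD (f (z + h) - f z - l * h) (l * h).
by rewrite subrK modulusM; nra.
Qed.

Lemma cdiffM f g z l m : cdiff f z l -> cdiff g z m ->
  cdiff (fun w => f w * g w) z (l * g z + f z * m).
Proof.
move=> fl gm e e0.
pose A := modulus (f z); pose B := modulus (g z); pose L := modulus l.
have [A0 B0 L0] : [/\ 0 <= A, 0 <= B & 0 <= L] by split; exact: modulus_ge0.
pose K := A + B + L + 2.
have K0 : 0 < K by rewrite /K; lra.
have eK0 : 0 < e / (3 * K) by rewrite divr_gt0// mulr_gt0.
pose e' := Num.min 1 (e / (3 * K)).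
have e'0 : 0 < e' by rewrite lt_min ltr01.
have [d1 d10 h1] := fl _ e'0; have [d2 d20 h2] := gm _ e'0.
have [d3 d30 h3] := cdiff_continuous gm e'0.
exists (Num.min d1 (Num.min d2 d3)); first by rewrite !lt_min d10 d20 d30.
move=> h; rewrite !lt_min => /and3P[/h1 F /h2 G /h3 G'].
have -> : f (z + h) * g (z + h) - f z * g z - (l * g z + f z * m) * h =
  (f (z + h) - f z - l * h) * g z + (f (z + h) - f z - l * h) * (g (z + h) - g z)
  + (l * h) * (g (z + h) - g z) + f z * (g (z + h) - g z - m * h) by ring.
have e'1 : e' <= 1 by rewrite ge_min lexx.
have e'K : e' * (3 * K) <= e.
  by rewrite -ler_pdivlMr ?mulr_gt0// ge_min lexx orbT.
have H0 := modulus_ge0 h.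
apply: (@le_trans _ _ (e' * modulus h * B + e' * modulus h * 1 + L * modulus h * e' + A * (e' * modulus h))).
  apply: (le_trans (modulusD _ _)); apply: lerD; first apply: (le_trans (modulusD _ _));
    first apply: lerD; first apply: (le_trans (modulusD _ _)); first apply: lerD;
    rewrite !modulusM.
  - by rewrite ler_wpM2r.
  - by apply: ler_pM => //; rewrite ?modulus_ge0//; lra.
  - by apply: ler_pM => //; rewrite ?mulr_ge0 ?modulus_ge0// ltW.
  - by rewrite ler_wpM2l.
have -> : e' * modulus h * B + e' * modulus h * 1 + L * modulus h * e' + A * (e' * modulus h)
  = (e' * (A + B + L + 1)) * modulus h by ring.
by rewrite ler_wpM2r//; apply: le_trans e'K; rewrite ler_wpM2l ?(ltW e'0)// /K; lra.
Qed.

Lemma cdiff_id z : cdiff id z 1.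
Proof.
move=> e e0; exists 1; rewrite ?ltr01// => h _.
by rewrite [z + h]addrC addrK mul1r subrr modulus0 mulr_ge0 ?modulus_ge0// ltW.
Qed.

Lemma cdiff_ext (f g : C -> C) z l (r : R) : 0 < r ->
  (forall h, modulus h < r -> f (z + h) = g (z + h)) -> cdiff f z l -> cdiff g z l.
Proof.
move=> r0 fg fl e /fl [d d0 hd]; exists (Num.min d r); first by rewrite lt_min d0.
move=> h; rewrite lt_min => /andP[hd' hr].
have := fg 0; rewrite addr0 modulus0 => /(_ r0) <-.
by rewrite -fg// hd.
Qed.

End PowerSeries.

(** * The identity theorem, and differentiability as a limit of quotients *)

Section DerivativeBridge.
Variable R : realType.
Notation C := R[i].
Implicit Types (a d : nat -> C) (f : C -> C) (z l : C).

(** Continuity of the sum at 0, tested at a small positive real point. The hypothesis leaves out z =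
    0 because [ev_eq0] applies it after dividing by z. *)
Lemma ev_eq0_coef0 d (r : R) : radius1 d -> 0 < r ->
  (forall z, z != 0 -> modulus z < r -> ev d z = 0) -> d 0%N = 0.
Proof.
move=> rd r0 h.
apply/eqP; rewrite -modulus_eq0; apply/negPn/negP => d0.
have {}d0 : 0 < modulus (d 0%N) by rewrite lt_neqAle eq_sym d0 modulus_ge0.
have z01 : modulus (0 : C) < 1 by rewrite modulus0.
have [e e0 he] := cdiff_continuous (ev_cdiff rd z01) d0.
pose t := Num.min r e / 2.
have t0 : 0 < t by rewrite divr_gt0// lt_min r0.
have [tr te] : t < r /\ t < e.
  have m0 : 0 < Num.min r e by rewrite lt_min r0.
  have mr : Num.min r e <= r by rewrite ge_min lexx.
  have me : Num.min r e <= e by rewrite ge_min lexx orbT.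
  by rewrite /t; split; lra.
have mt : modulus t%:C = t by rewrite modulus_real gtr0_norm.
have := he t%:C; rewrite mt add0r => /(_ te).
rewrite (h t%:C) ?mt//; last by rewrite -modulus_gt0 mt.
by rewrite ev_at0// sub0r modulusN ltxx.
Qed.

Lemma ev_eq0 d (r : R) : radius1 d -> 0 < r ->
  (forall z, z != 0 -> modulus z < r -> ev d z = 0) -> forall n, d n = 0.
Proof.
move=> rd r0 h n; elim: n d r rd r0 h => [|n IH] d r rd r0 h.
  exact: ev_eq0_coef0 h.
apply: (IH (drop_seq 1 d) (Num.min r 1)).
- exact: radius1_drop.
- by rewrite lt_min r0 ltr01.
move=> z z0; rewrite lt_min => /andP[zr z1].
have := ev_drop1 rd z1; rewrite h// (ev_eq0_coef0 rd r0 h) add0r => /esym/eqP.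
by rewrite mulf_eq0 (negbTE z0)/= => /eqP.
Qed.

Lemma gt0_complexE (e : C) : 0 < e -> exists2 x : R, 0 < x & e = x%:C.
Proof. by case: e => x y; rewrite ltcE /= => /andP[/eqP -> x0]; exists x. Qed.

Lemma cdiffP f z l : cdiff f z l <->
  ((fun h : C => h^-1 *: (f (h + z) - f z)) @ 0^' --> l).
Proof.
split=> [fl|/cvgrPdist_le fl e e0].
  apply/cvgrPdist_le => e /gt0_complexE[x x0 ->].
  have [d d0 hd] := fl _ x0.
  apply/nbhs_ballP; exists d%:C; first by rewrite /= ltcR.
  move=> h; rewrite /ball /= sub0r normrN modulus_ltE => /hd hh h0.
  rewrite normE lecR -(@ler_pM2r _ (modulus h)) ?modulus_gt0// -modulusM.
  rewrite modulusB in hh.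
  have -> // : (l - h^-1 *: (f (h + z) - f z)) * h = l * h - (f (z + h) - f z).
  by rewrite /GRing.scale /= [h + z]addrC; field.
have e0' : 0 < e%:C by rewrite ltcR.
have /nbhs_ballP[d /gt0_complexE[x x0 ->] hd] := fl _ e0'.
exists x => // h hx.
have [->|h0] := eqVneq h 0.
  by rewrite addr0 subrr mulr0 subrr modulus0 mulr0.
have := hd h; rewrite /ball /= sub0r normrN modulus_ltE => /(_ hx h0).
rewrite normE lecR -(@ler_pM2r _ (modulus h)) ?modulus_gt0// -modulusM => hh.
rewrite modulusB.
have <- // : (l - h^-1 *: (f (h + z) - f z)) * h = l * h - (f (z + h) - f z).
by rewrite /GRing.scale /= [h + z]addrC; field.
Qed.

Lemma cdiff_derive1 f z l : cdiff f z l -> derive1 f z = l.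
Proof. by move=> /cdiffP h; apply: cvg_lim h; exact: norm_hausdorff. Qed.

Lemma derivable_cvg1 f z : derivable f z 1 <->
  cvg ((fun h : C => h^-1 *: (f (h + z) - f z)) @ 0^').
Proof.
rewrite /derivable; set u := (fun _ : C => _); set v := (fun _ : C => _).
by suff -> : u = v by []; rewrite funeqE => h; rewrite /u /v /= [h%:A]mulr1.
Qed.

Lemma cdiff_derivable f z l : cdiff f z l -> derivable f z 1.
Proof. by move=> /cdiffP h; apply/derivable_cvg1/cvg_ex; exists l. Qed.

Lemma derivable_cdiff f z : derivable f z 1 -> cdiff f z (derive1 f z).
Proof. by move=> /derivable_cvg1 h; apply/cdiffP. Qed.

End DerivativeBridge.

(** * Area integrals of power series *)

Section LinearChangeOfVariables.
Variable R : realType.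
Notation mu := (@lebesgue_measure R).
Local Open Scope ereal_scope.

Let measurable_affine (r c : R) :
  measurable_fun [set: R] (fun x : R => (r * x + c)%R).
Proof. by apply: measurable_funD => //; apply: measurable_funM. Qed.

(** Both sides are measures in A; by uniqueness of Lebesgue measure it is enough to compare them on
    half-open intervals. *)
Lemma lebesgue_measure_affine (r : R) (c : R) (A : set R) :
  (0 < r)%R -> measurable A ->
  mu A = r%:E * mu ((fun x => (r * x + c)%R) @^-1` A).
Proof.
move=> r0; pose phi (x : measurableTypeR R) : measurableTypeR R := (r * x + c)%R.
have mphi : measurable_fun setT phi by exact: measurable_affine.
pose m : {measure set (measurableTypeR R) -> \bar R} :=
  mscale (NngNum (ltW r0)) (pushforward mu phi).
move=> mA; rewrite (@lebesgue_measure_unique _ (m mphi))// => X [[a b] _ <-] /=.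
rewrite /m /= /mscale /pushforward /=.
rewrite /pushforward; have -> : phi @^-1` `]a, b]%classic = `]((a - c) / r)%R, ((b - c) / r)%R]%classic.
  apply/seteqP; split => x /=; rewrite !in_itv/= /phi;
    rewrite ltr_pdivrMr// ler_pdivlMr// ltrBlDr lerBrDr; by rewrite [(x * _)%R]mulrC.
rewrite !lebesgue_measure_itv/= !lte_fin ltr_pM2r ?invr_gt0// ltrD2r.
case: ifPn => _; last by rewrite mule0.
by rewrite -!EFinB -EFinM; congr EFin; field; rewrite gt_eqF.
Qed.

Lemma integral_affine (r : R) (c : R) (f : R -> \bar R) :
  (0 < r)%R -> measurable_fun [set: R] f -> (forall x, 0 <= f x) ->
  \int[mu]_x f x = r%:E * \int[mu]_x f (r * x + c)%R.
Proof.
move=> r0 mf f0; pose phi (x : measurableTypeR R) : measurableTypeR R := (r * x + c)%R.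
have mphi : measurable_fun setT phi by exact: measurable_affine.
pose m : {measure set (measurableTypeR R) -> \bar R} :=
  mscale (NngNum (ltW r0)) (pushforward mu phi).
rewrite (@eq_measure_integral _ _ _ _ (m mphi)); last first.
  by move=> A mA _; exact: (lebesgue_measure_affine c r0 mA).
rewrite ge0_integral_mscale//= (ge0_integral_pushforward mphi)//.
Qed.

Notation mu2 := (mu \x mu).
Implicit Types F : R * R -> \bar R.

Definition mfun2 F := measurable_fun [set: R * R] F.

Let mfst : measurable_fun [set: R * R] (@fst R R).
Proof. exact: measurable_fst. Qed.
Let msnd : measurable_fun [set: R * R] (@snd R R).
Proof. exact: measurable_snd. Qed.

Lemma mfun2_linear F (a b c d : R) : mfun2 F ->
  mfun2 (fun p => F (a * p.1 + b * p.2, c * p.1 + d * p.2)%R).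
Proof.
move=> mF; pose g (p : R * R) := ((a * p.1 + b * p.2)%R, (c * p.1 + d * p.2)%R).
rewrite /mfun2 (_ : (fun p => _) = F \o g)//.
apply: measurableT_comp => //.
by apply: measurable_fun_pair; apply: measurable_funD; apply: measurable_funM.
Qed.

(** Fubini: on each horizontal line the shear is a translation. *)
Lemma integral_shear1 F (t : R) : mfun2 F -> (forall p, 0 <= F p) ->
  \int[mu2]_p F (p.1 + t * p.2, p.2)%R = \int[mu2]_p F p.
Proof.
move=> mF F0.
have mF' : mfun2 (fun p => F (p.1 + t * p.2, p.2)%R).
  have := mfun2_linear 1 t 0 1 mF.
  by under [fun _ => _]eq_fun do rewrite !mul1r mul0r add0r.
rewrite !fubini_tonelli2//; apply: eq_integral => y _; rewrite /fubini_G /=.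
have mFy : measurable_fun [set: R] (fun x => F (x, y)).
  exact: measurable_fun_pair1.
rewrite (integral_affine (t * y) ltr01 mFy)// mul1e.
by apply: eq_integral => x _; rewrite mul1r.
Qed.

Lemma integral_shear2 F (t : R) : mfun2 F -> (forall p, 0 <= F p) ->
  \int[mu2]_p F (p.1, p.2 + t * p.1)%R = \int[mu2]_p F p.
Proof.
move=> mF F0.
have mF' : mfun2 (fun p => F (p.1, p.2 + t * p.1)%R).
  have := mfun2_linear 1 0 t 1 mF.
  by under [fun _ => _]eq_fun do rewrite !mul1r mul0r addr0 addrC.
rewrite !fubini_tonelli1//; apply: eq_integral => x _; rewrite /fubini_F /=.
have mFx : measurable_fun [set: R] (fun y => F (x, y)).
  exact: measurable_fun_pair2.
rewrite (integral_affine (t * x) ltr01 mFx)// mul1e.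
by apply: eq_integral => y _; rewrite mul1r.
Qed.

Lemma integral_dilation F (r : R) : (0 < r)%R -> mfun2 F -> (forall p, 0 <= F p) ->
  \int[mu2]_p F p = (r ^+ 2)%:E * \int[mu2]_p F (r * p.1, r * p.2)%R.
Proof.
move=> r0 mF F0.
pose H p := F (r * p.1, r * p.2)%R.
have mH : mfun2 H.
  have := mfun2_linear r 0 0 r mF.
  by under [fun _ => _]eq_fun do rewrite !mul0r add0r addr0.
have H0 p : 0 <= H p by exact: F0.
pose G (x : R) := \int[mu]_y F (x, y).
pose K (x : R) := \int[mu]_y H (x, y).
have G0 x : 0 <= G x by apply: integral_ge0.
have K0 x : 0 <= K x by apply: integral_ge0.
have mG : measurable_fun [set: R] G by exact: measurable_fun_fubini_tonelli_F.
have mK : measurable_fun [set: R] K by exact: measurable_fun_fubini_tonelli_F.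
have -> : \int[mu2]_p F p = \int[mu]_x G x by rewrite fubini_tonelli1.
have -> : \int[mu2]_p F (r * p.1, r * p.2)%R = \int[mu]_x K x.
  by rewrite fubini_tonelli1.
rewrite (integral_affine 0 r0 mG)// expr2 EFinM -muleA; congr (_ * _).
rewrite -ge0_integralZl_EFin//; last exact: ltW.
apply: eq_integral => x _; rewrite addr0 /G /K /H /=.
have mFx : measurable_fun [set: R] (fun y => F (r * x, y)%R).
  exact: measurable_fun_pair2.
rewrite (integral_affine 0 r0 mFx)//; congr (_ * _).
by apply: eq_integral => y _; rewrite addr0.
Qed.

(* A plane rotation is a product of three shears. *)
Lemma integral_rotation F (c s : R) : mfun2 F -> (forall p, 0 <= F p) ->
  (c ^+ 2 + s ^+ 2 = 1)%R -> (1 + c != 0)%R ->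
  \int[mu2]_p F (c * p.1 - s * p.2, s * p.1 + c * p.2)%R = \int[mu2]_p F p.
Proof.
move=> mF F0 cs c1; pose t := (- (s / (1 + c)))%R.
have m1 : mfun2 (fun p => F (p.1 + t * p.2, p.2)%R).
  have := mfun2_linear 1 t 0 1 mF.
  by under [fun _ => _]eq_fun do rewrite !mul1r mul0r add0r.
have m2 : mfun2 (fun p => F (p.1 + t * (p.2 + s * p.1), p.2 + s * p.1)%R).
  have := mfun2_linear 1 0 s 1 m1 => /=.
  by under [fun _ => _]eq_fun do rewrite !mul1r mul0r addr0 [(s * _ + _)%R]addrC.
rewrite -(integral_shear1 t mF)// -(integral_shear2 s m1)//= -(integral_shear1 t m2)//=.
apply: eq_integral => -[x y] _ /=; congr (F (_, _)).
- have ts : (t * s = c - 1)%R.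
    by rewrite /t mulNr mulrAC -expr2 -[(s ^+ 2)%R](addrK (c ^+ 2)%R) [(s ^+ 2 + _)%R]addrC cs; field.
  have tc : (t * (1 + c) = - s)%R by rewrite /t; field.
  have -> : (x + t * y + t * (y + s * (x + t * y)) = (1 + t * s) * x + (t * (2 + t * s)) * y)%R by ring.
  rewrite ts (_ : 2 + (c - 1) = 1 + c)%R; last by ring.
  by rewrite tc; ring.
- have ts : (t * s = c - 1)%R.
    by rewrite /t mulNr mulrAC -expr2 -[(s ^+ 2)%R](addrK (c ^+ 2)%R) [(s ^+ 2 + _)%R]addrC cs; field.
  have -> : (y + s * (x + t * y) = s * x + (1 + t * s) * y)%R by ring.
  by rewrite ts; ring.
Qed.

End LinearChangeOfVariables.

(** * Roots of unity and the discrete Parseval identity *)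

Section RootsOfUnity.
Variable R : realType.
Notation C := R[i].
Implicit Types (t : R) (z : C).

Definition expi t : C := cos t +i* sin t.

Lemma expiD s t : expi (s + t) = expi s * expi t.
Proof. by rewrite /expi cosD sinD; simpc; congr (_ +i* _); rewrite addrC. Qed.

Lemma expi0 : expi 0 = 1.
Proof. by rewrite /expi cos0 sin0. Qed.

Lemma expiX t n : expi t ^+ n = expi (t *+ n).
Proof.
elim: n => [|n IH]; first by rewrite expr0 mulr0n expi0.
by rewrite exprS IH -expiD mulrS.
Qed.

Lemma modulus_expi t : modulus (expi t) = 1.
Proof.
apply/eqP; rewrite -(@eqrXn2 _ 2) ?modulus_ge0// sqr_modulus /= cos2Dsin2.
by rewrite expr1n.
Qed.

Lemma expi_2pi : expi (pi *+ 2) = 1.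
Proof. by rewrite /expi cos2pi sin2pi. Qed.

Lemma expi_neq1 t : 0 < t -> t < pi *+ 2 -> expi t != 1.
Proof.
move=> t0 t2; apply/negP => /eqP[]; have -> : t = (t / 2) *+ 2 by rewrite mulr2n; field.
have s0 : 0 < sin (t / 2) by apply: sin_gt0_pi; rewrite mulr2n in t2; apply/andP; split; lra.
rewrite cos_mulr2n cos2sin2 mulr2n => h _.
have s2 : 0 < sin (t / 2) ^+ 2 by rewrite exprn_gt0.
by lra.
Qed.

Definition unity_root N : C := expi ((pi *+ 2) / N%:R).

Lemma unity_rootX N : (0 < N)%N -> unity_root N ^+ N = 1.
Proof.
move=> N0; rewrite /unity_root expiX -[X in expi X]mulr_natr divfK ?expi_2pi//.
by rewrite pnatr_eq0 -lt0n.
Qed.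

Lemma unity_rootX_neq1 N j : (0 < j)%N -> (j < N)%N -> unity_root N ^+ j != 1.
Proof.
move=> j0 jN; have N0 : (0 < N)%N by exact: leq_trans jN.
rewrite /unity_root expiX -[X in expi X]mulr_natr; apply: expi_neq1.
  by rewrite mulr_gt0 ?divr_gt0 ?ltr0n// mulrn_wgt0// pi_gt0.
rewrite mulrAC ltr_pdivrMr ?ltr0n// ltr_pM2l ?ltr_nat//.
by rewrite mulrn_wgt0// pi_gt0.
Qed.

Lemma modulus_unity_root N : modulus (unity_root N) = 1.
Proof. exact: modulus_expi. Qed.

Lemma unity_root_neqN1 N : (2 < N)%N -> unity_root N != -1.
Proof.
move=> N2; apply/negP => /eqP h; have := @unity_rootX_neq1 N 2 isT N2.
by rewrite h sqrrN expr1n eqxx.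
Qed.

Lemma unity_root_conj N : conjc (unity_root N) = (unity_root N)^-1.
Proof.
have w0 : unity_root N != 0 by rewrite -modulus_gt0 modulus_unity_root.
by apply: (mulfI w0); rewrite mulfV// mulcJ modulus_unity_root expr1n.
Qed.

Lemma sum_unity_root N n m : (n < N)%N -> (m < N)%N ->
  \sum_(k < N) (unity_root N ^+ n * (conjc (unity_root N)) ^+ m) ^+ k = (n == m)%:R * N%:R :> C.
Proof.
move=> nN mN; have N0 : (0 < N)%N by exact: leq_trans nN.
have w0 : unity_root N != 0 by rewrite -modulus_gt0 modulus_unity_root.
rewrite unity_root_conj; set w := unity_root N in w0 *.
have [->|nm] := eqVneq n m.
  rewrite mul1r -exprMn mulfV// expr1n; under eq_bigr do rewrite expr1n.
  by rewrite sumr_const card_ord.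
rewrite mul0r; set u := w ^+ n * _.
have u1 : u != 1.
  rewrite /u exprVn; apply/negP => /eqP h.
  have {h} : w ^+ n = w ^+ m by rewrite -[LHS](divfK (expf_neq0 m w0)) h mul1r.
  case: (ltngtP n m) nm => // [nm|mn] _.
    rewrite -(subnKC (ltnW nm)) exprD => /eqP; rewrite -subr_eq0 -{1}[w ^+ n]mulr1 -mulrBr mulf_eq0.
    rewrite (negbTE (expf_neq0 n w0))/= subr_eq0 eq_sym; apply/negP.
    by apply: unity_rootX_neq1; [rewrite subn_gt0|exact: leq_ltn_trans (leq_subr _ _) mN].
  rewrite -(subnKC (ltnW mn)) exprD => /eqP; rewrite -subr_eq0 -{2}[w ^+ m]mulr1 -mulrBr mulf_eq0.
  rewrite (negbTE (expf_neq0 m w0))/= subr_eq0; apply/negP.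
  by apply: unity_rootX_neq1; [rewrite subn_gt0|exact: leq_ltn_trans (leq_subr _ _) nN].
have uN : u ^+ N = 1.
  rewrite /u exprMn -!exprM ![(_ * N)%N]mulnC !exprM exprVn.
  by rewrite (unity_rootX N0) invr1 !expr1n mulr1.
have := subrX1 u N; rewrite uN subrr => /esym/eqP.
by rewrite mulf_eq0 subr_eq0 (negbTE u1)/= => /eqP.
Qed.

Lemma conjcX z n : conjc (z ^+ n) = conjc z ^+ n.
Proof. exact: rmorphXn. Qed.

(** The exponents n < K <= N are distinct modulo N, so the orthogonality in [sum_unity_root] removes
    every cross term. *)
Lemma parseval_roots (K N : nat) (b : nat -> C) z : (K <= N)%N ->
  \sum_(k < N) modulus (\sum_(n < K) b n * (unity_root N ^+ k * z) ^+ n) ^+ 2 =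
  N%:R * \sum_(n < K) modulus (b n) ^+ 2 * modulus z ^+ (2 * n).
Proof.
move=> KN; apply: (@complexI R); rewrite !rmorph_sum rmorphM /= rmorph_nat rmorph_sum /=.
set w := unity_root N.
have -> : \sum_(k < N) (modulus (\sum_(n < K) b n * (w ^+ k * z) ^+ n) ^+ 2)%:C =
  \sum_(k < N) \sum_(n < K) \sum_(m < K) b n * z ^+ n * conjc (b m * z ^+ m) * (w ^+ n * conjc w ^+ m) ^+ k.
  apply: eq_bigr => k _; rewrite -mulcJ rmorph_sum/= mulr_suml; apply: eq_bigr => n _.
  rewrite mulr_sumr; apply: eq_bigr => m _.
  rewrite !rmorphM /= !conjcX rmorphM /= conjcX !exprMn -!exprM [(n * k)%N]mulnC [(m * k)%N]mulnC.
  by ring.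
rewrite exchange_big /= mulr_sumr; apply: eq_bigr => n _.
rewrite exchange_big /=.
have E (m : 'I_K) : \sum_(i < N) b n * z ^+ n * conjc (b m * z ^+ m) * (w ^+ n * conjc w ^+ m) ^+ i
    = b n * z ^+ n * conjc (b m * z ^+ m) * ((n == m)%:R * N%:R).
  rewrite -mulr_sumr sum_unity_root//.
  - exact: leq_trans (ltn_ord n) KN.
  - exact: leq_trans (ltn_ord m) KN.
rewrite (eq_bigr _ (fun m _ => E m)) (bigD1 n)//= big1 ?addr0.
  rewrite eqxx mul1r mulcJ modulusM modulusX exprMn -exprM [(n * 2)%N]mulnC.
  by rewrite mulrC.
by move=> m mn; rewrite [_ == _](_ : _ = false) ?mul0r ?mulr0// eq_sym; apply/negbTE.
Qed.

End RootsOfUnity.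

(** * Integrals of polynomials over discs *)

Section AreaIntegrals.
Variable R : realType.
Notation C := R[i].
Notation mu := (@lebesgue_measure R).
Notation mu2 := (mu \x mu)%E.
Implicit Types (G : C -> R) (b : nat -> C) (z : C).

Definition cplx (p : R * R) : C := p.1 +i* p.2.

Definition disc (r : R) : set (R * R) := [set p | modulus (cplx p) < r].

Definition plane_measurable G := measurable_fun [set: R * R] (fun p => G (cplx p)).

Let mfst : measurable_fun [set: R * R] (@fst R R).
Proof. exact: measurable_fst. Qed.
Let msnd : measurable_fun [set: R * R] (@snd R R).
Proof. exact: measurable_snd. Qed.

Let sqr_modulusE p : modulus (cplx p) ^+ 2 = p.1 ^+ 2 + p.2 ^+ 2.
Proof. by rewrite sqr_modulus. Qed.

Lemma plane_measurable_pow n :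
  plane_measurable (fun z => complex.Re (z ^+ n)) /\
  plane_measurable (fun z => complex.Im (z ^+ n)).
Proof.
rewrite /plane_measurable; elim: n => [|n [IHr IHi]].
  by split; under [fun _ => _]eq_fun do rewrite expr0; exact: measurable_cst.
have E p : cplx p ^+ n.+1 =
   (p.1 * complex.Re (cplx p ^+ n) - p.2 * complex.Im (cplx p ^+ n)) +i*
   (p.1 * complex.Im (cplx p ^+ n) + p.2 * complex.Re (cplx p ^+ n)).
  by rewrite exprS; case: (cplx p ^+ n) => u v; rewrite /cplx; simpc.
split; under [fun _ => _]eq_fun do rewrite E /=.
  by apply: measurable_funB; apply: measurable_funM.
by apply: measurable_funD; apply: measurable_funM.
Qed.

Lemma plane_measurable_poly K b :
  plane_measurable (fun z => modulus (\sum_(n < K) b n * z ^+ n) ^+ 2).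
Proof.
rewrite /plane_measurable; under [fun _ => _]eq_fun do rewrite sqr_modulus.
apply: measurable_funD; apply: measurable_funX.
  under [fun _ => _]eq_fun do rewrite Re_sum.
  apply: measurable_sum => n; have [mr mi] := plane_measurable_pow n.
  have E p : complex.Re (b n * cplx p ^+ n) = complex.Re (b n) * complex.Re (cplx p ^+ n)
     - complex.Im (b n) * complex.Im (cplx p ^+ n).
    by case: (b n) => ? ?; case: (cplx p ^+ n).
  under [fun _ => _]eq_fun do rewrite E.
  by apply: measurable_funB; apply: measurable_funM.
under [fun _ => _]eq_fun do rewrite Im_sum.
apply: measurable_sum => n; have [mr mi] := plane_measurable_pow n.
have E p : complex.Im (b n * cplx p ^+ n) = complex.Re (b n) * complex.Im (cplx p ^+ n)
   + complex.Im (b n) * complex.Re (cplx p ^+ n).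
  by case: (b n) => ? ?; case: (cplx p ^+ n).
under [fun _ => _]eq_fun do rewrite E.
by apply: measurable_funD; apply: measurable_funM.
Qed.

Lemma plane_measurable_modulusX n : plane_measurable (fun z => modulus z ^+ (2 * n)).
Proof.
rewrite /plane_measurable; under [fun _ => _]eq_fun do rewrite exprM sqr_modulusE.
by apply: measurable_funX; apply: measurable_funD; apply: measurable_funX.
Qed.

Lemma measurable_disc r : 0 < r -> measurable (disc r).
Proof.
move=> r0.
pose f (p : R * R) := p.1 ^+ 2 + p.2 ^+ 2.
have mf : measurable_fun [set: R * R] f.
  by apply: measurable_funD; apply: measurable_funX.
have -> : disc r = [set: R * R] `&` f @^-1` `]-oo, (r ^+ 2)%R[%classic.
  rewrite setTI; apply/seteqP; split => p; rewrite /disc /f /= in_itv /= -sqr_modulusE;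
    by rewrite ltr_pXn2r// nnegrE ?modulus_ge0// ltW.
by apply: mf => //; exact: measurable_itv.
Qed.

Lemma disc_mem r p : (p \in disc r) = (modulus (cplx p) < r).
Proof. by apply/idP/idP => [/set_mem|h]; last exact/mem_set. Qed.

Lemma integral_disc_rotation G (r : R) (w : C) : 0 < r -> plane_measurable G ->
  (forall z, 0 <= G z) -> modulus w = 1 -> w != -1 ->
  (\int[mu2]_(p in disc r) (G (w * cplx p))%:E = \int[mu2]_(p in disc r) (G (cplx p))%:E)%E.
Proof.
move=> r0 mG G0 w1 wN1; rewrite [LHS]integral_mkcond [RHS]integral_mkcond.
set F := (X in _ = (\int[_]_p X p)%E).
have mF : mfun2 F.
  by apply/(measurable_restrictT _ _).1; [exact: measurable_disc|exact/measurable_funTS/measurable_EFinP].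
have F0 p : (0 <= F p)%E by apply: erestrict_ge0 => q _; rewrite lee_fin.
case: w w1 wN1 => c s w1 wN1.
have cs : c ^+ 2 + s ^+ 2 = 1 by have := sqr_modulus (c +i* s); rewrite w1 expr1n.
have c1 : 1 + c != 0.
  apply/negP; rewrite addr_eq0 => /eqP h.
  have cE : c = -1 by rewrite -[c]opprK -h.
  have s0 : s = 0 by apply/eqP; rewrite -sqrf_eq0; apply/eqP; move: cs; rewrite cE sqrrN expr1n; lra.
  by move: wN1; rewrite cE s0 => /eqP; apply; simpc.
rewrite -(integral_rotation mF F0 cs c1); apply: eq_integral => p _.
have E : cplx (c * p.1 - s * p.2, s * p.1 + c * p.2) = (c +i* s) * cplx p.
  by rewrite /cplx /=; simpc; congr (_ +i* _); ring.
by rewrite /F !patchE !disc_mem E modulusM w1 mul1r.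
Qed.

Lemma integral_disc_dilation G (q r : R) : 0 < q -> 0 < r -> plane_measurable G ->
  (forall z, 0 <= G z) ->
  (\int[mu2]_(p in disc (q * r)) (G (cplx p))%:E =
   (q ^+ 2)%:E * \int[mu2]_(p in disc r) (G (q%:C * cplx p))%:E)%E.
Proof.
move=> q0 r0 mG G0; rewrite [LHS]integral_mkcond [X in (_ * X)%E]integral_mkcond.
set F := (X in (\int[_]_p X p)%E = _).
have mF : mfun2 F.
  by apply/(measurable_restrictT _ _).1; [apply: measurable_disc; exact: mulr_gt0|exact/measurable_funTS/measurable_EFinP].
have F0 p : (0 <= F p)%E by apply: erestrict_ge0 => z _; rewrite lee_fin.
rewrite (integral_dilation q0 mF F0); congr (_ * _)%E; apply: eq_integral => p _.
have E : cplx (q * p.1, q * p.2) = q%:C * cplx p.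
  by rewrite /cplx /=; simpc.
by rewrite /F !patchE !disc_mem E modulusM modulus_real gtr0_norm// ltr_pM2l.
Qed.

Lemma pmule_natI (N : nat) (x y : \bar R) : (0 < N)%N ->
  (N%:R%:E * x = N%:R%:E * y -> x = y)%E.
Proof.
move=> N0 h; have N0' : (0 < (N%:R : R)%:E)%E by rewrite lte_fin ltr0n.
by apply/eqP; rewrite eq_le -(lee_pmul2l _ N0')// -[X in _ && X](lee_pmul2l _ N0')// h lexx.
Qed.

Lemma ge0_sum_const (N : nat) (x : \bar R) : (0 <= x)%E ->
  (\sum_(k < N) x = N%:R%:E * x)%E.
Proof.
move=> x0; elim: N => [|N IH]; first by rewrite big_ord0 mul0e.
by rewrite big_ord_recr/= IH -natr1 EFinD ge0_muleDl// mul1e.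
Qed.

Definition moment n r : \bar R := (\int[mu2]_(p in disc r) (modulus (cplx p) ^+ (2 * n))%:E)%E.

(* Averaging over the rotations by the [N]-th roots of unity kills the cross terms. *)
Lemma integral_disc_poly K b r : 0 < r ->
  (\int[mu2]_(p in disc r) (modulus (\sum_(n < K) b n * cplx p ^+ n) ^+ 2)%:E =
   \sum_(n < K) (modulus (b n) ^+ 2)%:E * moment n r)%E.
Proof.
(* [N] has to be at least [K] for [parseval_roots], and greater than 2 so that the rotation is not
   by -1, the case excluded in [integral_rotation]. *)
move=> r0; pose N := (K + 3)%N; pose w : C := unity_root R N.
have N2 : (2 < N)%N by rewrite /N addn3.
pose G z := modulus (\sum_(n < K) b n * z ^+ n) ^+ 2.
have mG := plane_measurable_poly K b; rewrite -/G in mG.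
have G0 z : 0 <= G z by rewrite /G exprn_ge0// modulus_ge0.
have w1 : modulus w = 1 by exact: modulus_unity_root.
have mGw k : plane_measurable (fun z => G (w ^+ k * z)).
  have := plane_measurable_poly K (fun n => b n * w ^+ k ^+ n).
  congr (plane_measurable _); apply/funext => z; rewrite /G.
  by congr (modulus _ ^+ 2); apply: eq_bigr => n _; rewrite exprMn mulrA.
have rot k : (\int[mu2]_(p in disc r) (G (w ^+ k * cplx p))%:E = \int[mu2]_(p in disc r) (G (cplx p))%:E)%E.
  elim: k => [|k IH]; first by apply: eq_integral => p _; rewrite expr0 mul1r.
  have wN1 : w != -1 by exact: unity_root_neqN1.
  rewrite -IH; transitivity (\int[mu2]_(p in disc r) ((fun z => G (w ^+ k * z)) (w * cplx p))%:E)%E.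
    by apply: eq_integral => p _; rewrite exprSr mulrA.
  exact: (integral_disc_rotation (G := fun z => G (w ^+ k * z)) r0 (mGw k) (fun z => G0 _) w1 wN1).
apply: (@pmule_natI N); first by rewrite /N addn3.
have -> : (N%:R%:E * \int[mu2]_(p in disc r) (G (cplx p))%:E =
    \sum_(k < N) \int[mu2]_(p in disc r) (G (w ^+ k * cplx p))%:E)%E.
  by under eq_bigr do rewrite rot; rewrite ge0_sum_const//; apply: integral_ge0 => p _; rewrite lee_fin.
rewrite -ge0_integral_sum//; last 3 first.
- exact: measurable_disc.
- by move=> k; apply/measurable_funTS/measurable_EFinP; exact: mGw.
- by move=> k p _; rewrite lee_fin.
have -> : (\int[mu2]_(p in disc r) (\sum_(k < N) (G (w ^+ k * cplx p))%:E))%E =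
    (\int[mu2]_(p in disc r) (N%:R%:E * \sum_(n < K) ((modulus (b n) ^+ 2)%:E * (modulus (cplx p) ^+ (2 * n))%:E)))%E.
  apply: eq_integral => p _; rewrite sumEFin parseval_roots ?leq_addr//.
  by rewrite EFinM -sumEFin; congr (_ * _)%E; apply: eq_bigr => n _; rewrite EFinM.
have mB n : measurable_fun (disc r) (fun p => (modulus (cplx p) ^+ (2 * n))%:E).
  by apply/measurable_funTS/measurable_EFinP; exact: plane_measurable_modulusX.
have mBc n : measurable_fun (disc r) (fun p => (modulus (b n) ^+ 2)%:E * (modulus (cplx p) ^+ (2 * n))%:E)%E.
  exact: measurable_funeM.
have B0 n p : (0 <= (modulus (b n) ^+ 2)%:E * (modulus (cplx p) ^+ (2 * n))%:E)%E.
  by rewrite -EFinM lee_fin mulr_ge0// exprn_ge0// modulus_ge0.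
rewrite ge0_integralZl_EFin//; last 3 first.
- exact: measurable_disc.
- by move=> p _; apply: sume_ge0 => n _.
- by apply: emeasurable_sum => n; exact: mBc.
congr (_ * _)%E; rewrite ge0_integral_sum; last 3 first.
- exact: measurable_disc.
- by move=> n; exact: mBc.
- by move=> n p _; exact: B0.
apply: eq_bigr => n _; rewrite ge0_integralZl_EFin//.
- exact: measurable_disc.
- by move=> p _; rewrite lee_fin exprn_ge0// modulus_ge0.
- exact: mB.
- by rewrite exprn_ge0// modulus_ge0.
Qed.

(** Lets s tend to 1 through Bernoulli's inequality: if y < x, then s = 1 - t with n t x <= (x - y)
    / 2 gives a contradiction. *)
Lemma expr_limit_le (x y : R) n : 0 <= x ->
  (forall s, 0 < s -> s < 1 -> s ^+ n * x <= y) -> x <= y.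
Proof.
move=> x0 h; rewrite leNgt; apply/negP => yx.
have bernoulli (t : R) m : 0 <= t -> t <= 1 -> 1 - m%:R * t <= (1 - t) ^+ m.
  move=> t0 t1; elim: m => [|m IH]; first by rewrite mul0r subr0 expr0.
  rewrite exprS -natr1; have m0 : 0 <= m%:R :> R by [].
  have := ler_wpM2l (_ : 0 <= 1 - t) IH; rewrite subr_ge0 => /(_ t1); nra.
pose d := (x - y) / (2 * n.+1%:R * x).
have xp : 0 < x.
  rewrite lt_neqAle x0 andbT; apply/negP => /eqP e0.
  by have := h (1 / 2); rewrite -e0 mulr0; lra.
have N0 : 0 < n.+1%:R :> R by rewrite ltr0n.
have d0 : 0 < d by rewrite divr_gt0 ?mulr_gt0//; lra.
pose t := Num.min (1 / 2) d.
have t0 : 0 < t by rewrite lt_min d0 andbT; lra.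
have t12 : t <= 1 / 2 by rewrite ge_min lexx.
have td : t <= d by rewrite ge_min lexx orbT.
have {}h := h (1 - t); have := bernoulli t n (ltW t0).
have /h{}h : 0 < 1 - t by lra.
have /h{}h : 1 - t < 1 by lra.
move=> /(_ _)/(ler_wpM2r x0) B.
have {}B : (1 - n%:R * t) * x <= (1 - t) ^+ n * x by apply: B; lra.
have nx : n%:R * t * x <= (x - y) / 2.
  have -> : (x - y) / 2 = n.+1%:R * d * x by rewrite /d; field; rewrite !gt_eqF.
  rewrite ler_wpM2r//; apply: ler_pM => //; first exact: ltW.
  by rewrite ler_nat.
lra.
Qed.

(** Left as a constant: finiteness of the Dirichlet integral depends only on its being positive and
    finite. *)
Definition disc_area : R := fine (moment 0 1).

Let moment_ge0 n r : (0 <= moment n r)%E.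
Proof. by apply: integral_ge0 => p _; rewrite lee_fin exprn_ge0// modulus_ge0. Qed.

Let mpow n D : measurable_fun D (fun p => (modulus (cplx p) ^+ (2 * n))%:E).
Proof. by apply/measurable_funTS/measurable_EFinP; exact: plane_measurable_modulusX. Qed.

Let moment0 : moment 0 1 = mu2 (disc 1).
Proof.
rewrite /moment; under eq_integral do rewrite expr0.
by rewrite integral_cst ?mul1e//; exact: measurable_disc.
Qed.

Let square_measure (a b : R) : a < b -> mu2 (`[a, b] `*` `[a, b]) = ((b - a) ^+ 2)%:E.
Proof.
move=> ab; rewrite product_measure1E//; try exact: measurable_itv.
have itv : lebesgue_measure `[a, b]%classic = (b - a)%:E.
  by rewrite lebesgue_measure_itv/= lte_fin ab -EFinB.
by rewrite -[LHS]/(lebesgue_measure _ * lebesgue_measure _)%E itv -EFinM expr2.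
Qed.

(** A square inside the disc and one around it bound the area. As [fine] sends an infinite value to
    0, positivity also records that the area is finite. *)
Lemma disc_area_gt0 : 0 < disc_area.
Proof.
rewrite /disc_area moment0; apply: fine_gt0; apply/andP; split.
  have h : (mu2 (`[0%R, (1 / 2)%R] `*` `[0%R, (1 / 2)%R]) <= mu2 (disc 1))%E.
    apply: le_measure; rewrite ?inE.
    - by apply: measurableX; exact: measurable_itv.
    - exact: measurable_disc.
    move=> [x y] /= []; rewrite !in_itv/= => /andP[x0 x1] /andP[y0 y1].
    rewrite /disc /= -(@ltr_pXn2r _ 2) ?nnegrE ?modulus_ge0// sqr_modulusE /=; nra.
  by apply: lt_le_trans h; rewrite square_measure ?lte_fin ?exprn_gt0//; lra.
have h : (mu2 (disc 1) <= mu2 (`[(-1)%R, 1%R] `*` `[(-1)%R, 1%R]))%E.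
  apply: le_measure; rewrite ?inE.
  - exact: measurable_disc.
  - by apply: measurableX; exact: measurable_itv.
  move=> p /ltW p1; split; rewrite /= in_itv /= -ler_norml.
    exact: le_trans (Re_le_modulus (cplx p)) p1.
  exact: le_trans (Im_le_modulus (cplx p)) p1.
apply: le_lt_trans h _; rewrite square_measure ?ltry//; lra.
Qed.

Let moment_fin n : moment n 1 = (fine (moment n 1))%:E.
Proof.
rewrite fineK// ge0_fin_numE//.
have h : (moment n 1 <= moment 0 1)%E.
  apply: ge0_le_integral => //.
  - exact: measurable_disc.
  - by move=> p _; rewrite lee_fin exprn_ge0// modulus_ge0.
  - exact: mpow.
  - exact: mpow.
  - by move=> p p1; rewrite lee_fin expr0 exprn_ile1 ?modulus_ge0// ltW.
apply: le_lt_trans h _; have := disc_area_gt0; rewrite /disc_area.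
by case: (moment 0 1) (moment_ge0 0 1) => //= r; rewrite ?ltry ?ltxx.
Qed.

Lemma moment_dilation n q : 0 < q -> moment n q = (q ^+ (2 * n + 2) * fine (moment n 1))%:E.
Proof.
move=> q0; rewrite /moment -{1}[q]mulr1.
rewrite (integral_disc_dilation q0 ltr01 (plane_measurable_modulusX n)); last first.
  by move=> z; rewrite exprn_ge0// modulus_ge0.
have -> : (\int[mu2]_(p in disc 1) (modulus (q%:C * cplx p) ^+ (2 * n))%:E =
    (q ^+ (2 * n))%:E * moment n 1)%E.
  rewrite -ge0_integralZl_EFin//.
  - by apply: eq_integral => p _; rewrite -EFinM modulusM modulus_real gtr0_norm// exprMn.
  - exact: measurable_disc.
  - by move=> p _; rewrite lee_fin exprn_ge0// modulus_ge0.
  - exact: mpow.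
  - by rewrite exprn_ge0// ltW.
by rewrite moment_fin -!EFinM mulrA -exprD addnC.
Qed.

Let annulus_bounds n q : 0 < q -> q < 1 ->
  (q ^+ 2) ^+ n * ((1 - q ^+ 2) * disc_area) <= (1 - (q ^+ 2) ^+ n.+1) * fine (moment n 1)
    <= (1 - q ^+ 2) * disc_area.
Proof.
move=> q0 q1.
have dq1 : disc q `<=` disc 1 by move=> p /lt_trans; apply.
have mq := measurable_disc q0; have m1 : measurable (disc 1) by exact: measurable_disc.
pose I m := (\int[mu2]_(p in disc 1 `\` disc q) (modulus (cplx p) ^+ (2 * m))%:E)%E.
have I0 m : (0 <= I m)%E by apply: integral_ge0 => p _; rewrite lee_fin exprn_ge0// modulus_ge0.
have split_moment m : moment m 1 = (moment m q + I m)%E.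
  rewrite /moment -{1}(setDUK dq1) ge0_integral_setU//.
  - exact: measurableD.
  - exact: mpow.
  - by move=> p _; rewrite lee_fin exprn_ge0// modulus_ge0.
  - by apply/disj_setPS => p [? []].
have IE m : I m = ((1 - (q ^+ 2) ^+ m.+1) * fine (moment m 1))%:E.
  have := split_moment m; rewrite (moment_dilation m q0) {1}(moment_fin m).
  move: (fine (moment m 1)) => x; case: (I m) (I0 m) => // y _; rewrite -EFinD => -[h]; congr EFin.
  by rewrite -exprM (_ : (2 * m.+1 = 2 * m + 2)%N) ?mulnS ?[(2 + _)%N]addnC//; lra.
have IE0 : I 0%N = ((1 - q ^+ 2) * disc_area)%:E by rewrite IE expr1.
have mA : measurable (disc 1 `\` disc q) by exact: measurableD.
rewrite -!lee_fin EFinM -IE0 -IE; apply/andP; split.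
  rewrite /I -ge0_integralZl_EFin//; [|exact: mpow|by rewrite !exprn_ge0// ltW].
  apply: ge0_le_integral => //.
  - by move=> p _; rewrite -EFinM lee_fin expr0 mulr1 !exprn_ge0// ltW.
  - by apply: measurable_funeM; exact: mpow.
  - exact: mpow.
  - move=> p [_ /negP]; rewrite -leNgt => qp.
    rewrite -EFinM lee_fin expr0 mulr1 -exprM lerXn2r ?nnegrE ?modulus_ge0//.
    exact: ltW.
apply: ge0_le_integral => //.
- by move=> p _; rewrite lee_fin exprn_ge0// modulus_ge0.
- exact: mpow.
- exact: mpow.
- by move=> p [/ltW p1 _]; rewrite lee_fin expr0 exprn_ile1// modulus_ge0.
Qed.

(* By dilation, [1 - q ^+ (2 * n + 2)] times the moment is the integral over the
   annulus [q <= |z| < 1], where [|z| ^+ (2 * n)] is between [q ^+ (2 * n)] and 1;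
   divide by the area [1 - q ^+ 2] and let [q] tend to 1. *)
Lemma momentE n : moment n 1 = (disc_area / n.+1%:R)%:E.
Proof.
rewrite moment_fin; congr EFin; set m := fine _.
have m0 : 0 <= m by apply: fine_ge0.
have N0 : 0 < n.+1%:R :> R by rewrite ltr0n.
have S s : 0 < s -> s < 1 ->
    s ^+ n * disc_area <= (\sum_(i < n.+1) s ^+ i) * m /\ (\sum_(i < n.+1) s ^+ i) * m <= disc_area.
  move=> s0 s1; have q0 : 0 < Num.sqrt s by rewrite sqrtr_gt0.
  have q1 : Num.sqrt s < 1 by rewrite -sqrtr1 ltr_sqrt.
  have := annulus_bounds n q0 q1; rewrite -/m sqr_sqrtr ?(ltW s0)// => /andP[].
  have -> : 1 - s ^+ n.+1 = (1 - s) * \sum_(i < n.+1) s ^+ i.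
    by rewrite -[LHS]opprB subrX1 -mulNr opprB.
  rewrite -mulrA [_ * ((1 - s) * _)]mulrCA !ler_pM2l ?subr_gt0//.
apply/eqP; rewrite eq_le ler_pdivlMr// ler_pdivrMr//; apply/andP; split.
  apply: (@expr_limit_le _ _ n); first by rewrite mulr_ge0// ltW.
  move=> s s0 s1; apply: le_trans (S s s0 s1).2.
  rewrite mulrCA mulrC ler_wpM2r// mulr_natr -[X in _ *+ X]card_ord -sumr_const.
  by apply: ler_sum => i _; rewrite ler_wiXn2l ?(ltW s0) ?(ltW s1)// -ltnS.
apply: (@expr_limit_le _ _ n); first by rewrite ltW// disc_area_gt0.
move=> s s0 s1; apply: le_trans (S s s0 s1).1 _.
rewrite mulrC ler_wpM2l// -[n.+1 in leRHS]card_ord -sumr_const.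
by apply: ler_sum => i _; rewrite exprn_ile1 ?(ltW s0) ?(ltW s1).
Qed.

Lemma integral_disc_polyE K b r : 0 < r ->
  (\int[mu2]_(p in disc r) (modulus (\sum_(n < K) b n * cplx p ^+ n) ^+ 2)%:E =
   (disc_area * \sum_(n < K) modulus (b n) ^+ 2 / n.+1%:R * r ^+ (2 * n + 2))%:E)%E.
Proof.
move=> r0; rewrite integral_disc_poly// mulr_sumr -sumEFin; apply: eq_bigr => n _.
by rewrite moment_dilation// momentE -EFinM; congr EFin; rewrite /=; ring.
Qed.

End AreaIntegrals.

(** * Area integrals of power series in terms of their coefficients *)

Section AreaPowerSeries.
Variable R : realType.
Notation C := R[i].
Notation mu := (@lebesgue_measure R).
Notation mu2 := (mu \x mu)%E.
Implicit Types (b : nat -> C) (z : C) (f : C -> C).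

(** Uniform convergence on |z| <= q: with s halfway from q to 1 and t = q / s, the tail from N on is
    at most M t^N / (1 - t). *)
Lemma ev_tail b (q e : R) : radius1 b -> 0 <= q -> q < 1 -> 0 < e ->
  exists N0, forall N z, (N0 <= N)%N -> modulus z <= q ->
    modulus (ev b z - \sum_(i < N) b i * z ^+ i) <= e.
Proof.
move=> rb q0 q1 e0; pose s := (1 + q) / 2.
have [s0 s1 qs] : [/\ 0 < s, s < 1 & q < s] by rewrite /s; split; lra.
have [M hM] := rb s (ltW s0) s1.
have M0 : 0 <= M by apply: le_trans (hM 0%N); rewrite mulr_ge0 ?modulus_ge0// exprn_ge0// ltW.
pose t := q / s.
have t0 : 0 <= t by rewrite divr_ge0// ltW.
have t1 : t < 1 by rewrite ltr_pdivrMr// mul1r.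
have e1 : 0 < e * (1 - t) / (M + 1) by rewrite divr_gt0 ?mulr_gt0 ?subr_gt0//; lra.
have : (GRing.exp t : R ^nat) @ \oo --> (0 : R) by apply: cvg_expr; rewrite ger0_norm.
move=> /cvgr0Pnorm_lt /(_ _ e1) [N0 _ hN0]; exists N0 => N z N0N zq.
have z1 : modulus z < 1 by exact: le_lt_trans q1.
have T : tends (fun L => \sum_(i < N + L) b i * z ^+ i - \sum_(i < N) b i * z ^+ i)
    (ev b z - \sum_(i < N) b i * z ^+ i).
  apply: tendsB (tends_cst _); have := ev_tends rb z1.
  move=> /tendsP h; apply/tendsP => x /h [m hm]; exists m => n mn; apply: hm.
  exact: leq_trans mn (leq_addl _ _).
apply: (tends_modulus_le T) => L.
rewrite big_split_ord /= addrAC subrr add0r (le_trans (modulus_sum _ _ _))//.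
apply: (@le_trans _ _ (\sum_(i < L) M * t ^+ N * t ^+ i)).
  apply: ler_sum => i _; rewrite -mulrA -exprD modulusM modulusX.
  apply: (@le_trans _ _ (modulus (b (N + i)%N) * q ^+ (N + i))).
    by rewrite ler_wpM2l ?modulus_ge0// lerXn2r ?nnegrE ?modulus_ge0.
  rewrite /t expr_div_n mulrA ler_pdivlMr ?exprn_gt0// mulrAC.
  by rewrite ler_wpM2r ?exprn_ge0.
rewrite -mulr_sumr.
have h1 := geometric_sum_le L t0 t1.
have : t ^+ N < e * (1 - t) / (M + 1).
  by have := hN0 N N0N; rewrite /= ger0_norm ?exprn_ge0.
rewrite ltr_pdivlMr; last by lra.
move=> h2; apply: (@le_trans _ _ (M * t ^+ N * (1 - t)^-1)).
  by rewrite ler_wpM2l// mulr_ge0// exprn_ge0.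
rewrite ler_pdivrMr ?subr_gt0//; have := exprn_ge0 N t0; nra.
Qed.

Lemma ev_plane_measurable b : radius1 b ->
  measurable_fun (disc (1 : R)) (fun p => modulus (ev b (cplx p)) ^+ 2).
Proof.
move=> rb.
apply: (@measurable_fun_cvg _ _ _ _ (fun K p => modulus (\sum_(n < K) b n * cplx p ^+ n) ^+ 2)).
  by move=> K; apply: measurable_funTS; exact: plane_measurable_poly.
move=> p p1; have h := tends_modulus (ev_tends rb p1).
by rewrite expr2; under [X in X @ _ --> _]eq_fun do rewrite expr2; exact: cvgM.
Qed.

(** Fatou's lemma along the partial sums, whose integrals are given exactly by
    [integral_disc_polyE]. *)
Lemma area_ev_le b (S : R) : radius1 b ->
  (forall K, \sum_(n < K) modulus (b n) ^+ 2 / n.+1%:R <= S) ->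
  (\int[mu2]_(p in disc 1) (modulus (ev b (cplx p)) ^+ 2)%:E <= (disc_area R * S)%:E)%E.
Proof.
move=> rb hS.
pose h K p := (modulus (\sum_(n < K) b n * cplx p ^+ n) ^+ 2)%:E.
have m1 : measurable (disc (1 : R)) by exact: measurable_disc.
have -> : (\int[mu2]_(p in disc 1) (modulus (ev b (cplx p)) ^+ 2)%:E =
    \int[mu2]_(p in disc 1) limn_einf (h ^~ p))%E.
  apply: eq_integral => p /set_mem p1.
  have hp : h ^~ p @ \oo --> (modulus (ev b (cplx p)) ^+ 2)%:E.
    have T := tends_modulus (ev_tends rb p1).
    apply: cvg_EFin; first by near=> n.
    by rewrite expr2; under [X in X @ _ --> _]eq_fun do rewrite /h/= expr2; exact: cvgM.
  by rewrite (cvg_limn_einf_sup hp).1.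
apply: le_trans (fatou _ _ _ _) _ => //.
- by move=> K; apply/measurable_funTS/measurable_EFinP; exact: plane_measurable_poly.
- by move=> K p _; rewrite lee_fin exprn_ge0// modulus_ge0.
rewrite limn_einf_lim; apply: lime_le; first exact: is_cvg_einfs.
near=> K; apply: le_trans (_ : \int[mu2]_(p in disc 1) h K p <= _)%E.
  by apply: ereal_inf_lbound; exists K => /=.
rewrite integral_disc_polyE// lee_fin ler_wpM2l ?(ltW (disc_area_gt0 R))//.
apply: le_trans (hS K); apply: ler_sum => i _.
by rewrite expr1n mulr1.
Unshelve. all: by end_near. Qed.

(** On a disc of radius q < 1 a long partial sum P is within 1 of the function f, so |P|^2 <= 2
    |f|^2 + 2 and the integral of |P|^2 is bounded independently of q; keep the first K terms and
    let q tend to 1. *)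
Lemma area_ev_ge b : radius1 b ->
  (\int[mu2]_(p in disc 1) (modulus (ev b (cplx p)) ^+ 2)%:E < +oo)%E ->
  exists S : R, forall K, \sum_(n < K) modulus (b n) ^+ 2 / n.+1%:R <= S.
Proof.
move=> rb Vfin.
have m1 : measurable (disc (1 : R)) by exact: measurable_disc.
have V0 : (0 <= \int[mu2]_(p in disc 1) (modulus (ev b (cplx p)) ^+ 2)%:E)%E.
  by apply: integral_ge0 => p _; rewrite lee_fin exprn_ge0// modulus_ge0.
have A0 := disc_area_gt0 R.
have ev_m := ev_plane_measurable rb.
have area1 : mu2 (disc 1) = (disc_area R)%:E.
  have := integral_disc_polyE 1 (fun=> 1) (@ltr01 R).
  under eq_integral do rewrite big_ord1 expr0 mulr1 modulus1 expr1n.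
  by rewrite integral_cst// mul1e big_ord1 modulus1 !expr1n invr1 !mulr1.
pose W := (\int[mu2]_(p in disc 1) (2 * modulus (ev b (cplx p)) ^+ 2 + 2)%:E)%E.
have mW : measurable_fun (disc (1 : R)) (fun p => 2 * modulus (ev b (cplx p)) ^+ 2 + 2).
  by apply: measurable_funD => //; apply: measurable_funM.
have Wfin : (W < +oo)%E.
  have -> : W = (2%:E * (\int[mu2]_(p in disc 1) (modulus (ev b (cplx p)) ^+ 2)%:E) + 2%:E * (disc_area R)%:E)%E.
    rewrite /W; under eq_integral do rewrite EFinD EFinM.
    rewrite ge0_integralD//; last 2 first.
    - by move=> p _; rewrite -EFinM lee_fin mulr_ge0// exprn_ge0// modulus_ge0.
    - by apply: measurable_funeM; apply/measurable_EFinP.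
    rewrite ge0_integralZl_EFin//; last 2 first.
    - by move=> p _; rewrite lee_fin exprn_ge0// modulus_ge0.
    - by apply/measurable_EFinP.
    by rewrite -area1; congr (_ + _)%E; rewrite integral_cst.
  by rewrite lte_add_pinfty// lte_mul_pinfty// ltry.
have W0 : (0 <= W)%E.
  by apply: integral_ge0 => p _; rewrite lee_fin addr_ge0// mulr_ge0// exprn_ge0// modulus_ge0.
have WE : W = (fine W)%:E by rewrite fineK// ge0_fin_numE.
exists (fine W / disc_area R) => K.
apply: (@expr_limit_le _ _ _ (2 * K)).
  by apply: sumr_ge0 => i _; rewrite divr_ge0// exprn_ge0// modulus_ge0.
move=> q q0 q1.
have [N0 hN0] := ev_tail rb (ltW q0) q1 (@ltr01 R).
pose N := maxn N0 K.
have dq1 : disc q `<=` disc 1 by move=> p /lt_trans; apply.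
have mq := measurable_disc q0.
have : (\int[mu2]_(p in disc q) (modulus (\sum_(n < N) b n * cplx p ^+ n) ^+ 2)%:E <= W)%E.
  apply: (@le_trans _ _ (\int[mu2]_(p in disc q) (2 * modulus (ev b (cplx p)) ^+ 2 + 2)%:E)%E).
    apply: ge0_le_integral => //.
    - by move=> p _; rewrite lee_fin exprn_ge0// modulus_ge0.
    - by apply/measurable_funTS/measurable_EFinP; exact: plane_measurable_poly.
    - by apply: (measurable_funS m1) => //; apply/measurable_EFinP.
    move=> p pq; rewrite lee_fin.
    have := hN0 N (cplx p) (leq_maxl _ _) (ltW pq); rewrite modulusB.
    set P := \sum_(n < N) _; set E := ev b _ => h.
    have hP : modulus P <= modulus (P - E) + modulus E by rewrite -{1}[P](subrK E) modulusD.
    have P0 := modulus_ge0 P; have E0 := modulus_ge0 E.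
    have {}hP : modulus P <= modulus E + 1 by lra.
    have {}hP : modulus P ^+ 2 <= (modulus E + 1) ^+ 2.
      by rewrite lerXn2r ?nnegrE// addr_ge0.
    have := sqr_ge0 (modulus E - 1); rewrite sqrrB; move: hP; rewrite sqrrD expr1n !mulr1; lra.
  apply: ge0_subset_integral => //; first by apply/measurable_EFinP.
  by move=> p _; rewrite lee_fin addr_ge0// mulr_ge0// exprn_ge0// modulus_ge0.
rewrite integral_disc_polyE// WE lee_fin mulrC -ler_pdivlMr//; apply: le_trans.
rewrite /N -(big_mkord xpredT (fun n => modulus (b n) ^+ 2 / n.+1%:R * q ^+ (2 * n + 2))).
rewrite (big_cat_nat (n := K)) ?leq_maxr//= big_mkord.
apply: (@le_trans _ _ (\sum_(i < K) modulus (b i) ^+ 2 / i.+1%:R * q ^+ (2 * i + 2))).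
  rewrite mulr_sumr; apply: ler_sum => i _; rewrite mulrC ler_wpM2l//.
    by rewrite divr_ge0// exprn_ge0// modulus_ge0.
  by rewrite ler_wiXn2l ?(ltW q0) ?(ltW q1)// addnC -mulnS leq_mul2l /= ltn_ord.
rewrite lerDl; apply: sumr_ge0 => i _.
by rewrite mulr_ge0 ?divr_ge0 ?exprn_ge0 ?modulus_ge0// ltW.
Qed.

Lemma dirichlet_integral_finite f : (dirichlet_integral f < +oo)%E <->
  (\int[mu2]_(p in disc 1) (modulus (derive1 f (cplx p)) ^+ 2)%:E < +oo)%E.
Proof.
rewrite /dirichlet_integral.
have -> : [set p : R * R | unit_disc (p.1 +i* p.2)] = disc 1.
  by apply/seteqP; split => p /unit_discE.
have I0 : (0 <= \int[mu2]_(p in disc 1) (modulus (derive1 f (cplx p)) ^+ 2)%:E)%E.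
  by apply: integral_ge0 => p _; rewrite lee_fin exprn_ge0// modulus_ge0.
rewrite -/(modulus _); split => h; last by rewrite lte_mul_pinfty// lee_fin invr_ge0 pi_ge0.
move: I0 h; rewrite /modulus /cplx; case: (integral _ _ _) => [x|//|//] _ h; rewrite ?ltry//.
by move: h; rewrite gt0_muley// lte_fin invr_gt0 pi_gt0.
Qed.

End AreaPowerSeries.

(** * Cauchy's theorem and power series expansion *)

Section PathIntegral.
Variable R : realType.
Notation C := R[i].
Implicit Types (h k F : R -> C) (x y t : R).

(** The base point -1 makes 0, the smallest parameter in use, an interior point, so that the
    fundamental theorem gives a two-sided derivative there. *)
Definition primitive (u : R -> R) x : R :=
  (\int[lebesgue_measure]_(t in `[(-1)%R, x]) u t)%R.

Lemma primitive_derive (u : R -> R) x : continuous u -> -1 < x ->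
  is_derive x 1 (primitive u) (u x).
Proof.
move=> cu x1.
have int_u : lebesgue_measure.-integrable `[(-1)%R, x + 1] (EFin \o u).
  apply: continuous_compact_integrable; first exact: segment_compact.
  exact: continuous_subspaceT.
have xx1 : x < x + 1 by rewrite ltrDl.
have [d e] := continuous_FTC1_closed xx1 int_u x1 (cu x).
by apply: DeriveDef; [exact: d|rewrite -derive1E; exact: e].
Qed.

Lemma derive_unique (U V : R -> R) (u : R -> R) x y : x <= y ->
  (forall t, x <= t <= y -> is_derive t 1 U (u t)) ->
  (forall t, x <= t <= y -> is_derive t 1 V (u t)) ->
  U y - U x = V y - V x.
Proof.
move=> xy hU hV.
have D t : x <= t <= y -> is_derive t 1 (U - V) 0.
  by move=> /[dup] /hU hu /hV hv; rewrite -(subrr (u t)); exact: is_deriveB.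
have [||z _] := @MVT_segment _ (U - V) (fun=> 0) x y xy.
- by move=> t; rewrite in_itv/= => /andP[xt ty]; apply: D; rewrite !ltW.
- by apply: derivable_within_continuous => t; rewrite in_itv/= => /D[].
have E w : (U - V) w = U w - V w by [].
by rewrite mul0r !E; lra.
Qed.

Lemma derive_bound (U u : R -> R) (M : R) x y : x <= y ->
  (forall t, x <= t <= y -> is_derive t 1 U (u t)) ->
  (forall t, x <= t <= y -> `|u t| <= M) -> `|U y - U x| <= M * (y - x).
Proof.
move=> xy hU hM.
have [||z zxy ->] := @MVT_segment _ U u x y xy.
- by move=> t; rewrite in_itv/= => /andP[xt ty]; apply: hU; rewrite !ltW.
- by apply: derivable_within_continuous => t; rewrite in_itv/= => /hU[].
rewrite normrM (ger0_norm (_ : 0 <= y - x)) ?subr_ge0// ler_wpM2r ?subr_ge0//.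
by apply: hM; rewrite in_itv/= in zxy.
Qed.

Definition ccontinuous h := forall x (e : R), 0 < e ->
  exists2 d : R, 0 < d & forall y, `|y - x| < d -> modulus (h y - h x) < e.

Lemma ccontinuous_Re h : ccontinuous h -> continuous (fun x => complex.Re (h x)).
Proof.
move=> ch x; apply/cvgrPdist_lt => e /(ch x)[d d0 hd].
apply/nbhs_ballP; exists d => // y; rewrite /ball /= distrC => /hd.
apply: le_lt_trans; rewrite distrC.
have -> : complex.Re (h y) - complex.Re (h x) = complex.Re (h y - h x).
  by case: (h y) (h x) => ? ? [].
exact: Re_le_modulus.
Qed.

Lemma ccontinuous_Im h : ccontinuous h -> continuous (fun x => complex.Im (h x)).
Proof.
move=> ch x; apply/cvgrPdist_lt => e /(ch x)[d d0 hd].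
apply/nbhs_ballP; exists d => // y; rewrite /ball /= distrC => /hd.
apply: le_lt_trans; rewrite distrC.
have -> : complex.Im (h y) - complex.Im (h x) = complex.Im (h y - h x).
  by case: (h y) (h x) => ? ? [].
exact: Im_le_modulus.
Qed.

Lemma ccontinuousD h k : ccontinuous h -> ccontinuous k -> ccontinuous (fun x => h x + k x).
Proof.
move=> ch ck x e e0; have e2 : 0 < e / 2 by rewrite divr_gt0.
have [d1 d10 h1] := ch x _ e2; have [d2 d20 h2] := ck x _ e2.
exists (Num.min d1 d2); first by rewrite lt_min d10.
move=> y; rewrite lt_min => /andP[/h1 H /h2 K].
by rewrite opprD addrACA (le_lt_trans (modulusD _ _))//; lra.
Qed.

Lemma ccontinuousM h k : ccontinuous h -> ccontinuous k -> ccontinuous (fun x => h x * k x).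
Proof.
move=> ch ck x e e0.
pose A := modulus (h x); pose B := modulus (k x).
have [A0 B0] : 0 <= A /\ 0 <= B by split; exact: modulus_ge0.
pose K := A + B + 1; have K0 : 0 < K by rewrite /K; lra.
pose e' := Num.min 1 (e / (2 * K)).
have e'0 : 0 < e' by rewrite lt_min ltr01 divr_gt0// mulr_gt0.
have e'1 : e' <= 1 by rewrite ge_min lexx.
have e'K : e' * (2 * K) <= e by rewrite -ler_pdivlMr ?mulr_gt0// ge_min lexx orbT.
have [d1 d10 h1] := ch x _ e'0; have [d2 d20 h2] := ck x _ e'0.
exists (Num.min d1 d2); first by rewrite lt_min d10.
move=> y; rewrite lt_min => /andP[/h1 /ltW H /h2 /ltW L].
have -> : h y * k y - h x * k x = (h y - h x) * (k y - k x) + (h y - h x) * k x + h x * (k y - k x) by ring.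
apply: (@le_lt_trans _ _ (e' * 1 + e' * B + A * e')).
  apply: (le_trans (modulusD _ _)); apply: lerD; first apply: (le_trans (modulusD _ _));
    first apply: lerD; rewrite modulusM.
  - by apply: ler_pM; rewrite ?modulus_ge0//; exact: le_trans e'1.
  - by rewrite ler_wpM2r.
  - by rewrite ler_wpM2l.
apply: lt_le_trans e'K; rewrite /K; nra.
Qed.

Lemma ccontinuous_cst (c : C) : ccontinuous (fun=> c).
Proof. by move=> x e e0; exists 1 => // y _; rewrite subrr modulus0. Qed.

Lemma ccontinuous_comp (g : C -> C) h : ccontinuous h ->
  (forall x (e : R), 0 < e -> exists2 d : R, 0 < d & forall w, modulus w < d ->
    modulus (g (h x + w) - g (h x)) < e) ->
  ccontinuous (fun x => g (h x)).
Proof.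
move=> ch cg x e e0; have [d d0 hd] := cg x e e0; have [d' d'0 hd'] := ch x d d0.
exists d' => // y /hd' /hd.
by rewrite [h x + _]addrC subrK.
Qed.

(** A difference of primitives rather than an integral over [x, y]: additivity in the end points is
    then an algebraic identity, and linearity follows from [cint_FTC]. *)
Definition cint h x y : C :=
  (primitive (fun t => complex.Re (h t)) y - primitive (fun t => complex.Re (h t)) x) +i*
  (primitive (fun t => complex.Im (h t)) y - primitive (fun t => complex.Im (h t)) x).

Definition rderiv F x (l : C) :=
  is_derive x 1 (fun t => complex.Re (F t)) (complex.Re l) /\
  is_derive x 1 (fun t => complex.Im (F t)) (complex.Im l).

Lemma cint_FTC h F x y : ccontinuous h -> -1 < x -> x <= y ->
  (forall t, x <= t <= y -> rderiv F t (h t)) -> cint h x y = F y - F x.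
Proof.
move=> ch x1 xy dF.
have p1 t : x <= t <= y -> -1 < t by move=> /andP[xt _]; exact: lt_le_trans xt.
rewrite /cint.
have er := derive_unique xy (fun t txy => primitive_derive (ccontinuous_Re ch) (p1 t txy))
  (fun t txy => (dF t txy).1).
have ei := derive_unique xy (fun t txy => primitive_derive (ccontinuous_Im ch) (p1 t txy))
  (fun t txy => (dF t txy).2).
rewrite {}er {}ei.
by case: (F y) (F x) => ? ? [].
Qed.

Lemma cint_chasles h x y t : cint h x y = cint h x t + cint h t y.
Proof. by rewrite /cint; simpc; congr (_ +i* _); ring. Qed.

(** The factor 2 comes from bounding the real and imaginary parts separately by the mean value
    theorem. *)
Lemma cint_bound h x y (M : R) : ccontinuous h -> -1 < x -> x <= y ->
  (forall t, x <= t <= y -> modulus (h t) <= M) -> modulus (cint h x y) <= 2 * M * (y - x).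
Proof.
move=> ch x1 xy hM.
have p1 t : x <= t <= y -> -1 < t by move=> /andP[xt _]; exact: lt_le_trans xt.
apply: le_trans (modulus_le_ReIm _) _ => /=.
have -> : 2 * M * (y - x) = M * (y - x) + M * (y - x) by ring.
apply: lerD; apply: derive_bound => // t txy.
- by apply: primitive_derive (p1 _ txy); exact: ccontinuous_Re.
- by apply: le_trans (hM _ txy); exact: Re_le_modulus.
- by apply: primitive_derive (p1 _ txy); exact: ccontinuous_Im.
- by apply: le_trans (hM _ txy); exact: Im_le_modulus.
Qed.

Lemma rderivD F G x l m : rderiv F x l -> rderiv G x m -> rderiv (fun t => F t + G t) x (l + m).
Proof.
have ReD (u v : C) : complex.Re (u + v) = complex.Re u + complex.Re v by case: u v => ? ? [].
have ImD (u v : C) : complex.Im (u + v) = complex.Im u + complex.Im v by case: u v => ? ? [].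
move=> [Fr Fi] [Gr Gi]; split.
  by under [fun t => _]eq_fun do rewrite ReD; rewrite ReD; exact: is_deriveD.
by under [fun t => _]eq_fun do rewrite ImD; rewrite ImD; exact: is_deriveD.
Qed.

Lemma rderivM F G x l m : rderiv F x l -> rderiv G x m ->
  rderiv (fun t => F t * G t) x (l * G x + F x * m).
Proof.
have ReM (u v : C) : complex.Re (u * v) = complex.Re u * complex.Re v - complex.Im u * complex.Im v by case: u v => ? ? [].
have ImM (u v : C) : complex.Im (u * v) = complex.Re u * complex.Im v + complex.Im u * complex.Re v by case: u v => ? ? [].
have ReD (u v : C) : complex.Re (u + v) = complex.Re u + complex.Re v by case: u v => ? ? [].
have ImD (u v : C) : complex.Im (u + v) = complex.Im u + complex.Im v by case: u v => ? ? [].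
move=> [Fr Fi] [Gr Gi]; split.
  under [fun t => _]eq_fun do rewrite ReM; rewrite ReD !ReM.
  apply: is_derive_eq (is_deriveB (is_deriveM Fr Gr) (is_deriveM Fi Gi)) _.
  by rewrite /GRing.scale /=; ring.
under [fun t => _]eq_fun do rewrite ImM; rewrite ImD !ImM.
apply: is_derive_eq (is_deriveD (is_deriveM Fr Gi) (is_deriveM Fi Gr)) _.
by rewrite /GRing.scale /=; ring.
Qed.

Lemma rderiv_cst (c : C) x : rderiv (fun=> c) x 0.
Proof. by split; exact: is_derive_cst. Qed.

Lemma rderiv_real x : rderiv (fun t => t%:C) x 1.
Proof. by split => /=; [exact: is_derive_id|exact: is_derive_cst]. Qed.

Lemma rderiv_expi x : rderiv (@expi R) x ('i * expi x).
Proof.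
split; rewrite /expi /=.
  by apply: is_derive_eq (is_derive_cos x) _; ring.
by apply: is_derive_eq (is_derive_sin x) _; ring.
Qed.

Lemma rderivZ (c : C) F x l : rderiv F x l -> rderiv (fun t => c * F t) x (c * l).
Proof. by move=> Fl; have := rderivM (rderiv_cst c x) Fl; rewrite mul0r add0r. Qed.

Lemma cintD h k x y : ccontinuous h -> ccontinuous k -> -1 < x -> x <= y ->
  cint (fun t => h t + k t) x y = cint h x y + cint k x y.
Proof.
move=> ch ck x1 xy.
pose P h t := cint h x t.
have E h' : P h' y - P h' x = cint h' x y.
  by rewrite /P {2}/cint !subrr subr0.
have dP h' t : ccontinuous h' -> x <= t <= y -> rderiv (P h') t (h' t).
  move=> ch' /andP[xt _]; have t1 : -1 < t by exact: lt_le_trans xt.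
  have dr := primitive_derive (ccontinuous_Re ch') t1.
  have di := primitive_derive (ccontinuous_Im ch') t1.
  by split => /=; rewrite -[X in is_derive _ _ _ X]subr0; apply: is_deriveB.
rewrite (@cint_FTC _ (fun t => P h t + P k t))//.
- by have <- := E h; have <- := E k; rewrite opprD addrACA.
- exact: ccontinuousD.
by move=> t txy; apply: rderivD; exact: dP.
Qed.

Lemma cintZ (c : C) h x y : ccontinuous h -> -1 < x -> x <= y ->
  cint (fun t => c * h t) x y = c * cint h x y.
Proof.
move=> ch x1 xy.
pose P h t := cint h x t.
have E : P h y - P h x = cint h x y by rewrite /P {2}/cint !subrr subr0.
rewrite -E mulrBr.
apply: (@cint_FTC _ (fun t => c * P h t)) => //.
  by apply: ccontinuousM => //; exact: ccontinuous_cst.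
move=> t /andP[xt _]; have t1 : -1 < t by exact: lt_le_trans xt.
apply: rderivZ.
have dr := primitive_derive (ccontinuous_Re ch) t1.
have di := primitive_derive (ccontinuous_Im ch) t1.
by split => /=; rewrite -[X in is_derive _ _ _ X]subr0; apply: is_deriveB.
Qed.

End PathIntegral.

(** * Contour integrals on the cone from a point to a circle *)

Section Goursat.
Variable R : realType.
Notation C := R[i].
Implicit Types (k g : C -> C) (s t x y : R) (z : C).

Lemma expi_lipschitz x y : modulus (expi y - expi x) <= 2 * `|y - x|.
Proof.
wlog xy : x y / x <= y => [hw|].
  have [/hw//|/ltW yx] := leP x y; rewrite modulusB distrC; exact: hw.
have hc : `|cos y - cos x| <= 1 * (y - x).
  apply: (@derive_bound _ _ (fun t => - sin t)) => // t _.
  by rewrite normrN sin_max.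
have hs : `|sin y - sin x| <= 1 * (y - x).
  apply: (@derive_bound _ _ cos) => // t _.
  by rewrite cos_max.
apply: le_trans (modulus_le_ReIm _) _; rewrite /= [X in 2 * X]ger0_norm ?subr_ge0//.
by apply: le_trans (lerD hc hs) _; rewrite mul1r; lra.
Qed.

Lemma ccontinuous_expi : ccontinuous (@expi R).
Proof.
move=> x e e0; exists (e / 3) => [|y yx]; first by rewrite divr_gt0.
by apply: le_lt_trans (expi_lipschitz x y) _; lra.
Qed.

(** [cone s t] is known to lie in the disc only for s in [0, 1]; clamping the parameter makes the
    integrands continuous on the whole line, as [ccontinuous] asks, and leaves them unchanged on
    [0, 1]. *)
Definition clamp s : R := Num.max 0 (Num.min 1 s).

Lemma clamp_id s : 0 <= s <= 1 -> clamp s = s.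
Proof. by move=> /andP[s0 s1]; rewrite /clamp min_r// max_r. Qed.

Lemma clamp01 s : 0 <= clamp s <= 1.
Proof. by rewrite /clamp le_max lexx /= ge_max ler01 ge_min lexx. Qed.

Lemma clamp_lipschitz x y : `|clamp y - clamp x| <= `|y - x|.
Proof.
have h1 := ler_norm (y - x); have h2 := ler_norm (- (y - x)); rewrite normrN in h2.
rewrite ler_norml /clamp /Num.max /Num.min; case: (ltP 1 x) => ?; case: (ltP 1 y) => ?;
  case: ltP => ?; case: ltP => ?; apply/andP; split; lra.
Qed.

Lemma ccontinuous_clamp : ccontinuous (fun s => (clamp s)%:C).
Proof.
move=> x e e0; exists e => // y yx; rewrite -rmorphB modulus_real.
exact: le_lt_trans (clamp_lipschitz _ _) yx.
Qed.

Definition continuous_on_disc g := forall z, modulus z < 1 -> forall e : R, 0 < e ->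
  exists2 d : R, 0 < d & forall h, modulus h < d -> modulus (g (z + h) - g z) < e.

Lemma affine_continuous_on_disc (u v : C) : continuous_on_disc (fun z => u + v * z).
Proof.
move=> z _ e e0; exists (e / (modulus v + 1)).
  by rewrite divr_gt0// ltr_wpDl// modulus_ge0.
move=> h; rewrite ltr_pdivlMr ?ltr_wpDl ?modulus_ge0// => hh.
have -> : u + v * (z + h) - (u + v * z) = h * v by ring.
rewrite modulusM; apply: le_lt_trans hh; rewrite ler_wpM2l ?modulus_ge0//; lra.
Qed.

Lemma continuous_on_discD k g : continuous_on_disc k -> continuous_on_disc g ->
  continuous_on_disc (fun z => k z + g z).
Proof.
move=> ck cg z z1 e e0; have e2 : 0 < e / 2 by rewrite divr_gt0.
have [d1 d10 h1] := ck z z1 _ e2; have [d2 d20 h2] := cg z z1 _ e2.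
exists (Num.min d1 d2); first by rewrite lt_min d10.
move=> y; rewrite lt_min => /andP[/h1 H /h2 K].
by rewrite opprD addrACA (le_lt_trans (modulusD _ _))//; lra.
Qed.

Variables (a : C) (r : R).
Hypothesis (ar : modulus a < r) (r1 : r < 1).

Let r0 : 0 < r. Proof. exact: le_lt_trans (modulus_ge0 a) ar. Qed.

Definition radial t : C := r%:C * expi t - a.

(* The segments from [a] to the points of the circle of radius [r]. *)
Definition cone s t : C := a + s%:C * radial t.

Lemma modulus_circle t : modulus (r%:C * expi t) = r.
Proof. by rewrite modulusM modulus_expi mulr1 modulus_real gtr0_norm. Qed.

Lemma modulus_radial_le t : modulus (radial t) <= 2.
Proof. by apply: le_trans (modulusD _ _) _; rewrite modulusN modulus_circle; have := ar; have := r1; lra. Qed.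

Lemma radial_neq0 t : radial t != 0.
Proof.
by rewrite subr_eq0; apply/eqP => e; have := modulus_circle t; rewrite e; have := ar; lra.
Qed.

Lemma modulus_cone_lt s t : 0 <= s <= 1 -> modulus (cone s t) < 1.
Proof.
move=> /andP[s0 s1]; apply: le_lt_trans r1.
have -> : cone s t = (1 - s)%:C * a + s%:C * (r%:C * expi t).
  by rewrite /cone /radial rmorphB; ring.
apply: le_trans (modulusD _ _) _; rewrite modulusM modulus_real [X in _ + X]modulusM modulus_circle modulus_real.
rewrite !ger0_norm ?subr_ge0//; have := ar; nra.
Qed.

Lemma cone_lipschitz s s' t t' : 0 <= s <= 1 ->
  modulus (cone s t - cone s' t') <= 2 * (`|s - s'| + `|t - t'|).
Proof.
move=> /andP[s0 s1].
have -> : cone s t - cone s' t' = (s - s')%:C * radial t' + s%:C * (r%:C * (expi t - expi t')).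
  by rewrite /cone /radial rmorphB; ring.
apply: le_trans (modulusD _ _) _; rewrite [leRHS]mulrDr; apply: lerD.
  by rewrite modulusM modulus_real mulrC ler_wpM2r ?modulus_radial_le.
rewrite !modulusM !modulus_real (ger0_norm s0) (ger0_norm (ltW r0)).
apply: le_trans (expi_lipschitz _ _).
have E0 := modulus_ge0 (expi t - expi t'); have R0 := ltW r0.
have : r * modulus (expi t - expi t') <= modulus (expi t - expi t') by rewrite ler_piMl// ltW// r1.
have : 0 <= r * modulus (expi t - expi t') by rewrite mulr_ge0.
nra.
Qed.

(** Together with [side_t], the integrals of k dz along the images of a segment t = const and of an
    arc s = const: the second factors of the integrands are the partial derivatives of [cone] in s
    and in t. *)
Definition side_s k t := cint (fun s => k (cone (clamp s) t) * radial t).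
Definition side_t k s :=
  cint (fun t => k (cone (clamp s) t) * ((clamp s)%:C * ('i * (r%:C * expi t)))).

(** Integral of k dz over the image of the boundary of the rectangle [s1, s2] x [t1, t2], traversed
    counterclockwise in the (s, t) plane. *)
Definition boundary k s1 s2 t1 t2 : C :=
  side_s k t1 s1 s2 + side_t k s2 t1 t2 - side_s k t2 s1 s2 - side_t k s1 t1 t2.

Lemma ccontinuous_circle : ccontinuous (fun t => r%:C * expi t).
Proof. by apply: ccontinuousM; [exact: ccontinuous_cst|exact: ccontinuous_expi]. Qed.

Lemma ccontinuous_side_s k t : continuous_on_disc k ->
  ccontinuous (fun s => k (cone (clamp s) t) * radial t).
Proof.
move=> ck; apply: ccontinuousM; last exact: ccontinuous_cst.
apply: ccontinuous_comp => [|s e e0].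
  apply: ccontinuousD; first exact: ccontinuous_cst.
  by apply: ccontinuousM; [exact: ccontinuous_clamp|exact: ccontinuous_cst].
by apply: ck => //; apply: modulus_cone_lt; exact: clamp01.
Qed.

Lemma ccontinuous_side_t k s : continuous_on_disc k ->
  ccontinuous (fun t => k (cone (clamp s) t) * ((clamp s)%:C * ('i * (r%:C * expi t)))).
Proof.
move=> ck; apply: ccontinuousM.
  apply: ccontinuous_comp => [|t e e0].
    apply: ccontinuousD; first exact: ccontinuous_cst.
    apply: ccontinuousM; first exact: ccontinuous_cst.
    by apply: ccontinuousD; [exact: ccontinuous_circle|exact: ccontinuous_cst].
  by apply: ck => //; apply: modulus_cone_lt; exact: clamp01.
by do 2 (apply: ccontinuousM; first exact: ccontinuous_cst); exact: ccontinuous_circle.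
Qed.

(** The affine function has the primitive u z + v z^2 / 2, so the contributions of the four sides
    telescope. *)
Lemma boundary_affine (u v : C) s1 s2 t1 t2 : 0 <= s1 -> s1 <= s2 -> s2 <= 1 ->
  0 <= t1 -> t1 <= t2 -> boundary (fun z => u + v * z) s1 s2 t1 t2 = 0.
Proof.
move=> s10 s12 s21 t10 t12.
pose G z := u * z + v / 2 * (z * z).
have two0 : (2 : C) != 0 by rewrite pnatr_eq0.
have ck := affine_continuous_on_disc u v.
have dG F x l : rderiv F x l -> rderiv (fun x => G (F x)) x ((u + v * F x) * l).
  move=> Fl; have -> : (u + v * F x) * l = u * l + v / 2 * (l * F x + F x * l) by field.
  by apply: rderivD; apply: rderivZ => //; exact: rderivM.
have dS s t : rderiv (fun s => cone s t) s (radial t).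
  have -> : radial t = 0 + (1 * radial t + s%:C * 0) by ring.
  apply: rderivD; first exact: rderiv_cst.
  by apply: rderivM; [exact: rderiv_real|exact: rderiv_cst].
have dT s t : rderiv (fun t => cone s t) t (s%:C * ('i * (r%:C * expi t))).
  have -> : s%:C * ('i * (r%:C * expi t)) = 0 + s%:C * (r%:C * ('i * expi t) + 0) by ring.
  apply: rderivD; first exact: rderiv_cst.
  apply: rderivZ; apply: rderivD; last exact: rderiv_cst.
  by apply: rderivZ; exact: rderiv_expi.
have S t : side_s (fun z => u + v * z) t s1 s2 = G (cone s2 t) - G (cone s1 t).
  apply: (@cint_FTC _ _ (fun s => G (cone s t))) => //.
  - exact: (ccontinuous_side_s t ck).
  - by lra.
  move=> s /andP[ss1 ss2]; rewrite clamp_id; last by apply/andP; split; lra.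
  exact: dG.
have T s : 0 <= s <= 1 -> side_t (fun z => u + v * z) s t1 t2 = G (cone s t2) - G (cone s t1).
  move=> s01; apply: (@cint_FTC _ _ (fun t => G (cone s t))) => //.
  - exact: (ccontinuous_side_t s ck).
  - by lra.
  by move=> t _; rewrite clamp_id//; exact: dG.
rewrite /boundary !S !T; try by apply/andP; split; lra.
by move: (G _) (G _) (G _) (G _) => *; ring.
Qed.

Lemma boundaryD k g s1 s2 t1 t2 : continuous_on_disc k -> continuous_on_disc g ->
  0 <= s1 -> s1 <= s2 -> 0 <= t1 -> t1 <= t2 ->
  boundary (fun z => k z + g z) s1 s2 t1 t2 = boundary k s1 s2 t1 t2 + boundary g s1 s2 t1 t2.
Proof.
move=> ck cg s10 s12 t10 t12.
have S t : side_s (fun z => k z + g z) t s1 s2 = side_s k t s1 s2 + side_s g t s1 s2.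
  rewrite /side_s -cintD//; try exact: ccontinuous_side_s; last by lra.
  by congr cint; apply/funext => s; rewrite mulrDl.
have T s : side_t (fun z => k z + g z) s t1 t2 = side_t k s t1 t2 + side_t g s t1 t2.
  rewrite /side_t -cintD//; try exact: ccontinuous_side_t; last by lra.
  by congr cint; apply/funext => t; rewrite mulrDl.
rewrite /boundary !S !T.
move: (side_s k _ _ _) (side_s k _ _ _) (side_s g _ _ _) (side_s g _ _ _)
  (side_t k _ _ _) (side_t k _ _ _) (side_t g _ _ _) (side_t g _ _ _) => *; ring.
Qed.

(** Each side contributes at most 4 E times its parameter length: the velocities of [cone] are
    bounded by 2, and [cint_bound] costs another 2. Two sides of each kind make 8. *)
Lemma boundary_bound k s1 s2 t1 t2 (E : R) : continuous_on_disc k ->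
  0 <= s1 -> s1 <= s2 -> s2 <= 1 -> 0 <= t1 -> t1 <= t2 -> 0 <= E ->
  (forall s t, s1 <= s <= s2 -> t1 <= t <= t2 -> modulus (k (cone s t)) <= E) ->
  modulus (boundary k s1 s2 t1 t2) <= 8 * E * ((s2 - s1) + (t2 - t1)).
Proof.
move=> ck s10 s12 s21 t10 t12 E0 kE.
have S t : t1 <= t <= t2 -> modulus (side_s k t s1 s2) <= 2 * (E * 2) * (s2 - s1).
  move=> tt; apply: cint_bound => //; first exact: ccontinuous_side_s.
    by lra.
  move=> s /andP[ss1 ss2]; rewrite clamp_id; last by apply/andP; split; lra.
  rewrite modulusM; apply: ler_pM; rewrite ?modulus_ge0 ?modulus_radial_le//.
  by apply: kE => //; apply/andP.
have T s : s1 <= s <= s2 -> modulus (side_t k s t1 t2) <= 2 * (E * 2) * (t2 - t1).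
  move=> ss; apply: cint_bound => //; first exact: ccontinuous_side_t.
    by lra.
  have s01 : 0 <= s <= 1 by move/andP: ss => [? ?]; apply/andP; split; lra.
  move=> t tt; rewrite clamp_id// modulusM; apply: ler_pM; rewrite ?modulus_ge0//.
    exact: kE.
  rewrite modulusM [X in _ * X]modulusM modulus_circle modulus_real.
  have -> : modulus ('i : C) = 1 by rewrite /modulus /= expr0n expr1n add0r sqrtr1.
  move/andP: s01 => [s0 s1']; rewrite ger0_norm//; have := r1; nra.
have S1 := S t1; have S2 := S t2; have T1 := T s1; have T2 := T s2.
rewrite !lexx s12 t12 /= in S1 S2 T1 T2.
have {}S1 := S1 isT; have {}S2 := S2 isT; have {}T1 := T1 isT; have {}T2 := T2 isT.
have h (p q m n : C) : modulus (p + q - m - n) <= modulus p + modulus q + modulus m + modulus n.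
  do 2 (apply: le_trans (modulusD _ _) _; rewrite modulusN lerD2r).
  exact: modulusD.
apply: le_trans (h _ _ _ _) _.
clear kE S T h; move: (modulus _) (modulus _) (modulus _) (modulus _) S1 S2 T1 T2 => *; lra.
Qed.

Lemma boundary_split k s1 s2 s3 t1 t2 t3 :
  boundary k s1 s3 t1 t3 = boundary k s1 s2 t1 t2 + boundary k s2 s3 t1 t2
    + boundary k s1 s2 t2 t3 + boundary k s2 s3 t2 t3.
Proof.
have S t : side_s k t s1 s3 = side_s k t s1 s2 + side_s k t s2 s3 by exact: cint_chasles.
have T s : side_t k s t1 t3 = side_t k s t1 t2 + side_t k s t2 t3 by exact: cint_chasles.
rewrite /boundary !S !T.
move: (side_s k _ _ _) (side_s k _ _ _) (side_s k _ _ _) (side_s k _ _ _)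
  (side_s k _ _ _) (side_s k _ _ _) (side_t k _ _ _) (side_t k _ _ _)
  (side_t k _ _ _) (side_t k _ _ _) (side_t k _ _ _) (side_t k _ _ _) => *; ring.
Qed.

End Goursat.

(** * Goursat's lemma and the integral of a difference quotient *)

Section CauchyIntegral.
Variable R : realType.
Notation C := R[i].
Implicit Types (f g : C -> C) (s t x y : R) (z : C).

Lemma nested_intervals (u : nat -> R) (d : R) : 0 <= d ->
  (forall n, u n <= u n.+1) ->
  (forall n, u n.+1 + d * 2^-1 ^+ n.+1 <= u n + d * 2^-1 ^+ n) ->
  exists x, forall n, u n <= x <= u n + d * 2^-1 ^+ n.
Proof.
move=> d0 u1 u2.
have nd m n : (m <= n)%N -> u m <= u n.
  by move=> mn; apply: (homo_leq (@lexx _ _) (@le_trans _ _) u1 mn).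
have w0 n : 0 <= d * 2^-1 ^+ n by rewrite mulr_ge0// exprn_ge0// invr_ge0.
have ni m n : (m <= n)%N -> u n + d * 2^-1 ^+ n <= u m + d * 2^-1 ^+ m.
  elim: n => [|n IH]; first by rewrite leqn0 => /eqP ->.
  rewrite leq_eqVlt => /orP[/eqP -> //|]; rewrite ltnS => /IH; exact: le_trans.
have ub m n : u m <= u n + d * 2^-1 ^+ n.
  have [mn|/ltnW nm] := leqP m n.
    by apply: le_trans (nd _ _ mn) _; rewrite lerDl.
  by apply: le_trans (ni _ _ nm); rewrite lerDl.
have hs : has_sup (range u).
  by split; [exists (u 0%N); exists 0%N|exists (u 0%N + d * 2^-1 ^+ 0) => _ [n _ <-]].
exists (sup (range u)) => n; apply/andP; split.
  by apply: sup_upper_bound => //; exists n.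
by apply: ge_sup; [exists (u 0%N); exists 0%N|move=> _ [m _ <-]].
Qed.

Lemma halves (s w : R) : 0 <= w ->
  [/\ s <= s, s + w <= s + (w + w), s <= s + w & s + w + w <= s + (w + w)].
Proof. by move=> w0; split; lra. Qed.

Lemma one_of_four (j0 j1 j2 j3 j4 : R) : j0 <= j1 + j2 + j3 + j4 ->
  j0 <= 4 * j1 \/ j0 <= 4 * j2 \/ j0 <= 4 * j3 \/ j0 <= 4 * j4.
Proof.
move=> h; have [?|?] := leP j0 (4 * j1); first by left.
have [?|?] := leP j0 (4 * j2); first by right; left.
have [?|?] := leP j0 (4 * j3); first by right; right; left.
by right; right; right; lra.
Qed.

Section Cone.
Variables (a : C) (r : R).
Hypothesis (ar : modulus a < r) (r1 : r < 1).

(** Quadrisection of the parameter rectangle [s0, 1] x [0, T]. As s0 > 0, its image avoids the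
    vertex a, where g is only assumed continuous. *)
Lemma goursat g s0 (T : R) : continuous_on_disc g ->
  (forall z, modulus z < 1 -> z != a -> exists l, cdiff g z l) ->
  0 < s0 -> s0 < 1 -> 0 <= T -> boundary a r g s0 1 0 T = 0.
Proof.
move=> cg dg s00 s01 T0.
have [h hE] : exists h : R, h = 2^-1 by exists 2^-1.
have h0 : 0 < h by rewrite hE invr_gt0.
have h1 : h < 1 by rewrite hE; lra.
have hh (c : R) n : c * h ^+ n = c * h ^+ n.+1 + c * h ^+ n.+1.
  by rewrite exprS hE; field.
have [d dE] : exists d : R, d = 1 - s0 by exists (1 - s0).
have d0 : 0 < d by rewrite dE subr_gt0.
have w0 (c : R) n : 0 <= c -> 0 <= c * h ^+ n by move=> c0; rewrite mulr_ge0// exprn_ge0// ltW.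
pose J n (p : R * R) := modulus (boundary a r g p.1 (p.1 + d * h ^+ n) p.2 (p.2 + T * h ^+ n)).
have quarter (np : nat * (R * R)) : exists q : R * R,
    [/\ np.2.1 <= q.1, q.1 + d * h ^+ np.1.+1 <= np.2.1 + d * h ^+ np.1,
        np.2.2 <= q.2, q.2 + T * h ^+ np.1.+1 <= np.2.2 + T * h ^+ np.1 &
        J np.1 np.2 <= 4 * J np.1.+1 q].
  case: np => n [s t] /=; rewrite (hh d n) (hh T n).
  have wd := w0 d n.+1 (ltW d0); have wT := w0 T n.+1 T0.
  have : J n (s, t) <= J n.+1 (s, t) + J n.+1 (s + d * h ^+ n.+1, t)
      + J n.+1 (s, t + T * h ^+ n.+1) + J n.+1 (s + d * h ^+ n.+1, t + T * h ^+ n.+1).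
    rewrite /J /= (hh d n) (hh T n) !addrA.
    rewrite (boundary_split _ _ _ _ (s + d * h ^+ n.+1) _ _ (t + T * h ^+ n.+1)).
    by do 3 (apply: le_trans (modulusD _ _) _; rewrite lerD2r).
  set j0 := J n _; set j1 := J n.+1 _; set j2 := J n.+1 _; set j3 := J n.+1 _; set j4 := J n.+1 _ => jj.
  have [a1 a2 a3 a4] := halves s wd; have [b1 b2 b3 b4] := halves t wT.
  have [H|[H|[H|H]]] := one_of_four jj.
  - by exists (s, t).
  - by exists (s + d * h ^+ n.+1, t).
  - by exists (s, t + T * h ^+ n.+1).
  - by exists (s + d * h ^+ n.+1, t + T * h ^+ n.+1).
have [step hstep] := choice quarter.
have [P [P0 hP]] : exists P : nat -> R * R, P 0%N = (s0, 0) /\ forall n,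
    [/\ (P n).1 <= (P n.+1).1, (P n.+1).1 + d * h ^+ n.+1 <= (P n).1 + d * h ^+ n,
        (P n).2 <= (P n.+1).2, (P n.+1).2 + T * h ^+ n.+1 <= (P n).2 + T * h ^+ n &
        J n (P n) <= 4 * J n.+1 (P n.+1)].
  pose P := fix P n : R * R := if n is m.+1 then step (m, P m) else (s0, 0).
  by exists P; split => // n; exact: (hstep (n, P n)).
clear hstep step quarter.
have [x hx] : exists x, forall n, (P n).1 <= x <= (P n).1 + d * h ^+ n.
  by rewrite hE in hP *; apply: nested_intervals => [|n|n]; [exact: ltW|have [] := hP n|have [] := hP n].
have [y hy] : exists y, forall n, (P n).2 <= y <= (P n).2 + T * h ^+ n.
  by rewrite hE in hP *; apply: nested_intervals => [|n|n]; [exact: T0|have [] := hP n|have [] := hP n].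
have inv n : [/\ s0 <= (P n).1, (P n).1 + d * h ^+ n <= 1, 0 <= (P n).2 &
    J 0%N (P 0%N) <= 4 ^+ n * J n (P n)].
  elim: n => [|n [i1 i2 i3 i4]].
    by rewrite P0; split => //=; rewrite ?expr0 ?mul1r// dE mulr1 addrC subrK.
  have [k1 k2 k3 k4 k5] := hP n; split.
  - exact: le_trans k1.
  - exact: le_trans k2 i2.
  - exact: le_trans k3.
  - apply: le_trans i4 _; rewrite exprSr -mulrA ler_wpM2l ?exprn_ge0//.
have x01 : s0 <= x <= 1 by have := hx 0%N; rewrite P0 /= expr0 mulr1 dE => /andP[? ?]; apply/andP; split; lra.
have x01' : 0 <= x <= 1 by move/andP: x01 => [? ?]; apply/andP; split; lra.
pose z0 := cone a r x y.
have z01 : modulus z0 < 1 by exact: modulus_cone_lt.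
have z0a : z0 != a.
  rewrite /z0 /cone -subr_eq0 addrC addKr mulf_neq0//; last exact: radial_neq0.
  by rewrite -modulus_gt0 modulus_real normr_gt0; apply: lt0r_neq0; move/andP: x01 => [? ?]; lra.
have [l gl] := dg z0 z01 z0a.
have J0 : boundary a r g s0 1 0 T = boundary a r g (P 0%N).1 ((P 0%N).1 + d * h ^+ 0) (P 0%N).2 ((P 0%N).2 + T * h ^+ 0).
  by rewrite P0 /= expr0 !mulr1 dE add0r [s0 + _]addrC subrK.
apply/eqP; rewrite -modulus_eq0 J0 -/(J 0%N (P 0%N)) eq_le modulus_ge0 andbT; clear J0.
have [D DE] : exists D : R, D = d + T by exists (d + T).
have D0 : 0 < D by rewrite DE; lra.
apply/ler_addgt0Pl => e e0; rewrite addr0.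
(* [boundary_bound] with E = 2 e' D h^n and sides of total length D h^n gives 16 D^2 e' h^(2n); as h
   = 1/2, the factor 4^n of the quadrisection cancels h^(2n). *)
pose e' := e / (16 * D ^+ 2).
have DD : 0 < 16 * D ^+ 2 by rewrite mulr_gt0// exprn_gt0.
have e'0 : 0 < e' by rewrite divr_gt0.
have [del del0 hdel] := gl e' e'0.
have : (GRing.exp h : R ^nat) @ \oo --> (0 : R).
  by apply: cvg_expr; rewrite gtr0_norm.
have del1 : 0 < del / (2 * D) by rewrite divr_gt0// mulr_gt0.
move=> /cvgr0Pnorm_lt /(_ _ del1) [n _ /(_ n (leqnn n))] /=.
rewrite ger0_norm ?exprn_ge0 ?(ltW h0)// ltr_pdivlMr ?mulr_gt0// => hn.
have [i1 i2 i3 i4] := inv n; apply: le_trans i4 _.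
have cone_near s t : (P n).1 <= s <= (P n).1 + d * h ^+ n ->
    (P n).2 <= t <= (P n).2 + T * h ^+ n -> modulus (cone a r s t - z0) <= 2 * D * h ^+ n.
  move=> hs ht; have s01' : 0 <= s <= 1 by move/andP: hs => [? ?]; apply/andP; split; lra.
  apply: le_trans (cone_lipschitz ar r1 _ _ _ s01') _.
  rewrite -mulrA ler_wpM2l// DE mulrDl; apply: lerD; rewrite ler_norml.
    by have := hx n; move/andP: hs => [? ?] /andP[? ?]; apply/andP; split; lra.
  by have := hy n; move/andP: ht => [? ?] /andP[? ?]; apply/andP; split; lra.
(* Subtracting the first-order expansion of g at z0 leaves the boundary integral unchanged, since
   affine functions contribute 0, and makes the integrand small. *)
pose k z := g z + ((l * z0 - g z0) + (- l) * z).
have ck : continuous_on_disc k by apply: continuous_on_discD => //; exact: affine_continuous_on_disc.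
have wd := w0 d n (ltW d0); have wT := w0 T n T0.
have p1 : 0 <= (P n).1 by lra.
have p2 : (P n).1 <= (P n).1 + d * h ^+ n by rewrite lerDl.
have p4 : (P n).2 <= (P n).2 + T * h ^+ n by rewrite lerDl.
have JE : J n (P n) = modulus (boundary a r k (P n).1 ((P n).1 + d * h ^+ n) (P n).2 ((P n).2 + T * h ^+ n)).
  have cA := affine_continuous_on_disc (l * z0 - g z0) (- l).
  by rewrite /k (boundaryD ar r1 cg cA p1 p2 i3 p4) (boundary_affine ar r1 _ _ p1 p2 i2 i3 p4) addr0.
have hb : modulus (boundary a r k (P n).1 ((P n).1 + d * h ^+ n) (P n).2 ((P n).2 + T * h ^+ n))
    <= 8 * (e' * (2 * D * h ^+ n)) * (((P n).1 + d * h ^+ n - (P n).1) + ((P n).2 + T * h ^+ n - (P n).2)).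
  apply: (boundary_bound ar r1 ck p1 p2 i2 i3 p4).
    apply: mulr_ge0; first exact: ltW.
    by apply: mulr_ge0; [apply: mulr_ge0 => //; exact: ltW|exact: exprn_ge0 (ltW h0)].
  move=> s t hs ht; have near := cone_near s t hs ht.
  have nd : modulus (cone a r s t - z0) < del by apply: le_lt_trans near _; rewrite mulrC.
  have := hdel _ nd; rewrite [z0 + _]addrC subrK => H.
  have -> : k (cone a r s t) = g (cone a r s t) - g z0 - l * (cone a r s t - z0) by rewrite /k; ring.
  by apply: le_trans H _; rewrite ler_wpM2l// ltW.
rewrite JE; apply: le_trans (ler_wpM2l (exprn_ge0 n (ler0n _ 4)) hb) _.
have -> : 4 ^+ n * (8 * (e' * (2 * D * h ^+ n)) * (((P n).1 + d * h ^+ n - (P n).1) + ((P n).2 + T * h ^+ n - (P n).2)))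
    = (4 ^+ n * h ^+ n * h ^+ n) * (e' * (16 * D ^+ 2)) by rewrite DE; ring.
rewrite /e' divfK ?gt_eqF// -!exprMn (_ : 4 * h * h = 1) ?expr1n ?mul1r//.
by rewrite hE; field.
Qed.

End Cone.

Lemma cdiff_inv a z : z != a -> cdiff (fun w => (w - a)^-1) z (- (z - a) ^- 2).
Proof.
move=> za e e0; pose w := z - a; have w0 : w != 0 by rewrite subr_eq0.
have mw : 0 < modulus w by rewrite modulus_gt0.
have W3 : 0 < modulus w ^+ 3 by rewrite exprn_gt0.
exists (Num.min (modulus w / 2) (e * modulus w ^+ 3 / 2)).
  by rewrite lt_min !divr_gt0 ?mulr_gt0.
move=> h; rewrite lt_min => /andP[h1 h2].
have wh : modulus w / 2 <= modulus (w + h).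
  by have := modulusD (w + h) (- h); rewrite addrK modulusN; lra.
have wh0 : w + h != 0 by rewrite -modulus_gt0; lra.
have -> : z + h - a = w + h by rewrite /w; ring.
have -> : (w + h)^-1 - w^-1 - - w ^- 2 * h = h ^+ 2 / (w ^+ 2 * (w + h)).
  by field; rewrite w0 wh0.
rewrite modulusM modulusV modulusM !modulusX ler_pdivrMr; last by rewrite mulr_gt0 ?exprn_gt0//; lra.
have H0 := modulus_ge0 h.
have A : modulus h <= e * (modulus w ^+ 2 * (modulus w / 2)).
  by apply: ltW; apply: lt_le_trans h2 _; rewrite !exprS expr0 le_eqVlt; apply/orP; left; apply/eqP; ring.
have B : e * (modulus w ^+ 2 * (modulus w / 2)) <= e * (modulus w ^+ 2 * modulus (w + h)).
  by rewrite ler_wpM2l ?(ltW e0)// ler_wpM2l ?exprn_ge0// ltW.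
have -> : e * modulus h * (modulus w ^+ 2 * modulus (w + h)) = modulus h * (e * (modulus w ^+ 2 * modulus (w + h))) by ring.
by rewrite expr2 ler_wpM2l// (le_trans A B).
Qed.

(** The value f' makes it continuous at a, but differentiability is known only off a; this is why
    [goursat] excepts one point. *)
Definition diff_quotient f (f' a z : C) : C := if z == a then f' else (f z - f a) / (z - a).

Lemma cdiff_cst (c : C) z : cdiff (fun=> c) z 0.
Proof.
move=> e e0; exists 1 => // h _; rewrite subrr mul0r subr0 modulus0.
by rewrite mulr_ge0 ?modulus_ge0// ltW.
Qed.

Lemma cdiffD f g z l m : cdiff f z l -> cdiff g z m -> cdiff (fun w => f w + g w) z (l + m).
Proof.
move=> fl gm e e0; have e2 : 0 < e / 2 by rewrite divr_gt0.
have [d1 d10 h1] := fl _ e2; have [d2 d20 h2] := gm _ e2.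
exists (Num.min d1 d2); first by rewrite lt_min d10.
move=> h; rewrite lt_min => /andP[/h1 H /h2 K].
have -> : f (z + h) + g (z + h) - (f z + g z) - (l + m) * h =
  (f (z + h) - f z - l * h) + (g (z + h) - g z - m * h) by ring.
by apply: le_trans (modulusD _ _) _; lra.
Qed.

Lemma diff_quotient_cdiff f (f' : C) a z l : z != a -> cdiff f z l ->
  exists m, cdiff (diff_quotient f f' a) z m.
Proof.
move=> za fl.
have za0 : 0 < modulus (z - a) by rewrite modulus_gt0 subr_eq0.
have D := cdiffM (cdiffD fl (cdiff_cst (- f a) z)) (cdiff_inv za).
eexists; apply: (cdiff_ext za0 _ D) => h hz.
rewrite /diff_quotient ifF//; apply/negbTE/eqP => e.
by move: hz; rewrite (_ : h = - (z - a)) ?modulusN ?ltxx// -e; ring.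
Qed.

Lemma diff_quotient_continuous f (f' : C) a : (forall z, modulus z < 1 -> exists l, cdiff f z l) ->
  cdiff f a f' -> continuous_on_disc (diff_quotient f f' a).
Proof.
move=> df fa z z1 e e0; have [->|za] := eqVneq z a; last first.
  have [l fl] := df z z1; have [m gm] := diff_quotient_cdiff f' za fl.
  exact: cdiff_continuous gm _ e0.
have e2 : 0 < e / 2 by rewrite divr_gt0.
have [d d0 hd] := fa _ e2; exists d => // h /hd H.
rewrite /diff_quotient eqxx; case: ifPn => [_|]; first by rewrite subrr modulus0.
rewrite -subr_eq0 addrAC subrr add0r => h0.
have mh : 0 < modulus h by rewrite modulus_gt0.
rewrite -(@ltr_pM2r _ (modulus h))// -modulusM.
have -> : ((f (a + h) - f a) / h - f') * h = f (a + h) - f a - f' * h by field.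
apply: le_lt_trans H _; rewrite ltr_pM2r//; lra.
Qed.

(** The rays t = 0 and t = 2 pi coincide, so by [goursat] the integral over the curve s = const is
    the same for all s in ]0, 1]; it tends to 0 with s because the quotient is bounded near a. *)
Lemma diff_quotient_circle_integral f a r : modulus a < r -> r < 1 ->
  (forall z, modulus z < 1 -> exists l, cdiff f z l) ->
  exists f' : C, continuous_on_disc (diff_quotient f f' a) /\
  cint (fun t => diff_quotient f f' a (r%:C * expi t) * ('i * (r%:C * expi t))) 0 (pi *+ 2) = 0.
Proof.
move=> ar r1 df; have a1 : modulus a < 1 by exact: lt_trans r1.
have [f' fa] := df a a1; exists f'.
pose g := diff_quotient f f' a.
have cg : continuous_on_disc g by exact: diff_quotient_continuous.
have dg z : modulus z < 1 -> z != a -> exists l, cdiff g z l.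
  by move=> z1 za; have [l fl] := df z z1; exact: diff_quotient_cdiff fl.
split => //; pose T : R := pi *+ 2.
have T0 : 0 < T by rewrite mulrn_wgt0// pi_gt0.
have r0 : 0 < r by exact: le_lt_trans (modulus_ge0 a) ar.
have -> : cint (fun t => g (r%:C * expi t) * ('i * (r%:C * expi t))) 0 T = side_t a r g 1 0 T.
  congr cint; apply/funext => t; rewrite clamp_id ?ler01 ?lexx// mul1r /cone mul1r.
  by rewrite /radial [a + _]addrC subrK.
have const s : 0 < s -> s < 1 -> side_t a r g 1 0 T = side_t a r g s 0 T.
  move=> s0 s1; have := goursat ar r1 cg dg s0 s1 (ltW T0); rewrite /boundary.
  have -> : side_s a r g T s 1 = side_s a r g 0 s 1.
    have rT : radial a r T = radial a r 0 by rewrite /radial expi_2pi expi0.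
    by congr cint; apply/funext => t; rewrite /cone rT.
  by move=> h; apply/eqP; rewrite -subr_eq0 -h; apply/eqP; move: (side_s _ _ _ _ _ _) (side_t _ _ _ _ _ _) (side_t _ _ _ _ _ _) => ? ? ?; ring.
have [d d0 hd] := cg a a1 _ ltr01.
pose M := modulus (g a) + 1; have M0 : 0 < M by rewrite ltr_wpDl// modulus_ge0.
apply/eqP; rewrite -modulus_eq0 eq_le modulus_ge0 andbT.
apply/ler_addgt0Pl => e e0; rewrite addr0.
(* The bound d / 4 keeps the small curve where the quotient is within 1 of its value at a, hence at
   most M in modulus; the last bound makes the integral at most e. *)
pose s := Num.min (1 / 2) (Num.min (d / 4) (e / (2 * M * T))).
have MT : 0 < 2 * M * T by rewrite !mulr_gt0.
have s0 : 0 < s by rewrite !lt_min !divr_gt0.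
have s12 : s <= 1 / 2 by rewrite ge_min lexx.
have sd : s <= d / 4 by rewrite !ge_min lexx orbT.
have se : s * (2 * M * T) <= e by rewrite -ler_pdivlMr// !ge_min lexx !orbT.
have s1 : s < 1 by lra.
have s01 : 0 <= s <= 1 by apply/andP; split; lra.
rewrite (const s s0 s1).
apply: le_trans (_ : 2 * (M * s) * (T - 0) <= _); last by rewrite subr0; move: se; rewrite (_ : s * (2 * M * T) = 2 * (M * s) * T)//; ring.
apply: cint_bound.
- exact: ccontinuous_side_t.
- by rewrite ltrN10.
- exact: ltW.
move=> t _; rewrite clamp_id// modulusM; apply: ler_pM; rewrite ?modulus_ge0//.
  have h2 : modulus (s%:C * radial a r t) < d.
    rewrite modulusM modulus_real gtr0_norm//.
    have := modulus_radial_le ar r1 t; have := modulus_ge0 (radial a r t); nra.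
  have := hd _ h2; rewrite -/(cone a r s t) => h3.
  have := modulusD (g (cone a r s t) - g a) (g a); rewrite subrK /M; lra.
rewrite modulusM modulus_real gtr0_norm// [modulus ('i * _)]modulusM (modulus_circle ar).
have -> : modulus ('i : C) = 1 by rewrite /modulus /= expr0n expr1n add0r sqrtr1.
by rewrite mul1r ler_piMr// ltW.
Qed.

End CauchyIntegral.

(** * Power series expansion of analytic functions *)

Section PowerSeriesExpansion.
Variable R : realType.
Notation C := R[i].
Notation T := (pi *+ 2 : R).
Implicit Types (f : C -> C) (s t x y : R) (z : C).

Let T0 : 0 < T. Proof. by rewrite mulrn_wgt0// pi_gt0. Qed.

Lemma ccontinuous_bounded (h : R -> C) x y : x <= y -> ccontinuous h ->
  exists M : R, forall t, x <= t <= y -> modulus (h t) <= M.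
Proof.
move=> xy ch.
have cm : continuous (fun t => modulus (h t)).
  move=> t; apply/cvgrPdist_lt => e /(ch t)[d d0 hd].
  apply/nbhs_ballP; exists d => // w; rewrite /ball /= distrC => /hd.
  apply: le_lt_trans; rewrite distrC ler_norml; apply/andP; split.
    by have := modulusD (h t - h w) (h w); rewrite subrK modulusB; lra.
  by have := modulusD (h w - h t) (h t); rewrite subrK; lra.
have [c _ hc] := EVT_max xy (continuous_subspaceT cm).
by exists (modulus (h c)) => t txy; apply: hc; rewrite in_itv.
Qed.

Lemma ccontinuous_sum (h : nat -> R -> C) N : (forall n, ccontinuous (h n)) ->
  ccontinuous (fun t => \sum_(n < N) h n t).
Proof.
move=> ch; elim: N => [|N IH].
  have -> : (fun t => \sum_(n < 0) h n t) = (fun=> 0) by apply/funext => t; rewrite big_ord0.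
  exact: ccontinuous_cst.
have -> : (fun t => \sum_(n < N.+1) h n t) = (fun t => \sum_(n < N) h n t + h N t).
  by apply/funext => t; rewrite big_ord_recr.
exact: ccontinuousD.
Qed.

Lemma cint_sum (h : nat -> R -> C) N x y : (forall n, ccontinuous (h n)) -> -1 < x -> x <= y ->
  cint (fun t => \sum_(n < N) h n t) x y = \sum_(n < N) cint (h n) x y.
Proof.
move=> ch x1 xy.
elim: N => [|N IH].
  rewrite big_ord0 (@cint_FTC _ _ (fun=> 0))//; first by rewrite subrr.
    exact: ccontinuous_sum.
  by move=> t _; rewrite big_ord0; exact: rderiv_cst.
have E : (fun t => \sum_(n < N.+1) h n t) = (fun t => \sum_(n < N) h n t + h N t).
  by apply/funext => t; rewrite big_ord_recr.
by rewrite E cintD// ?IH ?big_ord_recr//; exact: ccontinuous_sum.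
Qed.

Definition expNi t : C := conjc (expi t).

Lemma expi_expNi t : expi t * expNi t = 1.
Proof. by rewrite mulcJ modulus_expi expr1n. Qed.

Lemma modulus_expNi t : modulus (expNi t) = 1.
Proof. by rewrite modulus_conj modulus_expi. Qed.

Lemma ccontinuous_expNi : ccontinuous expNi.
Proof.
move=> x e e0; have [d d0 hd] := @ccontinuous_expi R x e e0.
by exists d => // y /hd; rewrite /expNi -rmorphB modulus_conj.
Qed.

Lemma ccontinuous_expNiX n : ccontinuous (fun t => expNi t ^+ n).
Proof.
elim: n => [|n IH]; first by under [X in _ X]eq_fun do rewrite expr0; exact: ccontinuous_cst.
by under [X in _ X]eq_fun do rewrite exprS; apply: ccontinuousM => //; exact: ccontinuous_expNi.
Qed.

Lemma rderiv_expNi t : rderiv expNi t (- ('i * expNi t)).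
Proof.
split; rewrite /expNi /expi /=.
  by apply: is_derive_eq (is_derive_cos t) _; ring.
by apply: is_derive_eq (is_deriveN (is_derive_sin t)) _; ring.
Qed.

Lemma rderiv_expNiX n t : rderiv (fun t => expNi t ^+ n) t (- (n%:R * 'i) * expNi t ^+ n).
Proof.
elim: n => [|n IH].
  rewrite mul0r oppr0 mul0r; under [X in rderiv X]eq_fun do rewrite expr0.
  exact: rderiv_cst.
under [X in rderiv X]eq_fun do rewrite exprS.
have -> : - (n.+1%:R * 'i) * expNi t ^+ n.+1 =
   - ('i * expNi t) * expNi t ^+ n + expNi t * (- (n%:R * 'i) * expNi t ^+ n).
  by rewrite exprS -natr1; ring.
by apply: rderivM => //; exact: rderiv_expNi.
Qed.

Lemma expNi_period : expNi T = expNi 0.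
Proof. by rewrite /expNi expi_2pi expi0. Qed.

Lemma cint_expNiX n : cint (fun t => expNi t ^+ n) 0 T = if n == 0%N then T%:C else 0.
Proof.
have N10 : -1 < 0 :> R by rewrite ltrN10.
case: ifPn => [/eqP ->|n0].
  rewrite (@cint_FTC _ _ (fun t => t%:C))// ?subr0 ?(ltW T0)//.
    exact: ccontinuous_expNiX.
  by move=> t _; rewrite expr0; exact: rderiv_real.
have nz : n%:R != 0 :> C by rewrite pnatr_eq0.
rewrite (@cint_FTC _ _ (fun t => 'i / n%:R * expNi t ^+ n))// ?(ltW T0)//.
- by rewrite expNi_period subrr.
- exact: ccontinuous_expNiX.
move=> t _; have -> : expNi t ^+ n = 'i / n%:R * (- (n%:R * 'i) * expNi t ^+ n).
  have i2 : 'i * 'i = -1 :> C by rewrite -expr2 sqr_i.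
  have -> : 'i / n%:R * (- (n%:R * 'i) * expNi t ^+ n) = - ('i * 'i) * (n%:R / n%:R * expNi t ^+ n) by ring.
  by rewrite i2 opprK mul1r divff// mul1r.
by apply: rderivZ; exact: rderiv_expNiX.
Qed.

(** Fourier coefficient of f on the circle of radius r; it will turn out to be a_n r^n, with a_n the
    Taylor coefficient. *)
Definition fourier_coef f (r : R) (n : nat) : C :=
  (T^-1)%:C * cint (fun t => f (r%:C * expi t) * expNi t ^+ n) 0 T.

Variable f : C -> C.
Hypothesis df : forall z, modulus z < 1 -> exists l, cdiff f z l.

Section Circle.
Variable r : R.
Hypothesis (r0 : 0 < r) (r1 : r < 1).

Let modulus_re t : modulus (r%:C * expi t) = r.
Proof. by rewrite modulusM modulus_expi mulr1 modulus_real gtr0_norm. Qed.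

Let ccircle : ccontinuous (fun t => r%:C * expi t).
Proof. by apply: ccontinuousM; [exact: ccontinuous_cst|exact: ccontinuous_expi]. Qed.

Let con_circle g : continuous_on_disc g -> ccontinuous (fun t => g (r%:C * expi t)).
Proof.
by move=> cg; apply: ccontinuous_comp => // x e e0; apply: cg => //; rewrite modulus_re.
Qed.

Let cf : continuous_on_disc f.
Proof. by move=> z /df[l fl] e; exact: cdiff_continuous fl _. Qed.

Let cterm n : ccontinuous (fun t => f (r%:C * expi t) * expNi t ^+ n).
Proof. by apply: ccontinuousM; [exact: con_circle|exact: ccontinuous_expNiX]. Qed.

Let N10 : -1 < 0 :> R. Proof. by rewrite ltrN10. Qed.

Lemma fourier_coef_bounded : exists M, forall n, modulus (fourier_coef f r n) <= M.
Proof.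
have [M hM] := ccontinuous_bounded (ltW T0) (con_circle cf).
exists (T^-1 * (2 * M * (T - 0))) => n.
rewrite modulusM modulus_real gtr0_norm ?invr_gt0// ler_wpM2l ?invr_ge0 ?(ltW T0)//.
apply: cint_bound => //; first exact: ltW.
by move=> t /hM; rewrite modulusM modulusX modulus_expNi expr1n mulr1.
Qed.

Lemma radius1_fourier_coef : radius1 (fourier_coef f r).
Proof. by have [M hM] := fourier_coef_bounded; exact: radius1_bound hM. Qed.

(** Cauchy's formula at a = r z, with 1 / (1 - z exp(-it)) expanded into a finite geometric sum and
    a remainder: only finite sums are integrated, and the integrated remainder is of order |z|^N. *)
Lemma cauchy_expansion z : modulus z < 1 -> f (r%:C * z) = ev (fourier_coef f r) z.
Proof.
move=> z1; pose a := r%:C * z.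
have ar : modulus a < r.
  by rewrite modulusM modulus_real gtr0_norm// gtr_pMr.
have [f' [cg]] := diff_quotient_circle_integral ar r1 df.
set g := diff_quotient f f' a in cg *.
have [M hM] := ccontinuous_bounded (ltW T0) (con_circle cg).
pose E t : C := r%:C * expi t.
have Ea t : E t - a != 0.
  by rewrite subr_eq0; apply/eqP => e; have := modulus_re t; rewrite -/(E t) e; have := ar; lra.
have gE t : (E t - a) * g (E t) = f (E t) - f a.
  rewrite /g /diff_quotient ifF; last by apply/negbTE; rewrite -subr_eq0.
  by rewrite mulrC divfK.
(* From E(t) (1 - z v) = E(t) - a and the geometric sum in z v; up to a constant, the three terms
   integrate to the partial sum, to -f(a) and to the remainder. *)
have key N t : g (E t) * ('i * E t) =
    \sum_(n < N) ('i * z ^+ n) * (f (E t) * expNi t ^+ n)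
    + \sum_(n < N) (- ('i * f a * z ^+ n)) * expNi t ^+ n
    + ('i * z ^+ N) * (expNi t ^+ N * (g (E t) * E t)).
  pose v := expNi t; pose S := \sum_(n < N) (z * v) ^+ n.
  have hS : (1 - z * v) * S = 1 - (z * v) ^+ N.
    by rewrite -[LHS]opprK -mulNr opprB -subrX1 opprB.
  have hE : E t * (1 - z * v) = E t - a.
    rewrite mulrBr mulr1; congr (_ - _); rewrite /E /a mulrA [_ * z * v]mulrAC.
    by rewrite -[r%:C * expi t * v]mulrA expi_expNi mulr1.
  have -> : \sum_(n < N) ('i * z ^+ n) * (f (E t) * expNi t ^+ n) = 'i * f (E t) * S.
    by rewrite mulr_sumr; apply: eq_bigr => n _; rewrite exprMn; ring.
  have -> : \sum_(n < N) (- ('i * f a * z ^+ n)) * expNi t ^+ n = - ('i * f a * S).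
    by rewrite mulr_sumr -sumrN; apply: eq_bigr => n _; rewrite exprMn; ring.
  have -> : 'i * f (E t) * S - 'i * f a * S = 'i * (g (E t) * E t) * ((1 - z * v) * S).
    have -> : 'i * (g (E t) * E t) * ((1 - z * v) * S) = 'i * ((E t * (1 - z * v)) * g (E t)) * S by ring.
    by rewrite hE gE; ring.
  by rewrite hS exprMn; ring.
have cgE : ccontinuous (fun t => g (E t) * E t) by apply: ccontinuousM => //; exact: con_circle.
have crem N : ccontinuous (fun t => expNi t ^+ N * (g (E t) * E t)).
  by apply: ccontinuousM => //; exact: ccontinuous_expNiX.
pose rem N := cint (fun t => expNi t ^+ N * (g (E t) * E t)) 0 T.
have hrem N : modulus (rem N) <= 2 * M * T.
  have -> : 2 * M * T = 2 * M * (T - 0) by rewrite subr0.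
  apply: cint_bound => //; first exact: ltW.
  move=> t tT; rewrite modulusM modulusX modulus_expNi expr1n mul1r modulusM modulus_re.
  apply: le_trans (hM t tT); rewrite ler_piMr ?modulus_ge0//; exact: ltW.
rewrite -/E => H0.
have sumE N : \sum_(n < N.+1) fourier_coef f r n * z ^+ n - f a = - ((T^-1)%:C * (z ^+ N.+1 * rem N.+1)).
  have : cint (fun t => g (E t) * ('i * E t)) 0 T = 0 by exact: H0.
  have c1 n : ccontinuous (fun t => ('i * z ^+ n) * (f (E t) * expNi t ^+ n)).
    by apply: ccontinuousM => //; exact: ccontinuous_cst.
  have c2 n : ccontinuous (fun t => (- ('i * f a * z ^+ n)) * expNi t ^+ n).
    by apply: ccontinuousM; [exact: ccontinuous_cst|exact: ccontinuous_expNiX].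
  have T0' := ltW T0.
  rewrite (funext (key N.+1)) cintD//; last 2 first.
  - by apply: ccontinuousD; [exact: ccontinuous_sum c1|exact: ccontinuous_sum c2].
  - by apply: ccontinuousM; [exact: ccontinuous_cst|].
  rewrite cintD//; last 2 first.
  - exact: ccontinuous_sum c1.
  - exact: ccontinuous_sum c2.
  rewrite (cint_sum _ c1)// (cint_sum _ c2)// cintZ// -/(rem N.+1).
  have -> : \sum_(n < N.+1) cint (fun t => (- ('i * f a * z ^+ n)) * expNi t ^+ n) 0 T =
      - ('i * f a * T%:C).
    rewrite big_ord_recl cintZ//; last exact: ccontinuous_expNiX.
    rewrite cint_expNiX /= expr0 mulr1 big1 ?addr0 ?mulNr// => n _.
    by rewrite cintZ ?cint_expNiX ?mulr0//; exact: ccontinuous_expNiX.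
  have TC : T%:C != 0 :> C by rewrite -modulus_gt0 modulus_real normr_gt0 gt_eqF.
  have i0 : 'i != 0 :> C by rewrite eq_complex /= oner_eq0 andbF.
  have -> : \sum_(n < N.+1) cint (fun t => ('i * z ^+ n) * (f (E t) * expNi t ^+ n)) 0 T =
      'i * T%:C * \sum_(n < N.+1) fourier_coef f r n * z ^+ n.
    rewrite mulr_sumr; apply: eq_bigr => n _; rewrite cintZ// /fourier_coef fmorphV/=.
    by rewrite -/E; move: (cint _ _ _) (z ^+ n) (T%:C) TC => u v w w0; field.
  rewrite fmorphV/=.
  move: (\sum_(n < N.+1) _) (rem N.+1) (T%:C) TC (z ^+ N.+1) (f a) => u v w w0 x y H.
  have alg (I : C) : I != 0 -> I * w * u - I * y * w + I * x * v = 0 -> u - y = - (w^-1 * (x * v)).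
    move=> I0 e; apply: (mulfI (mulf_neq0 I0 w0)).
    by apply/eqP; rewrite -subr_eq0 -e; apply/eqP; field.
  exact: alg i0 H.
apply: (@tends_unique _ (fun N => \sum_(n < N.+1) fourier_coef f r n * z ^+ n)); last first.
  have rc : radius1 (fourier_coef f r) by exact: radius1_fourier_coef.
  exact: (tendsS (ev_tends rc z1)).
apply: (@tends_le _ _ _ (fun N => (2 * M * modulus z) * modulus z ^+ N)).
  rewrite -[X in _ --> X](mulr0 (2 * M * modulus z)); apply: cvgM; first exact: cvg_cst.
  by apply: cvg_expr; rewrite ger0_norm ?modulus_ge0.
move=> N; rewrite sumE modulusN modulusM modulus_real gtr0_norm ?invr_gt0//.
rewrite mulrC ler_pdivrMr// modulusM modulusX exprS.
have -> : 2 * M * modulus z * modulus z ^+ N * T = modulus z * modulus z ^+ N * (2 * M * T) by ring.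
by rewrite ler_wpM2l ?hrem// mulr_ge0 ?exprn_ge0 ?modulus_ge0.
Qed.

End Circle.

(** The coefficients are read off at radius 1/2; by the identity theorem those at any r >= 1/2 are
    a_n r^n with the same a_n, which extends the expansion to the whole disc. *)
Theorem analytic_power_series :
  exists a, radius1 a /\ forall z, modulus z < 1 -> f z = ev a z.
Proof.
pose b (r : R) := fourier_coef f r.
pose a n := b 2^-1 n * 2 ^+ n.
have h0 : 0 < 2^-1 :> R by rewrite invr_gt0.
have h1 : 2^-1 < 1 :> R by lra.
have ba (r : R) n : 2^-1 <= r -> r < 1 -> b r n = a n * r%:C ^+ n.
  move=> rh r1; have r0 : 0 < r by exact: lt_le_trans rh.
  pose q : C := (2^-1 / r)%:C.
  have q1 : modulus q <= 1 by rewrite modulus_real gtr0_norm ?divr_gt0// ler_pdivrMr// mul1r.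
  have rb : radius1 (fun n => b r n * q ^+ n).
    move=> s s0 s1; have [M hM] := radius1_fourier_coef r0 r1 s0 s1.
    exists M => k; apply: le_trans (hM k); rewrite modulusM modulusX ler_wpM2r ?exprn_ge0//.
    by rewrite ler_piMr ?modulus_ge0// exprn_ile1// modulus_ge0.
  have rh2 := radius1_fourier_coef h0 h1.
  have rN : radius1 (fun n => (-1) * (b r n * q ^+ n)) by exact: radius1Z.
  have E : forall n, b 2^-1 n + (-1) * (b r n * q ^+ n) = 0.
    apply: (@ev_eq0 _ (fun n => b 2^-1 n + (-1) * (b r n * q ^+ n)) 1) => //; first exact: radius1D.
    move=> z _ z1.
    have e1 : ev (fun n => b 2^-1 n) z = f ((2^-1)%:C * z) by rewrite (cauchy_expansion h0 h1 z1).
    rewrite (evD rh2 rN z1) (evZ _ rb z1) -[ev (b 2^-1) z]/(ev (fun n => b 2^-1 n) z) e1.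
    have -> : ev (fun n => b r n * q ^+ n) z = ev (fourier_coef f r) (q * z).
      by congr csum; apply/funext => k; rewrite exprMn mulrA.
    rewrite -(cauchy_expansion r0 r1); last first.
      by rewrite modulusM; apply: le_lt_trans z1; rewrite ler_piMl ?modulus_ge0.
    have -> : r%:C * (q * z) = (2^-1)%:C * z.
      by rewrite mulrA; congr (_ * _); rewrite /q -rmorphM /=; congr (_%:C); rewrite mulrC divfK// gt_eqF.
    by rewrite mulN1r subrr.
  have := E n; rewrite mulN1r => /eqP; rewrite subr_eq0 => /eqP e.
  rewrite /a e /q rmorphM /= fmorphV /= fmorphV /= rmorph_nat.
  have rC : r%:C != 0 :> C by rewrite -modulus_gt0 modulus_real normr_gt0 gt_eqF.
  have n2 : (2 : C) != 0 by rewrite pnatr_eq0.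
  rewrite -!mulrA -exprMn -exprMn (_ : 2^-1 / r%:C * (2 * r%:C) = 1) ?expr1n ?mulr1//.
  by field.
exists a; split.
  move=> s s0 s1; pose r := Num.max 2^-1 s.
  have rh : 2^-1 <= r by rewrite le_max lexx.
  have sr : s <= r by rewrite le_max lexx orbT.
  have r1 : r < 1 by rewrite gt_max h1.
  have r0 : 0 < r by exact: lt_le_trans rh.
  have [M hM] := fourier_coef_bounded r0 r1.
  exists M => n; apply: le_trans (hM n); rewrite -/(b r n) ba// modulusM modulusX modulus_real gtr0_norm//.
  by rewrite ler_wpM2l ?modulus_ge0// lerXn2r ?nnegrE// ltW.
move=> z z1; pose r := (1 + modulus z) / 2.
have z0 := modulus_ge0 z.
have rh : 2^-1 <= r by rewrite /r; lra.
have r1 : r < 1 by rewrite /r; lra.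
have r0 : 0 < r by exact: lt_le_trans rh.
have rC : r%:C != 0 :> C by rewrite -modulus_gt0 modulus_real normr_gt0 gt_eqF.
have -> : f z = f (r%:C * (z / r%:C)) by rewrite mulrC divfK.
rewrite (cauchy_expansion r0 r1); last first.
  by rewrite modulusM modulusV modulus_real gtr0_norm// ltr_pdivrMr// /r; lra.
congr csum; apply/funext => n; rewrite -/(b r n) ba// expr_div_n.
by rewrite -mulrA [_ * (z ^+ n / _)]mulrC divfK// expf_neq0.
Qed.

End PowerSeriesExpansion.

(** * Energy and its minimizers *)

Section WeightedSequences.
Variable R : realType.
Local Notation C := R[i].
Implicit Types (a b h : nat -> C) (z w : C) (K M t : R).

(** The hypothesis x_i^2 <= u_i v_i absorbs the weights, so that their square roots never appear. *)
Lemma finite_cauchy_schwarz (I : Type) (r : seq I) (x u v : I -> R) :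
  (forall i, 0 <= u i) -> (forall i, 0 <= v i) -> (forall i, x i ^+ 2 <= u i * v i) ->
  (\sum_(i <- r) x i) ^+ 2 <= (\sum_(i <- r) u i) * (\sum_(i <- r) v i).
Proof.
move=> u0 v0 xuv; elim: r => [|i r IH]; first by rewrite !big_nil expr0n mul0r.
rewrite !big_cons; move: IH.
have : 0 <= \sum_(i <- r) u i by exact: sumr_ge0.
have : 0 <= \sum_(i <- r) v i by exact: sumr_ge0.
move: (\sum_(i <- r) x i) (\sum_(i <- r) u i) (\sum_(i <- r) v i) => X U V V0 U0 IH.
move: (x i) (u i) (v i) (u0 i) (v0 i) (xuv i) => y p q p0 q0 yq.
have : (y * X) ^+ 2 <= (p * q) * (U * V).
  by rewrite exprMn; apply: ler_pM => //; exact: sqr_ge0.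
move=> h.
have h2 : 2 * (y * X) <= p * V + q * U.
  have s0 : 0 <= p * V + q * U by rewrite addr_ge0// mulr_ge0.
  apply: le_trans (ler_norm _) _; rewrite -(@ler_pXn2r _ 2) ?nnegrE//.
  rewrite real_normK ?num_real// exprMn.
  apply: (@le_trans _ _ (2 ^+ 2 * ((p * q) * (U * V)))); first by rewrite ler_wpM2l// sqr_ge0.
  by have := sqr_ge0 (p * V - q * U); nra.
nra.
Qed.

Definition wsum a N : R := \sum_(n < N) n.+1%:R * modulus (a n) ^+ 2.

Definition ell a := exists M, forall N, wsum a N <= M.

Definition energy a : R := limn (wsum a).

Lemma wsum_term_ge0 a n : 0 <= n.+1%:R * modulus (a n) ^+ 2.
Proof. by rewrite mulr_ge0 ?sqr_ge0. Qed.

Lemma wsumS a N : wsum a N.+1 = wsum a N + N.+1%:R * modulus (a N) ^+ 2.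
Proof. exact: big_ord_recr. Qed.

Lemma wsum_nondecreasing a : nondecreasing_seq (wsum a).
Proof. by apply/nondecreasing_seqP => n; rewrite wsumS lerDl wsum_term_ge0. Qed.

Lemma energy_cvg a : ell a -> wsum a @ \oo --> energy a.
Proof.
move=> [M hM]; apply: nondecreasing_is_cvgn; first exact: wsum_nondecreasing.
by exists M => _ [n _ <-]; exact: hM.
Qed.

Lemma wsum_le_energy a N : ell a -> wsum a N <= energy a.
Proof.
move=> ea; apply: nondecreasing_cvgn_le; first exact: wsum_nondecreasing.
by apply/cvg_ex; exists (energy a); exact: energy_cvg.
Qed.

Lemma energy_le a M : (forall N, wsum a N <= M) -> energy a <= M.
Proof.
move=> h; have ea : ell a by exists M.
by apply: (cvgr_to_le (energy_cvg ea)); exact: nearW.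
Qed.

Lemma energy_ge0 a : ell a -> 0 <= energy a.
Proof. by move=> ea; have := wsum_le_energy 0 ea; rewrite /wsum big_ord0. Qed.

Lemma sqr_coef_le a n : ell a -> n.+1%:R * modulus (a n) ^+ 2 <= energy a.
Proof.
move=> ea; apply: le_trans (wsum_le_energy n.+1 ea); rewrite wsumS lerDr.
by apply: sumr_ge0 => i _; exact: wsum_term_ge0.
Qed.

Lemma coef_le a n : ell a -> modulus (a n) ^+ 2 <= energy a.
Proof.
move=> ea; apply: le_trans (sqr_coef_le n ea).
by rewrite ler_peMl ?sqr_ge0// ler1n.
Qed.

Lemma ell_radius1 a : ell a -> radius1 a.
Proof.
move=> ea; apply: (@radius1_bound _ _ (1 + energy a)) => n.
by have := coef_le n ea; have := modulus_ge0 (a n); nra.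
Qed.

(** A quadratic polynomial in t is fixed by its values at 0 and 1 and its leading coefficient.
    Summed with weights, the identity does the work of an inner product: t = -1 is the parallelogram
    law, t = 1/2 the midpoint identity, and t free gives the variation of minimizers. *)
Lemma sqr_modulus_quad (x y : C) t : modulus (x + t%:C * y) ^+ 2 =
  (1 - t) * modulus x ^+ 2 + t * modulus (x + y) ^+ 2 + (t ^+ 2 - t) * modulus y ^+ 2.
Proof. by rewrite !sqr_modulus; case: x y => [p q] [r s]; simpc => /=; ring. Qed.

Lemma wsum_quad a h t N : wsum (a + t%:C *: h) N =
  (1 - t) * wsum a N + t * wsum (a + h) N + (t ^+ 2 - t) * wsum h N.
Proof.
rewrite /wsum !mulr_sumr -!big_split /=; apply: eq_bigr => n _.
by rewrite (sqr_modulus_quad (a n) (h n)) !fctE; ring.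
Qed.

Lemma wsumZ (c : C) a N : wsum (c *: a) N = modulus c ^+ 2 * wsum a N.
Proof.
rewrite /wsum mulr_sumr; apply: eq_bigr => n _.
by rewrite [(c *: a) n]/(c * a n) modulusM exprMn mulrCA.
Qed.

Lemma ellD a b : ell a -> ell b -> ell (a + b).
Proof.
move=> [M hM] [K hK]; exists (2 * M + 2 * K) => N.
have := wsum_quad a b (-1) N; have := hM N; have := hK N.
have : 0 <= wsum (a + (-1)%:C *: b) N by apply: sumr_ge0 => i _; exact: wsum_term_ge0.
lra.
Qed.

Lemma ellZ (c : C) a : ell a -> ell (c *: a).
Proof. by move=> [M hM]; exists (modulus c ^+ 2 * M) => N; rewrite wsumZ ler_wpM2l ?sqr_ge0. Qed.

Lemma ellN a : ell a -> ell (- a).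
Proof. by move=> ea; rewrite -scaleN1r; exact: ellZ. Qed.

Lemma ellB a b : ell a -> ell b -> ell (a - b).
Proof. by move=> ea eb; apply: ellD => //; exact: ellN. Qed.

Lemma ell_sum (I : Type) (r : seq I) (F : I -> nat -> C) :
  (forall i, ell (F i)) -> ell (\sum_(i <- r) F i).
Proof.
move=> h; elim: r => [|i r IH]; last by rewrite big_cons; exact: ellD.
rewrite big_nil; exists 0 => N; rewrite /wsum big1// => n _.
by rewrite [(0 : nat -> C) n]/(0 : C) modulus0 expr0n mulr0.
Qed.

Lemma energyZ (c : C) a : ell a -> energy (c *: a) = modulus c ^+ 2 * energy a.
Proof.
move=> ea; apply: (cvg_unique (@Rhausdorff R) (energy_cvg (ellZ c ea))).
rewrite (funext (wsumZ c a)); apply: cvgM; [exact: cvg_cst|exact: energy_cvg].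
Qed.

Lemma energy_quad a h t : ell a -> ell h -> energy (a + t%:C *: h) =
  (1 - t) * energy a + t * energy (a + h) + (t ^+ 2 - t) * energy h.
Proof.
move=> ea eh; apply: (cvg_unique (@Rhausdorff R) (energy_cvg (ellD ea (ellZ _ eh)))).
rewrite (funext (wsum_quad a h t)).
have ee := energy_cvg (ellD ea eh).
by apply: cvgD; [apply: cvgD|]; (apply: cvgM; [exact: cvg_cst|]); rewrite //; exact: energy_cvg.
Qed.

Lemma evDr a b z : ell a -> ell b -> modulus z < 1 -> ev (a + b) z = ev a z + ev b z.
Proof. by move=> ea eb z1; exact: (evD (ell_radius1 ea) (ell_radius1 eb) z1). Qed.

Lemma evZr (c : C) a z : ell a -> modulus z < 1 -> ev (c *: a) z = c * ev a z.
Proof. by move=> ea z1; exact: (evZ _ (ell_radius1 ea) z1). Qed.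

Lemma evBr a b z : ell a -> ell b -> modulus z < 1 -> ev (a - b) z = ev a z - ev b z.
Proof. by move=> ea eb z1; rewrite evDr//; [rewrite -scaleN1r evZr// mulN1r|exact: ellN]. Qed.

(** Cauchy-Schwarz; the last factor is a partial sum of the reproducing kernel on the diagonal at
    z. *)
Lemma sqr_sum_ev_le a z N : (\sum_(n < N) modulus (a n) * modulus z ^+ n) ^+ 2 <=
  wsum a N * \sum_(n < N) (modulus z ^+ 2) ^+ n / n.+1%:R.
Proof.
apply: finite_cauchy_schwarz => i; first exact: wsum_term_ge0.
- by rewrite divr_ge0// exprn_ge0// sqr_ge0.
- rewrite exprMn -!exprM mulnC -mulrA.
  have i0 : i.+1%:R != 0 :> R by rewrite pnatr_eq0.
  move: (i.+1%:R) i0 (modulus z ^+ _) (modulus (a i) ^+ 2) => u u0 v x.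
  by rewrite le_eqVlt; apply/orP; left; apply/eqP; field.
Qed.

(** The kernel is bounded by the geometric series. This continuity of evaluations turns convergence
    in energy into pointwise convergence on the disc. *)
Lemma sqr_ev_le a z : ell a -> modulus z < 1 ->
  modulus (ev a z) ^+ 2 <= energy a / (1 - modulus z ^+ 2).
Proof.
move=> ea z1; have z0 := modulus_ge0 z.
have q1 : modulus z ^+ 2 < 1 by rewrite expr_lt1.
have e0 := energy_ge0 ea.
have B0 : 0 <= energy a / (1 - modulus z ^+ 2) by rewrite divr_ge0// subr_ge0 ltW.
rewrite -[leRHS]sqr_sqrtr// ler_pXn2r ?nnegrE ?modulus_ge0 ?sqrtr_ge0//.
apply: (ev_le (ell_radius1 ea) z1) => N.
rewrite -(@ler_pXn2r _ 2) ?nnegrE ?sqrtr_ge0//; last first.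
  by apply: sumr_ge0 => i _; rewrite mulr_ge0 ?modulus_ge0 ?exprn_ge0 ?modulus_ge0.
rewrite sqr_sqrtr//; apply: le_trans (sqr_sum_ev_le a z N) _; apply: ler_pM.
- by apply: sumr_ge0 => i _; exact: wsum_term_ge0.
- by apply: sumr_ge0 => i _; rewrite divr_ge0// exprn_ge0// sqr_ge0.
- exact: wsum_le_energy.
- apply: le_trans (geometric_sum_le N (sqr_ge0 _) q1); apply: ler_sum => i _.
  by rewrite ler_pdivrMr// ler_peMr ?exprn_ge0 ?sqr_ge0// ler1n.
Qed.

End WeightedSequences.

(** * Existence and orthogonality of minimizers *)

Section Minimizers.
Variable R : realType.
Local Notation C := R[i].
Implicit Types (a b h : nat -> C) (z w : C) (K M t : R) (Z : set C).

Lemma real_cauchy_cvg (u x : nat -> R) : x @ \oo --> (0 : R) ->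
  (forall n p, (n <= p)%N -> `|u n - u p| <= x n) -> cvgn u.
Proof.
move=> /cvgr0Pnorm_lt x0 ux; apply: cauchy_cvg; apply: cauchy_exP => e e0.
have [n _ hn] := x0 e e0; exists (u n); exists n => // p /= np.
rewrite /ball /=; apply: le_lt_trans (ux n p np) _.
by apply: le_lt_trans (ler_norm _) _; exact: hn (leqnn n).
Qed.

Lemma tends_cauchy (u : nat -> C) (x : nat -> R) : x @ \oo --> (0 : R) ->
  (forall n p, (n <= p)%N -> modulus (u n - u p) <= x n) -> exists l, tends u l.
Proof.
move=> x0 ux.
have cr : cvgn (fun n => complex.Re (u n)).
  apply: (real_cauchy_cvg x0) => n p np; apply: le_trans (ux n p np).
  by apply: le_trans (Re_le_modulus _); case: (u n) (u p) => [? ?] [? ?].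
have ci : cvgn (fun n => complex.Im (u n)).
  apply: (real_cauchy_cvg x0) => n p np; apply: le_trans (ux n p np).
  by apply: le_trans (Im_le_modulus _); case: (u n) (u p) => [? ?] [? ?].
set p := limn _ in cr; set q := limn _ in ci.
exists (p +i* q); apply: (@tends_le _ _ _ (fun n => `|complex.Re (u n) - p| + `|complex.Im (u n) - q|)).
  rewrite -[X in _ --> X](addr0 (0 : R)); apply: cvgD; rewrite -(normr0 R); apply: cvg_norm.
    by rewrite -(subrr p); apply: cvgB => //; exact: cvg_cst.
  by rewrite -(subrr q); apply: cvgB => //; exact: cvg_cst.
by move=> n; apply: le_trans (modulus_le_ReIm _) _; case: (u n).
Qed.

Lemma wsum_cvg (v : nat -> nat -> C) (l : nat -> C) N :
  (forall k, tends (fun p => v p k) (l k)) -> (fun p => wsum (v p) N) @ \oo --> wsum l N.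
Proof.
move=> vl; elim: N => [|N IH].
  by under eq_fun do rewrite /wsum big_ord0; rewrite /wsum big_ord0; exact: cvg_cst.
rewrite wsumS (funext (fun p => wsumS (v p) N)); apply: cvgD => //.
apply: cvgM; first exact: cvg_cst.
by under eq_fun do rewrite expr2; rewrite expr2; apply: cvgM; exact: tends_modulus.
Qed.

Definition midpoint a b : nat -> C := a + (2^-1)%:C *: (b - a).

Lemma energy_sub a b : ell a -> ell b ->
  energy (b - a) = 2 * energy a + 2 * energy b - 4 * energy (midpoint a b).
Proof.
move=> ea eb; rewrite /midpoint energy_quad//; last exact: ellB.
by rewrite (addrC a) subrK; field.
Qed.

(* For a constant family this is the existence of a minimizer; for a decreasing
   one it also gives weak compactness, without weak topologies. *)
Lemma almost_minimizers (A : nat -> set (nat -> C)) K :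
  (forall n a, A n.+1 a -> A n a) -> (forall n a, A n a -> ell a) ->
  (forall n a b, A n a -> A n b -> A n (midpoint a b)) ->
  (forall n, exists2 a, A n a & energy a <= K) ->
  exists a u, [/\ ell a, energy a <= K, forall n, A n (u n),
    forall z, modulus z < 1 -> tends (fun n => ev (u n) z) (ev a z) &
    forall b, (forall n, A n b) -> energy a <= energy b].
Proof.
move=> AS Ae Am AK.
pose E n := (@energy R) @` (A n); pose m n := inf (E n).
have Elb n : has_inf (E n).
  split; first by have [a aA _] := AK n; exists (energy a), a.
  by exists 0 => _ [a aA <-]; exact: energy_ge0 (Ae _ _ aA).
have mle n a : A n a -> m n <= energy a.
  by move=> aA; apply: ge_inf; [case: (Elb n)|exists a].
have mK n : m n <= K by have [a aA aK] := AK n; apply: le_trans aK; exact: mle.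
have mS n : m n <= m n.+1.
  apply: lb_le_inf; first by case: (Elb n.+1).
  by move=> _ [a aA <-]; apply: mle; exact: AS.
have mmono : nondecreasing_seq m by apply/nondecreasing_seqP.
have mcvg : cvgn m by apply: nondecreasing_is_cvgn => //; exists K => _ [n _ <-].
pose l : R := limn m.
have ml n : m n <= l by exact: nondecreasing_cvgn_le.
have lK K' : (forall n, m n <= K') -> l <= K'.
  by move=> h; apply: (cvgr_to_le mcvg); exact: nearW.
have /choice[u hu] : forall n, exists a, A n a /\ energy a <= m n + n.+1%:R^-1.
  move=> n; have i0 : 0 < n.+1%:R^-1 :> R by rewrite invr_gt0 ltr0n.
  have [_ [a aA <-] h] := @inf_adherent _ (E n) _ i0 (Elb n).
  by exists a; split => //; exact: ltW.
have uA n : A n (u n) by case: (hu n).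
have uE n : energy (u n) <= m n + n.+1%:R^-1 by case: (hu n).
have Amono n p a : (n <= p)%N -> A p a -> A n a.
  by move=> /subnKC <-; elim: (p - n)%N => [|k IH]; rewrite ?addn0// addnS => /AS/IH.
(* For n <= p the midpoint of u_n and u_p stays in [A n], so [energy_sub] bounds the energy of u_p -
   u_n by 2 (m p - m n) + 2 / (n + 1) + 2 / (p + 1), hence by [e n]. *)
pose e n : R := 2 * (l - m n) + 4 * n.+1%:R^-1.
have e0 : e @ \oo --> (0 : R).
  rewrite -[X in _ --> X](_ : 2 * (l - l) + 4 * 0 = 0); last by rewrite subrr !mulr0 addr0.
  apply: cvgD; apply: cvgM; try exact: cvg_cst.
    by apply: cvgB => //; exact: cvg_cst.
  exact: cvg_harmonic.
have ep n : 0 <= e n by rewrite /e addr_ge0// mulr_ge0// ?invr_ge0// subr_ge0.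
have ue n p : (n <= p)%N -> energy (u p - u n) <= e n.
  move=> np; rewrite energy_sub; [|exact: Ae (uA n)|exact: Ae (uA p)].
  have h1 : m n <= energy (midpoint (u n) (u p)).
    by apply: mle; apply: Am => //; exact: Amono (uA p).
  have h2 : p.+1%:R^-1 <= n.+1%:R^-1 :> R by rewrite lef_pV2 ?posrE ?ltr0n// ler_nat ltnS.
  rewrite /e; move: (uE n) (uE p) (ml p) h1 h2.
  move: (n.+1%:R^-1) (p.+1%:R^-1) (m n) (m p) (energy _) (energy _) (energy _) => *; lra.
have s0 : (fun n => Num.sqrt (e n)) @ \oo --> (0 : R).
  by rewrite -(sqrtr0 R); apply: continuous_cvg => //; exact: sqrt_continuous.
have uB n p : ell (u p - u n) by apply: ellB; exact: Ae (uA _).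
have /choice[a ha] : forall k, exists x, tends (fun n => u n k) x.
  move=> k; apply: (tends_cauchy s0) => n p np.
  rewrite -(@ler_pXn2r _ 2) ?nnegrE ?modulus_ge0 ?sqrtr_ge0// sqr_sqrtr// modulusB.
  by apply: le_trans (ue n p np); exact: (coef_le k (uB n p)).
have aue n N : wsum (a - u n) N <= e n.
  have hc := @wsum_cvg (fun p => u p - u n) (a - u n) N.
  apply: (cvgr_to_le (hc _)).
    by move=> k; apply: tendsB => //; exact: tends_cst.
  exists n => // p /= np; apply: le_trans (ue n p np); exact: wsum_le_energy.
have eau n : ell (a - u n) by exists (e n).
have aE : a = u 0%N + (a - u 0%N) by rewrite addrC subrK.
have ea : ell a by rewrite aE; apply: ellD => //; exact: Ae (uA _).
have al : energy a <= l.
  apply: energy_le => N.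
  have h : (fun p => m p + p.+1%:R^-1) @ \oo --> l.
    by rewrite -[X in _ --> X](addr0 l); apply: cvgD => //; exact: cvg_harmonic.
  apply: (ler_cvg_to (@wsum_cvg u a N ha) h); apply: nearW => p.
  by apply: le_trans (uE p); apply: wsum_le_energy; exact: Ae (uA p).
exists a, u; split=> //.
- by apply: le_trans al _; exact: lK.
- move=> z z1; have q0 : 0 < 1 - modulus z ^+ 2.
    by rewrite subr_gt0 expr_lt1// modulus_ge0.
  apply: (@tends_le _ _ _ (fun n => Num.sqrt (e n / (1 - modulus z ^+ 2)))).
    rewrite -(sqrtr0 R); apply: continuous_cvg; first exact: sqrt_continuous.
    by rewrite -(mul0r (1 - modulus z ^+ 2)^-1); apply: cvgM => //; exact: cvg_cst.
  move=> n; have eun := Ae _ _ (uA n).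
  have D0 : 0 <= e n / (1 - modulus z ^+ 2) by rewrite divr_ge0// ltW.
  rewrite modulusB -evBr// -(@ler_pXn2r _ 2) ?nnegrE ?modulus_ge0 ?sqrtr_ge0//.
  rewrite [leRHS]sqr_sqrtr//; apply: le_trans (sqr_ev_le (eau n) z1) _.
  by rewrite ler_pM2r ?invr_gt0//; exact: energy_le.
- by move=> b hb; apply: le_trans al _; apply: lK => n; exact: mle.
Qed.

Definition adm Z w a := [/\ ell a, ev a w = 1 & forall z, Z z -> ev a z = 0].

Definition minimal Z w a := adm Z w a /\ forall b, adm Z w b -> energy a <= energy b.

Lemma ev_midpoint a b z : ell a -> ell b -> modulus z < 1 ->
  ev (midpoint a b) z = ev a z + (2^-1)%:C * (ev b z - ev a z).
Proof.
move=> ea eb z1; rewrite /midpoint evDr ?evZr ?evBr//; first exact: ellB.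
by apply: ellZ; exact: ellB.
Qed.

Lemma adm_midpoint Z w a b : Z `<=` [set z | modulus z < 1] -> modulus w < 1 ->
  adm Z w a -> adm Z w b -> adm Z w (midpoint a b).
Proof.
move=> Z1 w1 [ea a1 aZ] [eb b1 bZ]; split.
- by apply: ellD => //; apply: ellZ; exact: ellB.
- by rewrite ev_midpoint// a1 b1 subrr mulr0 addr0.
- by move=> z Zz; rewrite ev_midpoint// ?aZ ?bZ// ?subr0 ?mulr0 ?addr0//; exact: Z1.
Qed.

(** At a point of [Z n] the approximating functions vanish from index n on, and this passes to their
    pointwise limit. *)
Lemma adm_limit (Z : nat -> set C) w K :
  (forall n, Z n `<=` [set z | modulus z < 1]) -> modulus w < 1 ->
  (forall n, Z n `<=` Z n.+1) ->
  (forall n, exists2 a, adm (Z n) w a & energy a <= K) ->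
  exists a, [/\ adm (\bigcup_n Z n) w a, energy a <= K &
    forall b, adm (\bigcup_n Z n) w b -> energy a <= energy b].
Proof.
move=> Z1 w1 ZS hK.
have [||||a [u [ea aK uA ua amin]]] := @almost_minimizers (fun n => adm (Z n) w) K.
- by move=> n a [? ? h]; split=> // z /ZS; exact: h.
- by move=> n a [].
- by move=> n a b; exact: adm_midpoint.
- exact: hK.
have Zmono n p : (n <= p)%N -> Z n `<=` Z p.
  by move=> /subnKC <-; elim: (p - n)%N => [|k IH]; rewrite ?addn0// addnS => z /IH/ZS.
exists a; split=> //; first split=> //.
- apply: tends_unique (ua w w1) _; apply: tends_ext (tends_cst 1) => n.
  by case: (uA n).
- move=> z [n _ Zz]; have z1 := Z1 n z Zz.
  apply: tends_unique (ua z z1) _; apply/tendsP => e e0; exists n => p np.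
  by case: (uA p) => _ _ ->; rewrite ?subr0 ?modulus0//; exact: Zmono Zz.
- move=> b [eb b1 bZ]; apply: amin => n; split=> // z Zz.
  by apply: bZ; exists n.
Qed.

Lemma minimal_exists Z w a : Z `<=` [set z | modulus z < 1] -> modulus w < 1 ->
  adm Z w a -> exists p, minimal Z w p.
Proof.
move=> Z1 w1 aA.
have [|//|||p [pA _ pm]] := @adm_limit (fun=> Z) w (energy a).
- by move=> _; exact: Z1.
- by move=> _ z.
- by move=> _; exists a.
have e : \bigcup_(n in [set: nat]) Z = Z by rewrite bigcup_const//; exists 0%N.
by rewrite e in pA pm; exists p.
Qed.

Section Pythagoras.
Variables (Z : set C) (w : C) (p : nat -> C).
Hypotheses (Z1 : Z `<=` [set z | modulus z < 1]) (w1 : modulus w < 1) (pm : minimal Z w p).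

(** With X twice the real inner product of p and h, minimality gives 0 <= t X + t^2 E(h) for every
    real t, which forces X = 0: take t = - X / (E(h) + 1), where the 1 covers E(h) = 0. *)
Lemma energy_orthogonal h : ell h -> ev h w = 0 -> (forall z, Z z -> ev h z = 0) ->
  energy (p + h) = energy p + energy h.
Proof.
move=> eh hw hZ; have [[ep pw pZ] pmin] := pm.
have key t : energy p <= energy (p + t%:C *: h).
  apply: pmin; have eth := ellZ t%:C eh; split.
  - exact: ellD.
  - by rewrite evDr// evZr// hw mulr0 addr0.
  - by move=> z Zz; have z1 := Z1 Zz; rewrite evDr// evZr// hZ// mulr0 addr0 pZ.
pose X := energy (p + h) - energy p - energy h.
have {}key t : 0 <= t * X + t ^+ 2 * energy h.
  by have := key t; rewrite energy_quad// /X; lra.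
suff : X = 0 by rewrite /X; lra.
have h0 := energy_ge0 eh.
have hp : 0 < energy h + 1 by lra.
have := key (- X / (energy h + 1)); rewrite -subr_ge0 => hX.
apply/eqP; rewrite -sqrf_eq0 -(@mulrI_eq0 _ ((energy h + 1)^-1 ^+ 2)); last first.
  by apply/lregP; rewrite expf_neq0// invr_neq0// gt_eqF.
rewrite eq_le; apply/andP; split; last by rewrite mulr_ge0 ?sqr_ge0.
have e : (energy h + 1)^-1 ^+ 2 * X ^+ 2 = - (- X / (energy h + 1) * X + (- X / (energy h + 1)) ^+ 2 * energy h).
  by move: (energy h) hp => y hp; field; rewrite gt_eqF.
by rewrite e oppr_le0; have := key (- X / (energy h + 1)).
Qed.

(** Pythagoras, since a - a(w) p vanishes at w and on Z. In Hilbert space terms, the inner product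
    of a and p is a(w) E(p). *)
Lemma energy_decomp a : ell a -> (forall z, Z z -> ev a z = 0) ->
  energy a = modulus (ev a w) ^+ 2 * energy p + energy (a - ev a w *: p).
Proof.
move=> ea aZ; have [[ep pw pZ] pmin] := pm.
set c := ev a w; set h := a - c *: p.
have ecp := ellZ c ep.
have eh : ell h by exact: ellB.
have hw : ev h w = 0 by rewrite evBr// evZr// pw mulr1 subrr.
have hZ z : Z z -> ev h z = 0.
  by move=> Zz; have z1 := Z1 Zz; rewrite evBr// evZr// pZ// aZ// mulr0 subr0.
have [c0|c0] := eqVneq c 0.
  by rewrite /h c0 scale0r subr0 modulus0 expr0n mul0r add0r.
have -> : a = c *: (p + c^-1 *: h).
  by rewrite scalerDr scalerA divff// scale1r addrC subrK.
have ech := ellZ c^-1 eh.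
rewrite energyZ; last exact: ellD.
rewrite energy_orthogonal//.
- rewrite mulrDr; congr (_ + _); rewrite energyZ// modulusV mulrA -exprMn divff ?expr1n ?mul1r//.
  by rewrite modulus_eq0.
- by rewrite evZr// hw mulr0.
- by move=> z Zz; have z1 := Z1 Zz; rewrite evZr// hZ// mulr0.
Qed.

Lemma minimal_le a : ell a -> (forall z, Z z -> ev a z = 0) ->
  modulus (ev a w) ^+ 2 * energy p <= energy a.
Proof.
move=> ea aZ; rewrite (energy_decomp ea aZ) lerDl; apply: energy_ge0.
by apply: ellB => //; apply: ellZ; have [[]] := pm.
Qed.

End Pythagoras.

End Minimizers.

(** * Location and simplicity of the zeros of minimizers *)

Section ZerosOfMinimizers.
Variable R : realType.
Local Notation C := R[i].
Implicit Types (a b g h p : nat -> C) (z w : C) (M t : R) (Z : set C).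

Lemma wsum_shift a N :
  wsum (shift_seq a) N.+1 = \sum_(n < N) n.+2%:R * modulus (a n) ^+ 2.
Proof. by rewrite /wsum big_ord_recl /= modulus0 expr0n mulr0 add0r. Qed.

Lemma ell_shift a : ell a -> ell (shift_seq a).
Proof.
move=> [M hM]; exists (2 * M) => -[|N].
  rewrite /wsum big_ord0 mulr_ge0//; apply: le_trans (hM 0%N).
  by apply: sumr_ge0 => i _; exact: wsum_term_ge0.
rewrite wsum_shift; apply: (@le_trans _ _ (2 * wsum a N)); last by rewrite ler_wpM2l.
rewrite /wsum mulr_sumr; apply: ler_sum => n _; rewrite mulrA ler_wpM2r ?sqr_ge0//.
by rewrite -natrM ler_nat; lia.
Qed.

Lemma energy_shift_ge a : ell a -> energy a <= energy (shift_seq a).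
Proof.
move=> ea; apply: energy_le => N; apply: le_trans (wsum_le_energy N.+1 (ell_shift ea)).
rewrite wsum_shift; apply: ler_sum => n _; rewrite ler_wpM2r ?sqr_ge0//.
by rewrite ler_nat.
Qed.

Lemma wsum_drop_le a k N : ell a ->
  \sum_(n < N) n.+1%:R * modulus (a (n.+1 + k)%N) ^+ 2 <= energy a.
Proof.
move=> ea; apply: le_trans (wsum_le_energy (k.+1 + N) ea).
rewrite /wsum big_split_ord /=; apply: (@le_trans _ _ (\sum_(i < N) (k.+1 + i).+1%:R * modulus (a (k.+1 + i)%N) ^+ 2)).
  apply: ler_sum => n _; have -> : (n.+1 + k = k.+1 + n)%N by lia.
  by rewrite ler_wpM2r ?sqr_ge0// ler_nat; lia.
by rewrite lerDr; apply: sumr_ge0 => i _; rewrite mulr_ge0 ?sqr_ge0.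
Qed.

(* The quotient [a / (z - w)] has coefficients [g n = \sum_k a (n.+1 + k) * w ^+ k]. *)
Lemma divide_root a w : ell a -> modulus w < 1 -> ev a w = 0 ->
  exists2 g, ell g & a = shift_seq g - w *: g.
Proof.
move=> ea w1 aw; have w0 := modulus_ge0 w; have ra := ell_radius1 ea.
pose g n := ev (drop_seq n.+1 a) w; exists g; last first.
  apply/funext => -[|n].
    have := ev_drop1 ra w1; rewrite aw => e.
    have -> : (shift_seq g - w *: g) 0%N = - (w * g 0%N) by exact: sub0r.
    by apply/eqP; rewrite -addr_eq0 -e.
  have -> : (shift_seq g - w *: g) n.+1 = g n - w * g n.+1 by [].
  rewrite /g (ev_drop1 (radius1_drop n.+1 ra) w1).
  have -> : drop_seq 1 (drop_seq n.+1 a) = drop_seq n.+2 a.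
    by apply/funext => m; rewrite /drop_seq; congr a; lia.
  by rewrite addrK /drop_seq addn0.
pose G := (1 - modulus w)^-1.
have G0 : 0 <= G by rewrite invr_ge0 subr_ge0 ltW.
pose v K n : C := \sum_(k < K) a (n.+1 + k)%N * w ^+ k.
have vg n : tends (fun K => v K n) (g n) by exact: (ev_tends (radius1_drop n.+1 ra) w1).
have vle K n : modulus (v K n) ^+ 2 <=
    G * \sum_(k < K) modulus w ^+ k * modulus (a (n.+1 + k)%N) ^+ 2.
  apply: (@le_trans _ _ ((\sum_(k < K) modulus w ^+ k * modulus (a (n.+1 + k)%N)) ^+ 2)).
    rewrite ler_pXn2r ?nnegrE ?modulus_ge0//; last first.
      by apply: sumr_ge0 => i _; rewrite mulr_ge0 ?exprn_ge0 ?modulus_ge0.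
    apply: le_trans (modulus_sum _ _ _) _; apply: ler_sum => k _.
    by rewrite modulusM modulusX mulrC.
  have := @finite_cauchy_schwarz R _ (index_enum 'I_K)
    (fun k : 'I_K => modulus w ^+ k * modulus (a (n.+1 + k)%N))
    (fun k : 'I_K => modulus w ^+ k)
    (fun k : 'I_K => modulus w ^+ k * modulus (a (n.+1 + k)%N) ^+ 2).
  move=> h; apply: le_trans (h _ _ _) _.
  - by move=> k; rewrite exprn_ge0.
  - by move=> k; rewrite mulr_ge0 ?exprn_ge0 ?modulus_ge0.
  - by move=> k; rewrite exprMn expr2 mulrA.
  - rewrite ler_wpM2r ?geometric_sum_le//.
    by apply: sumr_ge0 => k _; rewrite mulr_ge0 ?exprn_ge0 ?modulus_ge0.
exists (G * (G * energy a)) => N.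
have hc : (fun K => wsum (v K) N) @ \oo --> wsum g N by exact: wsum_cvg.
apply: (cvgr_to_le hc); apply: nearW => K.
rewrite /wsum; apply: (@le_trans _ _ (\sum_(n < N) G * \sum_(k < K) modulus w ^+ k * (n.+1%:R * modulus (a (n.+1 + k)%N) ^+ 2))).
  apply: ler_sum => n _; apply: le_trans (ler_wpM2l _ (vle K n)) _ => //.
  by rewrite mulrCA ler_wpM2l// mulr_sumr; apply: ler_sum => k _; rewrite mulrCA.
rewrite -mulr_sumr ler_wpM2l// exchange_big /=.
apply: (@le_trans _ _ (\sum_(k < K) modulus w ^+ k * energy a)).
  apply: ler_sum => k _; rewrite -mulr_sumr ler_wpM2l ?exprn_ge0//.
  exact: wsum_drop_le.
by rewrite -mulr_suml ler_wpM2r ?energy_ge0// geometric_sum_le.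
Qed.

Lemma cdiff_unique (f : C -> C) z (l m : C) : cdiff f z l -> cdiff f z m -> l = m.
Proof. by move=> /cdiff_derive1 <- /cdiff_derive1 <-. Qed.

(* If [p = z g - w g] with [g] vanishing on [Z], then [p] is orthogonal to [z g],
   so [|w|^2 E(g) = E(z g) + E(p) >= E(g) + E(p)], which is absurd. *)
Lemma minimal_zero Z p w : Z `<=` [set z | modulus z < 1] -> minimal Z 0 p ->
  modulus w < 1 -> ev p w = 0 -> Z w /\ ev (deriv_seq p) w != 0.
Proof.
move=> Z1 pm w1 pw; have [[ep p0 pZ] _] := pm.
have z01 : modulus (0 : C) < 1 by rewrite modulus0.
have [g eg pg] := divide_root ep w1 pw.
have esg := ell_shift eg; have ewg := ellZ w eg.
have pE z : modulus z < 1 -> ev p z = (z - w) * ev g z.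
  move=> z1; rewrite pg evBr// evZr// mulrBl; congr (_ - _).
  by apply: ev_shift => //; exact: ell_radius1.
have gw : ev (deriv_seq p) w = ev g w.
  apply: (cdiff_unique (ev_cdiff (ell_radius1 ep) w1)).
  have c1 : cdiff (fun z => z - w) w 1.
    move=> e e0; exists 1 => // h _.
    have -> : w + h - w - (w - w) - 1 * h = 0 by ring.
    by rewrite modulus0 mulr_ge0 ?modulus_ge0// ltW.
  have := cdiffM c1 (ev_cdiff (ell_radius1 eg) w1).
  rewrite subrr mul0r addr0 mul1r; apply: (@cdiff_ext _ _ _ _ _ (1 - modulus w)).
    by rewrite subr_gt0.
  move=> h hh; rewrite -pE//; apply: le_lt_trans (modulusD _ _) _.
  by move: hh; rewrite ltrBrDl.
(* The implication to be refuted covers both failures: it is vacuous when w is outside Z, and true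
   when the zero is multiple. Since g(w) = p'(w), it makes [g] vanish on all of Z. *)
suff key : ~ (Z w -> ev (deriv_seq p) w = 0).
  split; first by apply: contra_notP key => nZ /nZ.
  by apply/eqP => e; apply: key.
move=> hw.
have gZ z : Z z -> ev g z = 0.
  move=> Zz; have [e|zw] := eqVneq z w; first by rewrite e -gw hw// -e.
  have z1 : modulus z < 1 := Z1 z Zz.
  move: (pE z z1); rewrite (pZ z Zz) => /esym/eqP.
  by rewrite mulf_eq0 subr_eq0 (negbTE zw) => /eqP.
have sgE z : modulus z < 1 -> ev (shift_seq g) z = z * ev g z.
  by move=> z1; apply: ev_shift => //; exact: ell_radius1.
have := @energy_orthogonal R Z 0 p Z1 z01 pm (- shift_seq g) (ellN esg).
rewrite -scaleN1r evZr// sgE// mul0r mulr0 => /(_ erefl) h.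
have : energy (p + -1 *: shift_seq g) = energy p + energy (-1 *: shift_seq g).
  by apply: h => z Zz; rewrite evZr ?sgE ?gZ ?mulr0//; exact: Z1.
have -> : p + -1 *: shift_seq g = (- w) *: g.
  by rewrite {1}pg scaleN1r scaleNr addrAC subrr add0r.
rewrite !energyZ// !modulusN modulus1 expr1n mul1r => E.
have h1 := energy_shift_ge eg; have h2 := energy_ge0 eg.
(* The energy of p is positive because p(0) = 1; with |w| < 1 this contradicts the identity [E]. *)
have h3 : 1 <= energy p.
  by have := coef_le 0 ep; rewrite -(ev_at0 (ell_radius1 ep)) p0 modulus1 expr1n.
have h4 : modulus w ^+ 2 <= 1 by rewrite expr_le1 ?modulus_ge0 ?ltW.
by have := ler_wpM2r h2 h4; rewrite mul1r; lra.
Qed.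

End ZerosOfMinimizers.

(** * The complete Pick property and bounded minimizers *)

Section BoundednessOfMinimizers.
Variable R : realType.
Local Notation C := R[i].
Implicit Types (a b g h p : nat -> C) (z w : C) (c : nat -> R) (Z : set C).

(** Coefficients b_n of 1 - 1/k, where k(x) is the sum of x^n / (n + 1). Comparing coefficients in k
    (1 - 1/k) = k - 1 gives b_n from all earlier b_j; the list carries them so that the recursion is
    structural. *)
Fixpoint kaluza_list (n : nat) : seq R :=
  if n is m.+1 then
    rcons (kaluza_list m) (if m is 0 then 0 else
      m.+1%:R^-1 - \sum_(j < m) nth 0 (kaluza_list m) j / (m.+1 - j)%:R)
  else [::].

Lemma kaluza_listS n : kaluza_list n.+1 =
  rcons (kaluza_list n) (if n is 0 then 0 else
    n.+1%:R^-1 - \sum_(j < n) nth 0 (kaluza_list n) j / (n.+1 - j)%:R).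
Proof. by []. Qed.

Lemma size_kaluza_list n : size (kaluza_list n) = n.
Proof. by elim: n => //= n IH; rewrite size_rcons IH. Qed.

Definition kaluza n := nth 0 (kaluza_list n.+1) n.

Lemma nth_kaluza_list n j : (j < n)%N -> nth 0 (kaluza_list n) j = kaluza j.
Proof.
elim: n => // n IH; rewrite ltnS leq_eqVlt => /orP[/eqP ->//|jn] /=.
by rewrite nth_rcons size_kaluza_list jn IH.
Qed.

Lemma kaluza0 : kaluza 0 = 0.
Proof. by []. Qed.

Lemma kaluzaE n : (0 < n)%N ->
  kaluza n = n.+1%:R^-1 - \sum_(j < n) kaluza j / (n.+1 - j)%:R.
Proof.
case: n => // n _; rewrite /kaluza kaluza_listS nth_rcons size_kaluza_list.
rewrite ltnn eqxx; congr (_ - _); apply: eq_bigr => j _.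
by rewrite nth_kaluza_list.
Qed.

Lemma kaluza_sum m : \sum_(n < m.+1) kaluza n / (m.+1 - n)%:R = (0 < m)%N%:R / m.+1%:R.
Proof.
case: m => [|m]; first by rewrite big_ord1 kaluza0 !mul0r.
by rewrite big_ord_recr /= (@kaluzaE m.+1)// subSnn divr1 mul1r addrC subrK.
Qed.

(* Kaluza's lemma: the coefficients [1 / n.+1] are log-convex. *)
Lemma kaluza_ge0 n : 0 <= kaluza n.
Proof.
elim/ltn_ind: n => -[|[|m]] IH; first by rewrite kaluza0.
  by rewrite kaluzaE// big_ord_recr big_ord0 /= kaluza0 mul0r addr0 subr0 invr_ge0.
rewrite kaluzaE// subr_ge0.
have e : m.+3%:R^-1 = (m.+2%:R / m.+3%:R) * (\sum_(n < m.+2) kaluza n / (m.+2 - n)%:R).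
  have m0 : m.+2%:R != 0 :> R by rewrite pnatr_eq0.
  by rewrite kaluza_sum mul1r mulrAC divff// mul1r.
rewrite [leRHS]e mulr_sumr; apply: ler_sum => j _.
rewrite mulrCA ler_wpM2l ?IH//.
have jm := ltn_ord j.
have d0 : (0 < m.+2 - j)%N by rewrite subn_gt0.
rewrite (_ : m.+3 - j = (m.+2 - j).+1)%N; last by rewrite subSn// ltnW.
have dm : (m.+2 - j <= m.+2)%N by exact: leq_subr.
move: (m.+2 - j)%N d0 dm => d d0 dm.
have d0' : 0 < d%:R :> R by rewrite ltr0n.
have -> : m.+2%:R / m.+3%:R / d%:R = m.+2%:R / (m.+3%:R * d%:R) :> R by rewrite invfM mulrA.
rewrite ler_pdivlMr ?mulr_gt0 ?ltr0n// mulrC ler_pdivrMr ?ltr0n//.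
by rewrite -!natrM ler_nat; nia.
Qed.

(** For n > m the truncated difference is 0 and so is its inverse; the convolution can thus be
    written as a sum over a range independent of m. *)
Lemma kaluza_sum_ord m M : (m < M)%N ->
  \sum_(n < M) kaluza n / (m.+1 - n)%:R = (0 < m)%N%:R / m.+1%:R.
Proof.
move=> mM; rewrite -(subnKC mM) big_split_ord /= kaluza_sum big1 ?addr0// => i _.
by rewrite (_ : m.+1 - (m.+1 + i) = 0)%N ?invr0 ?mulr0//; lia.
Qed.

Lemma kaluza_sum_le m M : \sum_(n < M) kaluza n / (m.+1 - n)%:R <= m.+1%:R^-1.
Proof.
apply: (@le_trans _ _ (\sum_(n < M + m.+1) kaluza n / (m.+1 - n)%:R)).
  rewrite big_split_ord /= lerDl; apply: sumr_ge0 => i _.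
  by rewrite divr_ge0 ?kaluza_ge0.
rewrite kaluza_sum_ord; last by lia.
by rewrite ler_piMl// lern1 leq_b1.
Qed.

(** By truncated subtraction and [y 0 = 0], the left side consists of the first M - n terms of the
    right side. *)
Lemma delayed_sum_le (y : nat -> R) n M : y 0%N = 0 -> (forall k, 0 <= y k) ->
  \sum_(m < M) y (m.+1 - n)%N <= \sum_(m < M) y m.+1.
Proof.
move=> y0 yp; elim: n M => [|n IH] [|M]; rewrite ?big_ord0//.
rewrite big_ord_recl /= subSS sub0n y0 add0r big_ord_recr /=.
apply: le_trans (_ : \sum_(m < M) y m.+1 <= _); last by rewrite lerDl.
by under eq_bigr do rewrite subSS; exact: IH.
Qed.

(* The kernel [k = \sum x ^+ n / n.+1] times [1 - \sum kaluza n * x ^+ n] is 1,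
   and truncating both factors only adds nonpositive terms. *)
Lemma kaluza_kernel_le (x : R) M : 0 <= x -> (0 < M)%N ->
  (\sum_(n < M) x ^+ n / n.+1%:R) * (1 - \sum_(n < M) kaluza n * x ^+ n) <= 1.
Proof.
move=> x0 M0; rewrite mulrBr mulr1 lerBlDr -lerBlDl mulr_sumr.
pose y d : R := if d is d'.+1 then x ^+ d' / d'.+1%:R else 0.
have y_ge0 d : 0 <= y d by case: d => //= d; rewrite divr_ge0// exprn_ge0.
apply: (@le_trans _ _ (\sum_(n < M) kaluza n * x ^+ n * \sum_(m < M) y (m.+1 - n)%N)); last first.
  apply: ler_sum => n _; rewrite [leRHS]mulrC ler_wpM2l ?mulr_ge0 ?kaluza_ge0 ?exprn_ge0//.
  exact: delayed_sum_le.
under [leRHS]eq_bigr do rewrite mulr_sumr.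
rewrite exchange_big /=.
have e m : (m < M)%N -> \sum_(n < M) kaluza n * x ^+ n * y (m.+1 - n)%N = x ^+ m * ((0 < m)%N%:R / m.+1%:R).
  move=> mM; rewrite -(kaluza_sum_ord mM) mulr_sumr; apply: eq_bigr => n _.
  have [nm|mn] := leqP n m; last first.
    by rewrite (_ : m.+1 - n = 0)%N ?invr0 ?mulr0//; lia.
  rewrite subSn//= -{3}(subnKC nm) exprD.
  by move: (x ^+ n) (x ^+ (m - n)) (kaluza n) (_%:R^-1) => *; ring.
have -> : \sum_(m < M) \sum_(n < M) kaluza n * x ^+ n * y (m.+1 - n)%N =
    \sum_(m < M) x ^+ m * ((0 < m)%N%:R / m.+1%:R).
  by apply: eq_bigr => m _; exact: e.
case: M M0 {e} => // M _; rewrite !big_ord_recl /= expr0 invr1 mul0r !mulr0 mul1r add0r addrAC subrr add0r.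
by apply: ler_sum => m _; rewrite mul1r.
Qed.

Lemma ell_iter_shift n g : ell g -> ell (iter n (@shift_seq R) g).
Proof. by move=> eg; elim: n => //= n IH; exact: ell_shift. Qed.

Lemma ev_iter_shift n g z : ell g -> modulus z < 1 ->
  ev (iter n (@shift_seq R) g) z = z ^+ n * ev g z.
Proof.
move=> eg z1; elim: n => [|n IH]; first by rewrite mul1r.
by rewrite /= ev_shift ?IH ?exprS ?mulrA//; apply: ell_radius1; exact: ell_iter_shift.
Qed.

Lemma iter_shift_lt n g m : (m < n)%N -> iter n (@shift_seq R) g m = 0.
Proof. by elim: n m => // n IH [|m] //= mn; exact: IH. Qed.

(** The n-fold shift moves the coefficient of index m - n to m, where the weight m + 1 - n is the
    one it had in g; for m < n the truncated weight is 0. *)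
Lemma wsum_iter_shift_le n g N :
  \sum_(m < N) (m.+1 - n)%:R * modulus (iter n (@shift_seq R) g m) ^+ 2 <= wsum g N.
Proof.
elim: n N => [|n IH] [|N]; rewrite ?big_ord0 /wsum ?big_ord0//.
rewrite big_ord_recl /= modulus0 expr0n mulr0 add0r.
under eq_bigr do rewrite subSS.
apply: le_trans (IH N) _; exact: wsum_nondecreasing.
Qed.

(** Coefficients of g times the truncation to n < M of 1 - 1/k(z conj(w)); at z = w the multiplier
    is the real truncated sum at |w|^2. *)
Definition pick_sum w M g : nat -> C :=
  \sum_(n < M) ((kaluza n)%:C * conjc w ^+ n) *: iter n (@shift_seq R) g.

Lemma ell_pick_sum w M g : ell g -> ell (pick_sum w M g).
Proof. by move=> eg; apply: ell_sum => n; apply: ellZ; exact: ell_iter_shift. Qed.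

Lemma ev_pick_sum w M g z : ell g -> modulus z < 1 ->
  ev (pick_sum w M g) z = (\sum_(n < M) (kaluza n)%:C * conjc w ^+ n * z ^+ n) * ev g z.
Proof.
move=> eg z1; rewrite /pick_sum; elim: M => [|M IH].
  rewrite !big_ord0 mul0r -(scale0r g) evZr// mul0r //.
rewrite !big_ord_recr /= evDr//; last 2 first.
- by apply: ell_sum => n; apply: ellZ; exact: ell_iter_shift.
- by apply: ellZ; exact: ell_iter_shift.
rewrite IH evZr ?ev_iter_shift//; last exact: ell_iter_shift.
by rewrite mulrDl mulrA.
Qed.

(* Cauchy-Schwarz with weights [kaluza n / (m.+1 - n)], of total mass at most
   [1 / m.+1]: the shifts weighted by [Num.sqrt (kaluza n)] form a row contraction. *)
Lemma energy_pick_sum w M g : ell g ->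
  energy (pick_sum w M g) <= (\sum_(n < M) kaluza n * (modulus w ^+ 2) ^+ n) * energy g.
Proof.
move=> eg; apply: energy_le => N; set x := modulus w ^+ 2; set s := fun n => iter n (@shift_seq R) g.
have k0 n := kaluza_ge0 n; have x0 : 0 <= x by exact: sqr_ge0.
have coefE m : pick_sum w M g m = \sum_(n < M) ((kaluza n)%:C * conjc w ^+ n) * s n m.
  by rewrite /pick_sum fct_sumE.
pose v n m := kaluza n * x ^+ n * ((m.+1 - n)%:R * modulus (s n m) ^+ 2).
have v0 n m : 0 <= v n m.
  apply: mulr_ge0; first by apply: mulr_ge0 => //; exact: exprn_ge0.
  by apply: mulr_ge0 => //; exact: sqr_ge0.
have step m : m.+1%:R * modulus (pick_sum w M g m) ^+ 2 <= \sum_(n < M) v n m.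
  have h : modulus (pick_sum w M g m) <= \sum_(n < M) kaluza n * modulus w ^+ n * modulus (s n m).
    rewrite coefE; apply: le_trans (modulus_sum _ _ _) _; apply: ler_sum => n _.
    by rewrite !modulusM modulusX modulus_conj modulus_real ger0_norm.
  have cs := @finite_cauchy_schwarz R _ (index_enum 'I_M)
    (fun n : 'I_M => kaluza n * modulus w ^+ n * modulus (s n m))
    (fun n : 'I_M => kaluza n / (m.+1 - n)%:R) (fun n => v n m).
  rewrite mulrC -ler_pdivlMr ?ltr0n// mulrC.
  apply: (@le_trans _ _ ((\sum_(n < M) kaluza n * modulus w ^+ n * modulus (s n m)) ^+ 2)).
    by rewrite ler_pXn2r ?nnegrE ?modulus_ge0//; exact: le_trans (modulus_ge0 _) h.
  apply: le_trans (cs _ _ _) _.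
  - by move=> n; rewrite divr_ge0.
  - by move=> n; exact: v0.
  - move=> n; rewrite /v; have [nm|mn] := leqP n m; last first.
      by rewrite /s iter_shift_lt// modulus0 !mulr0 expr0n !mulr0.
    have d0 : (m.+1 - n)%:R != 0 :> R by rewrite pnatr_eq0 subn_eq0 -ltnNge.
    rewrite /x -exprM mulnC exprM.
    move: (_ - _)%N%:R d0 (modulus w ^+ n) (kaluza n) (modulus _) => d d0 y k t.
    by rewrite le_eqVlt; apply/orP; left; apply/eqP; field.
  - by rewrite ler_wpM2r ?kaluza_sum_le//; exact: sumr_ge0.
apply: (@le_trans _ _ (\sum_(m < N) \sum_(n < M) v n m)); first by apply: ler_sum => m _.
rewrite exchange_big /= mulr_suml; apply: ler_sum => n _; rewrite /v -mulr_sumr.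
have kx : 0 <= kaluza n * x ^+ n by apply: mulr_ge0 => //; exact: exprn_ge0.
rewrite ler_wpM2l//.
by apply: le_trans (wsum_iter_shift_le n g N) _; exact: wsum_le_energy.
Qed.

(** Here y = |p(w)|, t = |g(0)|, s = |1 + p(w) g(0)|^2, P and G are the energies of p and g, and X
    is that of p + p(w) g, decomposed along p and along g. Eliminating the two remainders leaves y G
    <= t P, multiplied by y. *)
Lemma two_decompositions (y t s P G X E1 E2 : R) :
  X = s * P + y ^+ 2 * E1 -> X = 2 ^+ 2 * y ^+ 2 * G + E2 ->
  G = t ^+ 2 * P + E1 -> P = y ^+ 2 * G + E2 -> s * P <= (1 + y * t) ^+ 2 * P ->
  y * (y * G) <= y * (t * P).
Proof.
move=> h1 h2 h3 h4.
have e1 : E1 = G - t ^+ 2 * P by lra.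
have e2 : E2 = P - y ^+ 2 * G by lra.
have -> : s * P = 2 * (y * (y * G)) + P + y ^+ 2 * (t ^+ 2 * P).
  have -> : s * P = X - y ^+ 2 * E1 by lra.
  by rewrite h2 e1 e2; ring.
have -> : (1 + y * t) ^+ 2 * P = P + 2 * (y * (t * P)) + y ^+ 2 * (t ^+ 2 * P) by ring.
by lra.
Qed.

(** Eliminating r and U gives q^2 G <= (1 - k) P; multiplication by K yields q^2 / 2 <= q^2 G K <=
    P. The 2 is the price of truncating the kernel. *)
Lemma pick_bound (q r P G U k K : R) : 0 <= q -> 0 <= r -> 0 <= P -> 0 <= G -> 0 <= K ->
  q * G <= r * P -> r ^+ 2 * P <= U -> U <= (1 - k) * G -> 2^-1 <= G * K ->
  K * (1 - k) <= 1 -> q ^+ 2 <= 2 * P.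
Proof.
move=> q0 r0 P0 G0 K0 qr rU UG GK Kk.
have Gp : 0 < G.
  rewrite lt_neqAle G0 andbT; apply/eqP => e; move: GK; rewrite -e mul0r; lra.
have main : q ^+ 2 * G <= (1 - k) * P.
  rewrite -(ler_pM2r Gp).
  have h : (q * G) ^+ 2 <= (r * P) ^+ 2 by rewrite ler_pXn2r ?nnegrE ?mulr_ge0.
  have -> : q ^+ 2 * G * G = (q * G) ^+ 2 by ring.
  apply: le_trans h _.
  have -> : (r * P) ^+ 2 = r ^+ 2 * P * P by ring.
  have -> : (1 - k) * P * G = (1 - k) * G * P by ring.
  by rewrite ler_wpM2r// (le_trans rU).
have h1 := ler_wpM2r K0 main; have h2 := ler_wpM2r P0 Kk.
have h3 := ler_wpM2l (sqr_ge0 q) GK.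
have e1 : q ^+ 2 * G * K = q ^+ 2 * (G * K) by ring.
have e2 : (1 - k) * P * K = K * (1 - k) * P by ring.
by lra.
Qed.

(* With [g] the minimizer for the value 1 at [w], the function [u] equal to [g]
   minus [pick_sum w M g] still vanishes on [Z], has [u(0) = g(0)], and energy at
   most [(1 - k) * energy g]; comparing [u] with the multiple [g(0) * p] of [p]
   bounds [g(0)], and hence [p(w)], since [g(0) * energy p] and
   [conjc (p(w)) * energy g] are both the inner product of [g] and [p]. *)
Theorem minimal_bounded Z p w : Z `<=` [set z | modulus z < 1] -> minimal Z 0 p ->
  modulus w < 1 -> modulus (ev p w) ^+ 2 <= 2 * energy p.
Proof.
move=> Z1 pm w1; have [[ep p0 pZ] _] := pm.
have z01 : modulus (0 : C) < 1 by rewrite modulus0.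
have P0 := energy_ge0 ep.
have [pw0|pw0] := eqVneq (ev p w) 0.
  by rewrite pw0 modulus0 expr0n mulr_ge0.
have [g gm] : exists g, minimal Z w g.
  apply: (@minimal_exists R Z w ((ev p w)^-1 *: p) Z1 w1); split; first exact: ellZ.
    by rewrite evZr// mulVf.
  by move=> z Zz; have z1 : modulus z < 1 := Z1 z Zz; rewrite evZr// (pZ z Zz) mulr0.
have [[eg gw gZ] _] := gm.
have G0 := energy_ge0 eg.
(* A long partial sum of g(w) = 1 has modulus at least 3/4, and (3/4)^2 > 1/2; [sqr_sum_ev_le] then
   brings in the truncated kernel. *)
have [M M0 hM] : exists2 M, (0 < M)%N &
    2^-1 <= energy g * \sum_(n < M) (modulus w ^+ 2) ^+ n / n.+1%:R.
  have /tendsP /(_ (4^-1)) [|N hN] := ev_tends (ell_radius1 eg) w1; first by rewrite invr_gt0.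
  exists N.+1 => //; have := hN N.+1 (leqnSn N); rewrite gw => h.
  apply: (@le_trans _ _ ((\sum_(n < N.+1) modulus (g n) * modulus w ^+ n) ^+ 2)).
    have h1 : 3/4 <= \sum_(n < N.+1) modulus (g n) * modulus w ^+ n.
      apply: (@le_trans _ _ (modulus (\sum_(i < N.+1) g i * w ^+ i))).
        move: h; set y := \sum_(i < _) _ => h.
        have := modulusD y (1 - y); rewrite addrC subrK modulus1 (modulusB 1 y); lra.
      apply: le_trans (modulus_sum _ _ _) _; apply: ler_sum => n _.
      by rewrite modulusM modulusX.
    by move: (\sum_(n < _) _) h1 => y h1; nra.
  apply: le_trans (sqr_sum_ev_le g w N.+1) _; rewrite ler_wpM2r ?wsum_le_energy//.
  by apply: sumr_ge0 => i _; rewrite divr_ge0// exprn_ge0// sqr_ge0.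
set x := modulus w ^+ 2 in hM.
have x0 : 0 <= x by exact: sqr_ge0.
have KK := kaluza_kernel_le x0 M0.
set K := \sum_(n < M) x ^+ n / n.+1%:R in hM KK.
set k := \sum_(n < M) kaluza n * x ^+ n in KK.
have K0 : 0 <= K by apply: sumr_ge0 => i _; apply: divr_ge0 => //; exact: exprn_ge0.
pose T := pick_sum w M g.
have eT : ell T by exact: ell_pick_sum.
have Tw : ev T w = k%:C.
  rewrite ev_pick_sum// gw mulr1 /k rmorph_sum /=; apply: eq_bigr => n _.
  by rewrite [RHS]rmorphM /= [in RHS]rmorphXn /= -mulrA -exprMn (mulrC (conjc w)) mulcJ.
have T0 : ev T 0 = 0.
  rewrite ev_pick_sum// big1 ?mul0r// => -[[|n] hn] _ /=.
    by rewrite kaluza0 !mul0r.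
  by rewrite expr0n mulr0.
have TZ z : Z z -> ev T z = 0.
  by move=> Zz; rewrite ev_pick_sum ?gZ ?mulr0//; exact: Z1.
have TE := energy_decomp Z1 w1 gm eT TZ.
have TG : energy T <= k * energy g by exact: energy_pick_sum.
rewrite Tw modulus_real real_normK ?num_real// in TE.
pose u := g - T.
have eu : ell u by exact: ellB.
have uZ z : Z z -> ev u z = 0.
  by move=> Zz; have z1 : modulus z < 1 := Z1 z Zz; rewrite evBr// gZ// TZ// subrr.
have uw : ev u w = (1 - k)%:C by rewrite evBr// gw Tw rmorphB.
have u0 : ev u 0 = ev g 0 by rewrite evBr// T0 subr0.
have uE := energy_decomp Z1 w1 gm eu uZ.
rewrite uw modulus_real real_normK ?num_real// in uE.
have uT : u - (1 - k)%:C *: g = (-1) *: (T - k%:C *: g).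
  by rewrite /u rmorphB scalerBl scale1r scaleN1r !opprB addrC addrA subrK.
rewrite uT energyZ ?modulusN ?modulus1 ?expr1n ?mul1r in uE; last first.
  by apply: ellB => //; exact: ellZ.
(* With G = E(g): E(u) = (1 - k)^2 G + E(T - k g) and E(T) = k^2 G + E(T - k g), so E(u) = (1 - 2 k)
   G + E(T), while E(T) <= k G. *)
have uG : energy u <= (1 - k) * energy g.
  by rewrite uE; move: TE TG; move: (energy T) (energy (T - _)) => a b; lra.
have pu := minimal_le Z1 z01 pm eu uZ; rewrite u0 in pu.
pose q := ev p w; pose r := ev g 0.
have qr : modulus q * energy g <= modulus r * energy p.
  have eqg := ellZ q eg.
  have epg : ell (p + q *: g) by exact: ellD.
  have pgZ z : Z z -> ev (p + q *: g) z = 0.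
    move=> Zz; have z1 : modulus z < 1 := Z1 z Zz.
    by rewrite evDr// evZr// pZ// gZ// mulr0 addr0.
  have e1 := energy_decomp Z1 z01 pm epg pgZ.
  have e2 := energy_decomp Z1 w1 gm epg pgZ.
  have e3 := energy_decomp Z1 z01 pm eg gZ.
  have e4 := energy_decomp Z1 w1 gm ep pZ.
  rewrite evDr// evZr// p0 -/r in e1; rewrite evDr// evZr// gw mulr1 -/q in e2.
  rewrite -/r in e3; rewrite -/q in e4.
  have f1 : p + q *: g - (1 + q * r) *: p = q *: (g - r *: p).
    by rewrite scalerDl scale1r opprD addrACA subrr add0r scalerBr scalerA.
  have f2 : p + q *: g - (q + q) *: g = p - q *: g.
    by rewrite scalerDl opprD addrA addrK.
  rewrite f1 energyZ in e1; last by apply: ellB => //; exact: ellZ.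
  rewrite f2 -mulr2n -mulr_natl modulusM modulus_nat exprMn in e2.
  have m1 : modulus (1 + q * r) <= 1 + modulus q * modulus r.
    by have := modulusD 1 (q * r); rewrite modulus1 modulusM.
  have m2 : modulus (1 + q * r) ^+ 2 <= (1 + modulus q * modulus r) ^+ 2.
    by rewrite ler_pXn2r ?nnegrE ?modulus_ge0// addr_ge0// mulr_ge0 ?modulus_ge0.
  have q0 : 0 < modulus q by rewrite modulus_gt0.
  have m3 := ler_wpM2r P0 m2.
  by rewrite -(ler_pM2l q0); exact: (two_decompositions e1 e2 e3 e4 m3).
exact: (pick_bound (modulus_ge0 q) (modulus_ge0 r) P0 G0 K0 qr pu uG hM KK).
Qed.

End BoundednessOfMinimizers.

(** * Zero sets *)

Section ZeroSets.
Variable R : realType.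
Local Notation C := R[i].
Local Notation mu2 := ((@lebesgue_measure R) \x (@lebesgue_measure R))%E.
Implicit Types (f : C -> C) (a b p : nat -> C) (z w : C) (Z S : set C).

Lemma deriv_seq_term a n :
  modulus (deriv_seq a n) ^+ 2 / n.+1%:R = n.+1%:R * modulus (a n.+1) ^+ 2.
Proof.
rewrite /deriv_seq modulusM modulus_nat exprMn.
have n0 : n.+1%:R != 0 :> R by rewrite pnatr_eq0.
by move: (n.+1%:R) n0 (modulus _ ^+ _) => x x0 y; field.
Qed.

Lemma ell_area_finite a : ell a ->
  (\int[mu2]_(p in disc 1) (modulus (ev (deriv_seq a) (cplx p)) ^+ 2)%:E < +oo)%E.
Proof.
move=> ea; apply: (@le_lt_trans _ _ (disc_area R * energy a)%:E); last exact: ltry.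
apply: area_ev_le; first by apply: radius1_deriv; exact: ell_radius1.
move=> K; apply: le_trans (wsum_le_energy K.+1 ea).
rewrite /wsum big_ord_recl /= -[leLHS]add0r; apply: lerD; first by rewrite mul1r sqr_ge0.
apply: ler_sum => n _; rewrite deriv_seq_term ler_wpM2r ?sqr_ge0// ler_nat.
exact: leqW.
Qed.

(** Up to a constant factor, a_n contributes n |a_n|^2 to the area integral: this misses a_0, and
    for n >= 1 it is at least half of (n + 1) |a_n|^2. *)
Lemma area_finite_ell a : radius1 a ->
  (\int[mu2]_(p in disc 1) (modulus (ev (deriv_seq a) (cplx p)) ^+ 2)%:E < +oo)%E -> ell a.
Proof.
move=> ra /(area_ev_ge (radius1_deriv ra))[S hS].
exists (modulus (a 0%N) ^+ 2 + 2 * S) => N.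
apply: le_trans (wsum_nondecreasing a (leqnSn N)) _.
rewrite /wsum big_ord_recl /= mul1r lerD2l.
apply: le_trans (ler_wpM2l _ (hS N)) => //; rewrite mulr_sumr; apply: ler_sum => n _.
rewrite deriv_seq_term [leRHS]mulrA -[bump 0 n]/(n.+1) ler_wpM2r ?sqr_ge0// -natrM ler_nat; lia.
Qed.

Lemma derive1_ev f a z : radius1 a -> (forall z, modulus z < 1 -> f z = ev a z) ->
  modulus z < 1 -> cdiff f z (ev (deriv_seq a) z).
Proof.
move=> ra fa z1; apply: (@cdiff_ext _ (ev a) f z _ (1 - modulus z)); last exact: ev_cdiff.
  by rewrite subr_gt0.
move=> h hh; rewrite fa//; apply: le_lt_trans (modulusD _ _) _.
by move: hh; rewrite ltrBrDl.
Qed.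

Lemma dirichlet_area_ev f a : radius1 a -> (forall z, modulus z < 1 -> f z = ev a z) ->
  (\int[mu2]_(p in disc 1) (modulus (derive1 f (cplx p)) ^+ 2)%:E =
   \int[mu2]_(p in disc 1) (modulus (ev (deriv_seq a) (cplx p)) ^+ 2)%:E)%E.
Proof.
move=> ra fa; apply: eq_integral => p /set_mem p1.
by rewrite (cdiff_derive1 (derive1_ev ra fa p1)).
Qed.

Lemma dirichlet_space_ell f : dirichlet_space f ->
  exists2 a, ell a & forall z, modulus z < 1 -> f z = ev a z.
Proof.
move=> [fA fI].
have [|a [ra fa]] := @analytic_power_series R f.
  by move=> z /unit_discE z1; exists (derive1 f z); apply: derivable_cdiff; exact: fA.
exists a => //; apply: area_finite_ell => //; rewrite -(dirichlet_area_ev ra fa).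
exact/dirichlet_integral_finite.
Qed.

Lemma ell_dirichlet_space a : ell a -> dirichlet_space (ev a).
Proof.
move=> ea; have ra := ell_radius1 ea; split.
  by move=> z /unit_discE z1; exact: cdiff_derivable (ev_cdiff ra z1).
apply/dirichlet_integral_finite; rewrite (dirichlet_area_ev ra)//.
exact: ell_area_finite.
Qed.

(** The coefficients of the product come from [analytic_power_series]; their energy is controlled by
    integrating |u'v + uv'|^2 <= 2 |v|^2 |u'|^2 + 2 |u|^2 |v'|^2 over the disc. *)
Lemma ell_mul a b (K L : R) : ell a -> ell b -> 
  (forall z, modulus z < 1 -> modulus (ev a z) ^+ 2 <= K) ->
  (forall z, modulus z < 1 -> modulus (ev b z) ^+ 2 <= L) ->
  exists2 d, ell d & forall z, modulus z < 1 -> ev d z = ev a z * ev b z.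
Proof.
move=> ea eb aK bL; have ra := ell_radius1 ea; have rb := ell_radius1 eb.
pose f z := ev a z * ev b z.
have df z : modulus z < 1 ->
    cdiff f z (ev (deriv_seq a) z * ev b z + ev a z * ev (deriv_seq b) z).
  by move=> z1; apply: cdiffM; exact: ev_cdiff.
have [|d [rd fd]] := @analytic_power_series R f.
  by move=> z z1; eexists; exact: df.
exists d; last by move=> z z1; rewrite -fd.
have K0 : 0 <= K by apply: le_trans (aK 0 _); rewrite ?sqr_ge0// modulus0.
have L0 : 0 <= L by apply: le_trans (bL 0 _); rewrite ?sqr_ge0// modulus0.
apply: area_finite_ell => //.
have md c : radius1 c -> measurable_fun (disc (1 : R))
    (fun x : R * R => (modulus (ev (deriv_seq c) (cplx x)) ^+ 2)%:E).
  by move=> rc; apply/measurable_EFinP; apply: ev_plane_measurable; exact: radius1_deriv.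
have m1 : measurable (disc (1 : R)) by exact: measurable_disc.
have pos c (x : R * R) : disc (1 : R) x -> (0 <= (modulus (ev (deriv_seq c) (cplx x)) ^+ 2)%:E)%E.
  by move=> _; rewrite lee_fin sqr_ge0.
have mk (k : R) c : radius1 c -> measurable_fun (disc (1 : R))
    (fun p : R * R => (k%:E * (modulus (ev (deriv_seq c) (cplx p)) ^+ 2)%:E)%E).
  by move=> rc; apply: measurable_funeM; exact: md.
apply: (@le_lt_trans _ _ (\int[mu2]_(p in disc 1)
  ((2 * L)%:E * (modulus (ev (deriv_seq a) (cplx p)) ^+ 2)%:E +
   (2 * K)%:E * (modulus (ev (deriv_seq b) (cplx p)) ^+ 2)%:E))%E).
  apply: ge0_le_integral => //.
  - by move=> x; exact: pos.
  - exact: md.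
  - by apply: emeasurable_funD; exact: mk.
  move=> x x1; rewrite -!EFinM -EFinD lee_fin.
  rewrite -(cdiff_unique (df _ x1) (derive1_ev rd fd x1)).
  move: (aK _ x1) (bL _ x1); move: (ev a _) (ev b _) (ev (deriv_seq a) _) (ev (deriv_seq b) _).
  move=> u v u' v' uK vL; have := modulusD (u' * v) (u * v'); rewrite !modulusM => h.
  have h2 : modulus (u' * v + u * v') ^+ 2 <= (modulus u' * modulus v + modulus u * modulus v') ^+ 2.
    by rewrite ler_pXn2r ?nnegrE ?modulus_ge0// addr_ge0// mulr_ge0 ?modulus_ge0.
  apply: le_trans h2 _.
  have := ler_wpM2r (sqr_ge0 (modulus v')) uK; have := ler_wpM2r (sqr_ge0 (modulus u')) vL.
  move: (modulus u) (modulus v) (modulus u') (modulus v') => s t s' t'.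
  by have := sqr_ge0 (s' * t - s * t'); rewrite sqrrB sqrrD !exprMn; lra.
rewrite ge0_integralD//; last 4 first.
- by move=> x x1; apply: mule_ge0; [rewrite lee_fin mulr_ge0|rewrite lee_fin sqr_ge0].
- exact: mk.
- by move=> x x1; apply: mule_ge0; [rewrite lee_fin mulr_ge0|rewrite lee_fin sqr_ge0].
- exact: mk.
rewrite !ge0_integralZl_EFin//; try exact: md; try exact: mulr_ge0; try by move=> x; exact: pos.
by rewrite lte_add_pinfty// lte_mul_pinfty ?lee_fin ?mulr_ge0//; exact: ell_area_finite.
Qed.

(** The given functions may be unbounded; the minimizers that replace them satisfy the bounds
    required by [ell_mul]. *)
Lemma adm_union (Z1 Z2 : set C) : Z1 `<=` [set z | modulus z < 1] ->
  Z2 `<=` [set z | modulus z < 1] -> (exists a, adm Z1 0 a) -> (exists a, adm Z2 0 a) ->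
  exists a, adm (Z1 `|` Z2) 0 a.
Proof.
move=> h1 h2 [a1 A1] [a2 A2]; have z01 : modulus (0 : C) < 1 by rewrite modulus0.
have [p pm] := minimal_exists h1 z01 A1; have [q qm] := minimal_exists h2 z01 A2.
have [[ep p0 pZ] _] := pm; have [[eq q0 qZ] _] := qm.
have bp z : modulus z < 1 -> modulus (ev p z) ^+ 2 <= 2 * energy p by exact: minimal_bounded pm.
have bq z : modulus z < 1 -> modulus (ev q z) ^+ 2 <= 2 * energy q by exact: minimal_bounded qm.
have [d ed dE] := ell_mul ep eq bp bq.
exists d; split=> //; first by rewrite dE// p0 q0 mulr1.
by move=> z [zZ|zZ]; [have z1 := h1 z zZ|have z1 := h2 z zZ]; rewrite (dE z z1) ?(pZ z zZ) ?(qZ z zZ) ?mul0r ?mulr0.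
Qed.

(** When 0 lies in S, the minimizer for the rest of S is multiplied by z; the new zero at 0 is
    simple because p(0) = 1. *)
Lemma adm_zero_set S : S `<=` unit_disc -> (exists a, adm (S `\ 0) 0 a) -> dirichlet_zero_set S.
Proof.
move=> Sd [a aA]; split=> //; have z01 : modulus (0 : C) < 1 by rewrite modulus0.
have S1 : S `\ 0 `<=` [set z | modulus z < 1].
  by move=> z [/Sd/unit_discE z1 _].
have [p pm] := minimal_exists S1 z01 aA; have [[ep p0 pZ] _] := pm.
have rp := ell_radius1 ep.
have mz := fun w => @minimal_zero R _ p w S1 pm.
have [S0|S0] := pselect (S 0); last first.
  exists (ev p); split; first exact: ell_dirichlet_space.
  - move=> z Sz; have z1 : modulus z < 1 by apply/unit_discE; exact: Sd.
    have pz : ev p z = 0 by apply: pZ; split=> // z0; apply: S0; rewrite -z0.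
    have [_ dz] := mz z z1 pz; split; first by case.
    by rewrite /derive1n /= (cdiff_derive1 (ev_cdiff rp z1)).
  - move=> z [/unit_discE z1 nSz]; apply/eqP => pz; apply: nSz.
    by have [[]] := mz z z1 pz.
have es := ell_shift ep; have rs := ell_radius1 es.
have sE z : modulus z < 1 -> ev (shift_seq p) z = z * ev p z by exact: ev_shift.
exists (ev (shift_seq p)); split; first exact: ell_dirichlet_space.
- move=> z Sz; have z1 : modulus z < 1 by apply/unit_discE; exact: Sd.
  have dd : derive1 (ev (shift_seq p)) z = ev p z + z * ev (deriv_seq p) z.
    apply: cdiff_derive1; apply: (@cdiff_ext _ (fun w => id w * ev p w) _ _ _ (1 - modulus z)).
    + by rewrite subr_gt0.
    + move=> h hh; rewrite sE//; apply: le_lt_trans (modulusD _ _) _.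
      by move: hh; rewrite ltrBrDl.
    + by have := cdiffM (cdiff_id z) (ev_cdiff rp z1); rewrite mul1r.
  have [z0|z0] := eqVneq z 0.
    split; last by rewrite /derive1n /= dd z0 p0 mul0r addr0 oner_eq0.
    by case=> // _; rewrite /derive1n /= sE// z0 mul0r.
  have pz : ev p z = 0 by apply: pZ; split=> // e; rewrite e eqxx in z0.
  have [_ dz] := mz z z1 pz; split.
    by case=> // _; rewrite /derive1n /= sE// pz mulr0.
  by rewrite /derive1n /= dd pz add0r mulf_neq0.
- move=> z [/unit_discE z1 nSz]; rewrite sE//; apply: mulf_neq0.
    by apply/eqP => z0; apply: nSz; rewrite z0.
  by apply/eqP => pz; apply: nSz; have [[]] := mz z z1 pz.
Qed.

Lemma zero_set_adm S : ~ S 0 -> dirichlet_zero_set S -> exists a, adm S 0 a.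
Proof.
move=> nS0 [Sd [f [fD fS fnz]]]; have [a ea fa] := dirichlet_space_ell fD.
have z01 : modulus (0 : C) < 1 by rewrite modulus0.
have f0 : ev a 0 != 0 by rewrite -fa//; apply: fnz; split=> //; apply/unit_discE.
exists ((ev a 0)^-1 *: a); split; first exact: ellZ.
- by rewrite evZr// mulVf.
- move=> z Sz; have z1 : modulus z < 1 by apply/unit_discE; exact: Sd.
  have [/(_ 0%N isT) fz _] := fS z Sz.
  have {}fz : f z = 0 := fz.
  by rewrite evZr// -(fa z z1) fz mulr0.
Qed.

End ZeroSets.

(** * Ideals of subsets of the disc and their accumulation points *)

Section Accumulation.
Variable R : realType.
Local Notation C := R[i].
Implicit Types (a : nat -> C) (z w : C) (Z S X : set C) (I : set C -> Prop).

(* The complements of the members of the ideal [I] form a filter, which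
   clusters by compactness. *)
Lemma ideal_accumulation I X :
  I set0 -> (forall A B, A `<=` B -> I B -> I A) -> (forall A B, I A -> I B -> I (A `|` B)) ->
  X `<=` [set z | modulus z < 1] -> ~ I X ->
  exists zeta, forall e : R, 0 < e -> ~ I (X `&` [set z | modulus (z - zeta) < e]).
Proof.
move=> I0 IS IU X1 nIX.
pose co (U : set (R * R)) := [set z | X z /\ ~ U (complex.Re z, complex.Im z)].
pose F : set_system (R * R) := [set U | I (co U)].
have FF : ProperFilter F.
  apply: Build_ProperFilter_ex.
    move=> U FU; apply: contra_notP nIX => nU; apply: IS FU => z Xz; split=> // Uz.
    by apply: nU; eexists; exact: Uz.
  split.
  - by apply: IS I0 => z [_]; exact.
  - move=> U V FU FV; apply: IS (IU _ _ FU FV) => z [Xz nUV].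
    by have [Uz|nUz] := pselect (U (complex.Re z, complex.Im z)); [right|left]; split=> // Vz; apply: nUV.
  - by move=> U V UV; apply: IS => z [Xz nV]; split=> // /UV.
pose K := `[(-1 : R), 1]%classic `*` `[(-1 : R), 1]%classic.
have cK : compact K by apply: compact_setX; exact: segment_compact.
have FK : F K.
  apply: IS I0 => z [Xz]; apply; have z1 := X1 z Xz.
  have h1 := Re_le_modulus z; have h2 := Im_le_modulus z.
  split; rewrite /= in_itv /= -ler_norml; apply: ltW; exact: le_lt_trans z1.
have [[x y] [_ cl]] := cK F FF FK.
exists (x +i* y) => e e0 Ie.
pose V : set (R * R) := [set p | modulus (p.1 +i* p.2 - x +i* y) < e].
have FV : F (~` V).
  apply: IS Ie => z [Xz nnV]; split=> //; have := nnV.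
  by move=> /contrapT; rewrite /V /=; case: z {Xz nnV}.
have NV : nbhs (x, y) V.
  apply/nbhs_ballP; exists (e / 2); first by rewrite /= divr_gt0.
  move=> [u v] [/= hu hv]; rewrite /V /=; apply: le_lt_trans (modulus_le_ReIm _) _ => /=.
  move: hu hv; rewrite /ball /= ![`|_ - u|]distrC ![`|_ - v|]distrC; lra.
by have [p [nVp Vp]] := cl _ _ FV NV.
Qed.

Lemma nbhs_modulus z (U : set C) : nbhs z U <->
  exists2 e : R, 0 < e & forall w, modulus (w - z) < e -> U w.
Proof.
split=> [/nbhs_ballP[e /= e0 h]|[e e0 h]].
  have [x x0 xe] := gt0_complexE e0; exists x => // w hw; apply: h.
  by rewrite /ball /= xe normE ltcR modulusB.
apply/nbhs_ballP; exists e%:C; first by rewrite /= ltcR.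
by move=> w; rewrite /ball /= normE ltcR modulusB => hw; exact: h.
Qed.

Lemma tends_cvg (u : nat -> C) l : tends u l -> u @ \oo --> l.
Proof.
move=> /tendsP h U /nbhs_modulus[e e0 hU]; have [N hN] := h e e0.
by exists N => // n /= Nn; apply: hU; exact: hN.
Qed.

Lemma not_limit_point S z : ~ limit_point S z ->
  exists2 e : R, 0 < e & S `&` [set w | modulus (w - z) < e] `<=` [set z].
Proof.
move=> /existsNP[U /not_implyP[/nbhs_modulus[e e0 h] nU]]; exists e => // w [Sw we].
apply: contrapT => wz; apply: nU; exists w; split=> //; last exact: h.
by apply/eqP.
Qed.

(** Bolzano-Weierstrass, obtained from [ideal_accumulation] for the ideal of finite sets. *)
Lemma discrete_finite S (r : R) : limit_point S `&` unit_disc = set0 -> r < 1 ->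
  finite_set (S `&` [set z | modulus z <= r]).
Proof.
move=> Sd r1; apply: contrapT => nf.
have [|||||zeta hz] := @ideal_accumulation (@finite_set C) (S `&` [set z | modulus z <= r]).
- exact: finite_set0.
- by move=> A B AB; exact: sub_finite_set.
- by move=> A B fA fB; rewrite finite_setU.
- by move=> z [_ zr]; exact: le_lt_trans r1.
- exact: nf.
have [zr|rz] := leP (modulus zeta) r; last first.
  apply: (hz (modulus zeta - r)); first by rewrite subr_gt0.
  apply: (@sub_finite_set _ _ set0) => // z [[_ /= zr] hd].
  have := modulusD (zeta - z) z; rewrite subrK modulusB => h.
  have : modulus zeta < modulus zeta by apply: le_lt_trans h _; lra.
  by rewrite ltxx.
have [|e e0 h] := @not_limit_point S zeta.
  move=> lz; have : (limit_point S `&` unit_disc) zeta.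
    by split=> //; apply/unit_discE; exact: le_lt_trans r1.
  by rewrite Sd.
apply: (hz e e0); apply: (sub_finite_set _ (finite_set1 zeta)) => z [[Sz _] ze].
by apply: h.
Qed.

(** Intersecting with the disc gives an ideal on all subsets of the plane, the form that
    [ideal_accumulation] takes. *)
Definition admissible Z := exists a, adm (Z `&` [set z | modulus z < 1]) 0 a.

Lemma admissibleS (A B : set C) : A `<=` B -> admissible B -> admissible A.
Proof.
by move=> AB [a [ea a0 aB]]; exists a; split=> // z [Az z1]; apply: aB; split=> //; exact: AB.
Qed.

Lemma admissibleU (A B : set C) : admissible A -> admissible B -> admissible (A `|` B).
Proof.
by move=> hA hB; rewrite /admissible setIUl; apply: adm_union => // z [].
Qed.

Definition unit_seq n : C := (n == 0%N)%:R.

Lemma ell_unit_seq : ell unit_seq.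
Proof.
exists 1 => -[|N]; first by rewrite /wsum big_ord0.
rewrite /wsum big_ord_recl /= mul1r /unit_seq eqxx modulus1 expr1n big1 ?addr0// => n _.
by rewrite /= modulus0 expr0n mulr0.
Qed.

Lemma ev_unit_seq z : modulus z < 1 -> ev unit_seq z = 1.
Proof.
move=> z1; have r1 := ell_radius1 ell_unit_seq.
have h := tendsS (ev_tends r1 z1); apply: (tends_unique h); apply: tends_ext (tends_cst 1) => n.
rewrite big_ord_recl /= expr0 mulr1 /unit_seq eqxx big1 ?addr0// => i _.
by rewrite mul0r.
Qed.

Lemma admissible0 : admissible set0.
Proof.
exists unit_seq; split; [exact: ell_unit_seq|by apply: ev_unit_seq; rewrite modulus0|].
by move=> z [].
Qed.

(** The witness is 1 - w / z as a function of w; removing 0 makes the case z = 0 vacuous. *)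
Lemma admissible1 z : admissible ([set z] `\ 0).
Proof.
have [->|z0] := eqVneq z 0; first by apply: admissibleS admissible0 => w [].
have e1 := ell_unit_seq; have es := ell_shift e1; have ezs := ellZ (- z^-1) es.
have E w : modulus w < 1 -> ev (unit_seq + (- z^-1) *: shift_seq unit_seq) w = 1 - z^-1 * w.
  by move=> w1; rewrite evDr// evZr// ev_shift ?ev_unit_seq ?mulr1 ?mulNr//; exact: ell_radius1.
exists (unit_seq + (- z^-1) *: shift_seq unit_seq); split; first exact: ellD.
  by rewrite E ?modulus0// mulr0 subr0.
by move=> w [[-> _] w1]; rewrite E// mulVf// subrr.
Qed.

Lemma finite_admissible Z : finite_set Z -> admissible (Z `\ 0).
Proof.
move=> /finite_seqP[s ->]; elim: s => [|z s IH].
  by apply: admissibleS admissible0 => z [].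
apply: admissibleS (admissibleU (admissible1 z) IH) => w [/=].
by rewrite inE => /orP[/eqP ->|ws] w0; [left|right].
Qed.

(** Weak compactness along an exhaustion by discs; the bound K common to all of them is what lets
    the functions converge. *)
Lemma admissible_exhaustion Z (K : R) :
  (forall n, exists2 a, adm (Z `&` [set z | modulus z <= 1 - n.+1%:R^-1]) 0 a & energy a <= K) ->
  admissible Z.
Proof.
move=> h; have z01 : modulus (0 : C) < 1 by rewrite modulus0.
have i0 n : 0 < n.+1%:R^-1 :> R by rewrite invr_gt0 ltr0n.
have [|//|||a [aA _ _]] := @adm_limit R (fun n => Z `&` [set z | modulus z <= 1 - n.+1%:R^-1]) 0 K.
- by move=> n z [_ hz]; apply: le_lt_trans hz _; rewrite ltrBlDr ltrDl.
- move=> n z [Zz /= hz]; split=> //=; apply: le_trans hz _.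
  by rewrite lerD2l lerN2 lef_pV2 ?posrE ?ltr0n// ler_nat.
- exact: h.
exists a; case: aA => ea a0 aZ; split=> // z [Zz z1]; apply: aZ.
have q0 : 0 < 1 - modulus z by rewrite subr_gt0.
pose n := Num.bound (1 - modulus z)^-1.
exists n => //; split=> //=; rewrite lerBrDr -lerBrDl.
rewrite -[leRHS]invrK lef_pV2 ?posrE ?ltr0n ?invr_gt0//.
apply: le_trans (ltW (archi_boundP _)) _; first by rewrite invr_ge0 ltW.
by rewrite ler_nat.
Qed.

End Accumulation.

(** * Choice of finite pieces near the accumulation point and their enumeration *)

Theorem theorem1p2 (R : realType) (S : set R[i])
    (S_disc : S `<=` unit_disc)
    (S_discrete : limit_point S `&` unit_disc = set0)
    (S_not_zero_set : ~ dirichlet_zero_set S) :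
  exists z : nat -> R[i],
    [/\ forall n, S (z n),
        exists2 zeta : R[i], unit_circle zeta & z @ \oo --> zeta &
        ~ dirichlet_zero_set (range z)].
Proof.
have S1 z : S z -> modulus z < 1 by move=> /S_disc/unit_discE.
pose X := S `\ 0.
have X1 : X `<=` [set z | modulus z < 1] by move=> z [/S1].
have XI Z : Z `<=` X -> Z `&` [set z | modulus z < 1] = Z.
  by move=> ZX; apply/seteqP; split=> [z []//|z Zz]; split=> //; exact: X1 (ZX z Zz).
have nX : ~ admissible X.
  by move=> hX; apply: S_not_zero_set; apply: adm_zero_set => //; move: hX; rewrite /admissible XI.
have [zeta hzeta] := ideal_accumulation (@admissible0 R) (@admissibleS R) (@admissibleU R) X1 nX.
pose B (k : nat) := X `&` [set z | modulus (z - zeta) < k.+1%:R^-1].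
have k0 (k : nat) : 0 < k.+1%:R^-1 :> R by rewrite invr_gt0 ltr0n.
(* If |zeta| > 1, a small neighbourhood misses X; if |zeta| < 1, discreteness leaves at most the
   point zeta in it. Both traces are admissible. *)
have zeta1 : modulus zeta = 1.
  apply/eqP; rewrite eq_le; apply/andP; split.
    rewrite leNgt; apply/negP => z1.
    apply: (hzeta (modulus zeta - 1)); first by rewrite subr_gt0.
    apply: admissibleS (@admissible0 R) => z [Xz /= hd].
    have := modulusD (zeta - z) z; rewrite subrK modulusB => h.
    have : modulus zeta < modulus zeta by apply: le_lt_trans h _; have := X1 z Xz => /=; lra.
    by rewrite ltxx.
  rewrite leNgt; apply/negP => z1.
  have [|e e0 h] := @not_limit_point R S zeta.
    move=> lz; have : (limit_point S `&` unit_disc) zeta by split=> //; apply/unit_discE.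
    by rewrite S_discrete.
  apply: (hzeta e e0); apply: admissibleS (admissible1 zeta) => z [[Sz z0] ze].
  by split=> //; apply: h.
(* Otherwise the part of [B k] in each disc has a function of energy at most k, and
   [admissible_exhaustion] makes [B k] admissible. *)
have /choice[m hm] : forall k, exists n : nat, forall a,
    adm (B k `&` [set z | modulus z <= 1 - n.+1%:R^-1]) 0 a -> k%:R < energy a.
  move=> k; apply: contrapT => /forallNP h; apply: (hzeta _ (k0 k)).
  apply: (@admissible_exhaustion R _ k%:R) => n.
  have /existsNP[a /not_implyP[aA /negP]] := h n.
  by rewrite -leNgt => ak; exists a.
pose F k := B k `&` [set z | modulus z <= 1 - (m k).+1%:R^-1].
pose P := \bigcup_k F k.
have PX : P `<=` X by move=> z [k _ [[]]].
have P0 : ~ P 0 by move=> /PX[_]; apply.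
(* A function for P serves every [F k], so its energy exceeds every k; k is taken above that
   energy. *)
have nP : ~ exists a, adm P 0 a.
  move=> [a [ea a0 aP]]; have := hm (Num.bound (energy a)) a.
  have /ltW h := archi_boundP (energy_ge0 ea).
  apply/not_implyP; split; last by apply/negP; rewrite -leNgt.
  by split=> // z Fz; apply: aP; exists (Num.bound (energy a)).
have fF k : finite_set (F k).
  have r1 : 1 - (m k).+1%:R^-1 < 1 :> R by rewrite ltrBlDr ltrDl.
  apply: sub_finite_set (discrete_finite S_discrete r1) => z [[[Sz _] _] zr].
  by split.
(* Finite sets without 0 are admissible, so P is infinite and has an injective enumeration, whose
   injectivity gives the convergence below. *)
have iP : ~ finite_set P.
  move=> fP; apply: nP; have := finite_admissible fP.
  have -> : P `\ 0 = P by apply/seteqP; split=> [z []//|z Pz]; split=> // z0; apply: P0; rewrite -z0.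
  by rewrite /admissible XI.
have cP : countable P by apply: bigcup_countable => // k _; exact: finite_set_countable.
have /card_esym/card_set_bijP[z [zP zinj zsurj]] := eq_card_nat cP iP.
have zPn n : P (z n) by exact: zP.
exists z; split.
- by move=> n; have [] := PX _ (zPn n).
- exists zeta; first by rewrite /unit_circle /= normE zeta1.
  apply/tends_cvg/tendsP => e e0.
  (* For k >= K the set [F k] lies within e of zeta, so a term at distance at least e belongs to one
     of the finite sets [F k] with k < K; by injectivity only finitely many indices are
     concerned. *)
  pose K := Num.bound e^-1.
  have fQ : finite_set (\bigcup_(k in `I_K) F k) by apply: bigcup_finite => // ; exact: finite_II.
  have fN : finite_set (z @^-1` (\bigcup_(k in `I_K) F k)).
    apply: finite_preimage fQ => x y _ _; apply: zinj; exact: in_setT.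
  have [s hs] := (finite_seqP _).1 fN.
  exists (\max_(i <- s) i).+1 => n hn; rewrite ltNge; apply/negP => en.
  have [k _ Fk] := zPn n.
  have kK : (k < K)%N.
    rewrite ltnNge; apply/negP => Kk; case: (Fk) => [[_ /=]] + _.
    apply/negP; rewrite -leNgt; apply: le_trans en.
    rewrite -[leRHS]invrK lef_pV2 ?posrE ?ltr0n ?invr_gt0//.
    apply: le_trans (ltW (archi_boundP _)) _; first by rewrite invr_ge0 ltW.
    by rewrite ler_nat; exact: leqW.
  have : (z @^-1` (\bigcup_(k in `I_K) F k)) n by exists k.
  rewrite hs /= => ns; move: hn; rewrite ltnNge => /negP; apply.
  exact: leq_bigmax_seq.
- have -> : range z = P.
    by apply/seteqP; split=> [_ [n _ <-]//|w /zsurj[n _ <-]]; exists n.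
  by move=> /(zero_set_adm P0).
Qed.
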